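(* Let $q_0\in(0,1)$ and let $f:[0,\infty)\to[0,1]$ be nonincreasing with $0<\sup\{a: f(a)>0\}<\infty$. Then $\lambda_{q_0 f}>\lambda_f$, where $q_0 f$ denotes the connection function $r\mapsto q_0 f(r)$.
   Context: For $\lambda>0$, $\mathscr{P}_\lambda$ is a homogeneous Poisson point process of intensity $\lambda$ in $\mathbb{R}^2$. Given a connection function $g:[0,\infty)\to[0,1]$, the random connection model $RCM(\lambda,g)$ is the random graph with vertex set $\mathscr{P}_\lambda$ in which each pair of vertices $x,y$ is joined by an edge with probability $g(|x-y|)$, independently of all other pairs. When $0<\int_0^\infty r g(r)\,dr<\infty$ there is a critical intensity $\lambda_g\in(0,\infty)$ such that for $\lambda>\lambda_g$ the graph $RCM(\lambda,g)$ a.s. has an infinite connected component and for $\lambda<\lambda_g$ a.s. it has none. *)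

(* Defs.v *)
From HB Require Import structures.
From mathcomp Require Import all_boot all_order all_algebra.
From mathcomp Require Import all_classical all_reals all_analysis.
From Stdlib Require Import Relations.
Set Implicit Arguments. Unset Strict Implicit. Unset Printing Implicit Defensive.
Import Order.TTheory GRing.Theory Num.Theory.
Local Open Scope classical_set_scope.
Local Open Scope ring_scope.

(** * Random connection model in R^2, built from independent primitives.

   The Poisson point process of intensity [lam] in R^2 is realised in the
   standard way: R^2 is tiled by the unit cells [k1,k1+1] x [k2,k2+1]
   ((k1,k2) in Z^2); cell (k1,k2) contains N_(k1,k2) ~ Poisson(lam) points,
   the i-th of which (i < N) has independent coordinates uniform on
   [k1,k1+1] and [k2,k2+1].  A point is labelled (k1,k2,i).  Each unordered
   pair of labels {a,b} carries an independent Uniform[0,1] variable U_{a,b};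
   a and b are joined iff U_{a,b} < g(|x_a - x_b|), which happens with
   probability g(|x_a - x_b|), independently of everything else. *)

Definition label := (int * int * nat)%type.

(** index set of the primitive real random variables:
    - inl (inl (k1,k2))     : the number of points in cell (k1,k2)
    - inl (inr (a, c))      : coordinate c (true = first, false = second) of point a
    - inr (a, b)            : the edge variable of the pair {a,b} (used with a
                              canonical ordering of the pair) *)
Definition idx := (((int * int) + (label * bool)) + (label * label))%type.

Definition cell_count (k : int * int) : idx := inl (inl k).
Definition coord (a : label) (c : bool) : idx := inl (inr (a, c)).
Definition edge_var (a b : label) : idx :=
  if (pickle a < pickle b)%N then inr (a, b) else inr (b, a).

Definition cell_lo {R : realType} (a : label) (c : bool) : R :=
  let: (k1, k2, _) := a in (if c then k1 else k2)%:~R.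

Definition mutually_independent {d} {T : measurableType d} {R : realType}
  (P : probability T R) (I : eqType) (Y : I -> T -> R) : Prop :=
  forall (s : seq I) (B : I -> set R), uniq s -> (forall i, measurable (B i)) ->
    P (\big[setI/setT]_(i <- s) (Y i @^-1` B i)) =
    (\prod_(i <- s) P (Y i @^-1` B i))%E.

Definition rcm_model {d} {T : measurableType d} {R : realType}
  (P : probability T R) (lam : R) (Y : idx -> T -> R) : Prop :=
  [/\ (forall i, measurable_fun setT (Y i)),
      (forall k (n : nat), P (Y (cell_count k) @^-1` [set n%:R]) = (poisson_pmf lam n)%:E),
      (forall a c (B : set R), measurable B ->
         P (Y (coord a c) @^-1` B) =
         lebesgue_measure (B `&` `[cell_lo a c, cell_lo a c + 1]%classic)),
      (forall a b (B : set R), measurable B ->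
         P (Y (inr (a, b)) @^-1` B) = lebesgue_measure (B `&` `[0, 1]%classic))
    & mutually_independent P Y].

Definition is_vertex {T} {R : realType} (Y : idx -> T -> R) (w : T) (a : label) : Prop :=
  let: (k1, k2, i) := a in (i%:R < Y (cell_count (k1, k2)) w).

Definition pdist {T} {R : realType} (Y : idx -> T -> R) (w : T) (a b : label) : R :=
  Num.sqrt ((Y (coord a true) w - Y (coord b true) w) ^+ 2 +
            (Y (coord a false) w - Y (coord b false) w) ^+ 2).

Definition rcm_adj {T} {R : realType} (g : R -> R) (Y : idx -> T -> R) (w : T)
  (a b : label) : Prop :=
  [/\ a <> b, is_vertex Y w a, is_vertex Y w b &
      Y (edge_var a b) w < g (pdist Y w a b)].

Definition infinite_component {T} {R : realType} (g : R -> R) (Y : idx -> T -> R) : set T :=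
  [set w | exists a, is_vertex Y w a /\
     infinite_set [set b | clos_refl_trans label (rcm_adj g Y w) a b]].

Definition almost_surely {d} {T : measurableType d} {R : realType}
  (P : probability T R) (E : set T) : Prop :=
  exists A, [/\ measurable A, A `<=` E & P A = 1%E].

Definition critical_intensity {R : realType} (g : R -> R) (lc : R) : Prop :=
  [/\ 0 < lc,
      (forall lam : R, lc < lam ->
         forall (d : measure_display) (T : measurableType d) (P : probability T R)
                (Y : idx -> T -> R),
           rcm_model P lam Y -> almost_surely P (infinite_component g Y))
    & (forall lam : R, 0 < lam -> lam < lc ->
         forall (d : measure_display) (T : measurableType d) (P : probability T R)
                (Y : idx -> T -> R),
           rcm_model P lam Y -> almost_surely P (~` infinite_component g Y))].

(* Main.v *)
(** Let [mu] be the critical intensity for [q0 f] and suppose [mu <= lam_f]. On one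
    probability space we build a model [Y1] of intensity [mu + delta] and a model [Y2] of
    intensity [mu - delta] such that every infinite component of [Y1] for [q0 f] yields one
    of [Y2] for [f]; since [mu + delta] percolates for [q0 f] and [mu - delta] does not for
    [f], this is absurd.

    Call a cell crowded if it has more than [K] points in [Y1]. An edge of [Y1] is an edge
    for [f] subject to two independent vetoes, each absent with probability [sqrt q0]. Hence
    the last point of an uncrowded cell is isolated by its own vetoes with a probability
    [eps = r ^ K] for some [r > 0], and [Y2] may do without it: this leaves room for a
    smaller intensity in [Y2]. Part of that room pays for nets: with probability [nu] of
    order [eps] up to a power of [K], a cell of [Y2] receives [g ^ 2] additional points, one
    in each square of a fine grid. A crowded cell of [Y1] requests nets in all
    cells within range, the positions of their points and the openness of all their edges,
    so that in [Y2] the whole neighbourhood is connected through the net whatever [Y1] does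
    there. The number of requests is linear in [K], so granting all of them has probability at
    least [exp (- C K)], which exceeds the superexponentially small probability of being
    crowded once [K] is large. The required inequalities are strict at [delta = 0], hence
    hold for small [delta]. *)

Require Import Defs.
From HB Require Import structures.
From mathcomp Require Import all_boot all_order all_algebra.
From mathcomp Require Import all_classical all_reals all_analysis measurable_realfun.
From mathcomp Require Import ring lra zify.
From Stdlib Require Import Relations.
Import Defs.
Set Implicit Arguments. Unset Strict Implicit. Unset Printing Implicit Defensive.
Import Order.TTheory GRing.Theory Num.Theory.
Import numFieldNormedType.Exports.
Local Open Scope classical_set_scope.
Local Open Scope ring_scope.

(** Only the two marginal laws must be exact: the models may depend on each other in any way, but
    within each of them all variables must be independent. This shapes the encoding. Vetoes are
    directed, with separate variables for [v] against [u] and for [u] against [v]; hence the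
    isolation of a point reads only vetoes issued from its own cell, and the counts of model 2 stay
    independent. The bound [K] is forced because isolation must be decided without reading the
    counts of the neighbouring cells: all labels that may occur there have to be vetoed. Requests
    form a table indexed by resource and requesting cell, with one uniform variable per entry. A
    cell is crowded only if it makes all its requests, a resource is granted as soon as some cell
    requests it. Grouped by cell, the table yields independent crowding in model 1; grouped by
    resource, it yields independent nets, positions and edges in model 2; and crowded cells obtain
    all they request by construction. *)

(** * Independence of generated sigma-algebras *)

Section Independence.
Context d (T : measurableType d) (R : realType) (P : probability T R).

Definition independent_systems (I : eqType) (F : I -> set_system T) :=
  forall (s : seq I) (A : I -> set T), uniq s -> (forall i, F i (A i)) ->
    P (\big[setI/setT]_(i <- s) A i) = (\prod_(i <- s) P (A i))%E.

Lemma bigsetI_measurable_seq (I : eqType) (s : seq I) (A : I -> set T) :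
  (forall i, i \in s -> measurable (A i)) ->
  measurable (\big[setI/setT]_(i <- s) A i).
Proof.
move=> mA; rewrite big_seq; apply: big_ind => //; exact: measurableI.
Qed.

(** Dynkin's argument, upgrading one index at a time from [F i] to its generated sigma-algebra: [s1]
    lists the upgraded indices, [s2] those still in the generating systems. With the other events
    fixed, both sides are finite measures in [A i] that agree on the pi-system [F i]. *)
Lemma independent_sigma (I : eqType) (F : I -> set_system T) :
  (forall i, setI_closed (F i)) -> (forall i, F i `<=` measurable) ->
  (forall i, F i setT) -> independent_systems F ->
  independent_systems (fun i => <<s F i >>).
Proof.
move=> FI Fm FT Find.
have sFm i : <<s F i >> `<=` measurable.
  exact: smallest_sub (@sigma_algebra_measurable _ T) (Fm i).
suff H (s1 s2 : seq I) (A : I -> set T) : uniq (s1 ++ s2) ->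
    (forall i, i \in s1 -> <<s F i >> (A i)) ->
    (forall i, i \in s2 -> F i (A i)) ->
    P (\big[setI/setT]_(i <- s1 ++ s2) A i) = (\prod_(i <- s1 ++ s2) P (A i))%E.
  by move=> s A us sA; have := H s [::] A; rewrite !cats0; apply.
elim: s1 s2 A => [|i s1 IH] s2 A /=.
  (* [independent_systems] wants a set of [F i] at every index, so the indices outside [s2] receive
     [setT]. *)
  move=> us _ FA; pose A' i := if i \in s2 then A i else setT.
  have := Find s2 A' us; rewrite /A'.
  rewrite (@eq_big_seq _ _ _ _ s2 _ A) => [|j ->//].
  rewrite (@eq_big_seq _ _ _ _ s2 _ (fun j => P (A j))) => [|j ->//].
  by apply=> j; case: ifPn => // /FA.
move=> /andP[is12 us] sA FA.
rewrite !big_cons.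
set E := \big[setI/setT]_(j <- _) A j.
have mE : measurable E.
  apply: bigsetI_measurable_seq => j; rewrite mem_cat => /orP[js|js].
    by apply: (sFm j); apply: sA; rewrite in_cons js orbT.
  by apply: (Fm j); apply: FA.
have sA' j : j \in s1 -> <<s F j >> (A j) by move=> js; apply: sA; rewrite in_cons js orbT.
have PE : P E = (\prod_(j <- s1 ++ s2) P (A j))%E by exact: IH.
rewrite -PE.
have fE : P E \is a fin_num by exact: fin_num_measure.
have e0 : 0 <= fine (P E) by exact: fine_ge0.
pose m2 := mscale (NngNum e0) P.
have m2E B : m2 B = (P E * P B)%E by rewrite -[in RHS](fineK fE).
have sAi : <<s F i >> (A i) by apply: sA; rewrite in_cons eqxx.
rewrite muleC -m2E -[LHS]/(mrestr P mE (A i)).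
apply: (g_sigma_algebra_measure_unique (F i) _ (fun=> setT)) => //.
- by rewrite bigcup_const.
- move=> B FB; rewrite -[RHS]/(m2 B) m2E -[LHS]/(P (B `&` E)).
  pose A' j := if j == i then B else A j.
  have ni j : j \in s1 ++ s2 -> (j == i) = false.
    by move=> js; apply/negbTE/eqP => ji; rewrite -ji js in is12.
  have := IH (i :: s2) A'.
  have per : perm_eq (s1 ++ i :: s2) (i :: s1 ++ s2) by rewrite -cat1s perm_catCA.
  rewrite (perm_uniq per) /= is12 us !(perm_big _ per) /= !big_cons /A' eqxx.
  rewrite (@eq_big_seq _ _ _ _ (s1 ++ s2) _ A) => [|j /ni ->//].
  rewrite (@eq_big_seq _ _ _ _ (s1 ++ s2) _ (fun j => P (A j))) => [|j /ni ->//].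
  rewrite -/E -PE => ->.
  + by rewrite muleC.
  + by [].
  + move=> j js; rewrite ni ?mem_cat ?js //; exact: sA'.
  + move=> j; rewrite in_cons; case: eqP => [->//|_ /= js]; exact: FA.
- move=> _; rewrite -[ltLHS]/(P (setT `&` E)) setTI.
  exact: le_lt_trans (probability_le1 P mE) (ltry 1).
Qed.

Lemma independent_systems_reindex (I J : eqType) (F : J -> set_system T)
    (h : I -> J) : (forall j, F j setT) -> injective h -> independent_systems F ->
  independent_systems (F \o h).
Proof.
move=> FT hinj Fi s A us FA.
pose A' j := if pselect (exists i, h i = j) is left e then A (projT1 (cid e)) else setT.
have A'h i : A' (h i) = A i.
  rewrite /A'; case: pselect => [e|[]]; last by exists i.
  by case: cid => k /= /hinj ->.
have := Fi [seq h i | i <- s] A'; rewrite map_inj_uniq// !big_map.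
rewrite (eq_bigr A) => [|j _]; last exact: A'h.
rewrite (eq_bigr (fun j => P (A j))) => [|j _]; last by rewrite A'h.
apply=> // j; rewrite /A'; case: pselect => // e; case: cid => x /= <-; exact: FA.
Qed.

End Independence.

(** * Functions of disjoint blocks of independent variables *)

Section Blocks.
Context d (T : measurableType d) (R : realType) (P : probability T R).
Context (J I : eqType) (xi : J -> T -> R) (own : J -> I).

Definition block_cylinders (i : I) : set_system T :=
  [set A | exists (s : seq J) (B : J -> set R),
     [/\ uniq s, forall j, j \in s -> own j = i, forall j, measurable (B j)
       & A = \big[setI/setT]_(j <- s) (xi j @^-1` B j)]].

Definition block_sigma (i : I) : set_system T := <<s block_cylinders i >>.

(** Measurability on this type expresses that a function of the sample point reads only the
    variables owned by [i]. *)
Definition blockType (i : I) := g_sigma_algebraType (block_cylinders i).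

Lemma bigsetI_seqP (K : eqType) (s : seq K) (F : K -> set T) w :
  (\big[setI/setT]_(j <- s) F j) w <-> forall j, j \in s -> F j w.
Proof.
elim: s => [|k s IH]; first by rewrite big_nil; split.
rewrite big_cons; split=> [[Fk /IH Fs] j|Fs].
  by rewrite in_cons => /orP[/eqP ->|/Fs].
by split; [apply: Fs; rewrite mem_head|apply/IH => j js; apply: Fs; rewrite in_cons js orbT].
Qed.

Lemma block_cylindersI i : setI_closed (block_cylinders i).
Proof.
move=> A1 A2 [s1 [B1 [u1 o1 m1 ->]]] [s2 [B2 [u2 o2 m2 ->]]].
pose B j := (if j \in s1 then B1 j else setT) `&` (if j \in s2 then B2 j else setT).
exists (undup (s1 ++ s2)), B; split.
- exact: undup_uniq.
- by move=> j; rewrite mem_undup mem_cat => /orP[/o1|/o2].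
- by move=> j; apply: measurableI; case: ifP.
- apply/seteqP; split=> w.
    move=> [/bigsetI_seqP h1 /bigsetI_seqP h2]; apply/bigsetI_seqP => j _.
    by split=> /=; case: ifPn => // js; [exact: h1|exact: h2].
  move/bigsetI_seqP => h; split; apply/bigsetI_seqP => j js.
    have := h j; rewrite mem_undup mem_cat js => /(_ isT)[] /=; by rewrite js.
  have := h j; rewrite mem_undup mem_cat js orbT => /(_ isT)[] /= _; by rewrite js.
Qed.

Lemma block_cylindersT i : block_cylinders i setT.
Proof. by exists [::], (fun=> setT); split => //; rewrite big_nil. Qed.

Lemma block_cylinders_preimage j B : measurable B ->
  block_cylinders (own j) (xi j @^-1` B).
Proof.
move=> mB; exists [:: j], (fun=> B); split => //.
  by move=> k; rewrite mem_seq1 => /eqP ->.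
by rewrite big_seq1.
Qed.

Lemma measurable_block j : measurable_fun setT (xi j : blockType (own j) -> R).
Proof.
by move=> _ B mB; rewrite setTI; apply: sub_sigma_algebra; exact: block_cylinders_preimage.
Qed.

Hypothesis mxi : forall j, measurable_fun setT (xi j).

Lemma block_cylinders_measurable i : block_cylinders i `<=` measurable.
Proof.
move=> A [s [B [_ _ mB ->]]]; apply: bigsetI_measurable_seq => j _.
by rewrite -[X in measurable X]setTI; exact: mxi.
Qed.

Lemma block_sigma_measurable i : block_sigma i `<=` measurable.
Proof.
exact: smallest_sub (@sigma_algebra_measurable _ T) (@block_cylinders_measurable i).
Qed.

Hypothesis ixi : mutually_independent P xi.

Lemma block_cylinders_independent : independent_systems P block_cylinders.
Proof.
move=> t A ut cA.
have /choice[s /choice[B HB]] : forall i, exists s (B : J -> set R),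
     [/\ uniq s, forall j, j \in s -> own j = i, forall j, measurable (B j)
       & A i = \big[setI/setT]_(j <- s) (xi j @^-1` B j)] by move=> i; exact: cA.
have us i : uniq (s i) by case: (HB i).
have os i j : j \in s i -> own j = i by case: (HB i) => _ + _ _; apply.
have mB i j : measurable (B i j) by case: (HB i).
have AE i : A i = \big[setI/setT]_(j <- s i) (xi j @^-1` B i j) by case: (HB i).
(* A variable occurs in the list of its owner only, so the sets chosen block by block merge into a
   single family. *)
pose C j := B (own j) j.
have AC i : A i = \big[setI/setT]_(j <- s i) (xi j @^-1` C j).
  by rewrite AE; apply: eq_big_seq => j /os <-.
have uf : uniq (flatten [seq s i | i <- t]).
  elim: t ut => //= i t IH /andP[it ut]; rewrite cat_uniq us IH// andbT.
  apply/hasPn => j /flattenP[_ /mapP[k kt ->] jk]; apply/negP => /os ji.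
  by move: it; rewrite -ji (os _ _ jk) kt.
have := ixi uf (fun j => mB (own j) j).
rewrite -/(C) !big_flatten !big_map (eq_bigr A) => [->|i _]; last by rewrite AC.
apply: eq_bigr => i _; rewrite AC ixi//; by move=> j; exact: mB.
Qed.

Lemma block_independent : independent_systems P block_sigma.
Proof.
apply: independent_sigma.
- exact: block_cylindersI.
- exact: block_cylinders_measurable.
- exact: block_cylindersT.
- exact: block_cylinders_independent.
Qed.

Lemma block_sigmaT i : block_sigma i setT.
Proof. by apply: sub_sigma_algebra; exact: block_cylindersT. Qed.

Lemma measurable_block_fun i d' (T' : measurableType d') (Y : T -> T') :
  measurable_fun setT (Y : blockType i -> T') ->
  forall B, measurable B -> block_sigma i (Y @^-1` B).
Proof. by move=> mY B mB; have := mY measurableT B mB; rewrite setTI. Qed.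

Lemma block_mutually_independent (Y : I -> T -> R) :
  (forall i, measurable_fun setT (Y i : blockType i -> R)) ->
  mutually_independent P Y.
Proof.
move=> mY s B us mB; apply: block_independent => // i.
exact: measurable_block_fun.
Qed.

Lemma block_measurable_fun i d' (T' : measurableType d') (Y : T -> T') :
  measurable_fun setT (Y : blockType i -> T') -> measurable_fun setT Y.
Proof.
move=> mY _ B mB; rewrite setTI; apply: (@block_sigma_measurable i).
exact: measurable_block_fun.
Qed.

End Blocks.

(** * Uniform laws, and independence tested on rays *)

Section UniformLaw.
Context d (T : measurableType d) (R : realType) (P : probability T R).

Definition uniform01 (Y : T -> R) :=
  forall B : set R, measurable B ->
    P (Y @^-1` B) = lebesgue_measure (B `&` `[0, 1]%classic).

Lemma measurable_preimage (Y : T -> R) (B : set R) :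
  measurable_fun setT Y -> measurable B -> measurable (Y @^-1` B).
Proof. by move=> mY mB; rewrite -[X in measurable X]setTI; exact: mY. Qed.

Lemma lebesgue_ray_itv (c x : R) : 0 <= x <= 1 ->
  lebesgue_measure (`]-oo, c + x[%classic `&` `[c, c + 1]%classic : set R) = x%:E.
Proof.
move=> /andP[x0 x1].
have -> : `]-oo, c + x[%classic `&` `[c, c + 1]%classic = `[c, c + x[%classic :> set R.
  apply/seteqP; split=> y /=; rewrite !in_itv /=.
    by move=> [yx /andP[y0 _]]; rewrite y0.
  by move=> /andP[y0 yx]; rewrite yx y0 (le_trans (ltW yx))// lerD2l.
rewrite lebesgue_measure_itv /= lte_fin ltrDl.
by case: ltgtP x0 => // [x0 _|<- _]; first by rewrite -EFinD addrAC subrr add0r.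
Qed.

Lemma lebesgue_unit_itv (c : R) : lebesgue_measure (`[c, c + 1]%classic : set R) = 1%E.
Proof. by rewrite lebesgue_measure_itv/= lte_fin ltrDl ltr01 -EFinD addrAC subrr add0r. Qed.

Lemma lebesgue01 : lebesgue_measure (`[0, 1]%classic : set R) = 1%E.
Proof. by have := lebesgue_unit_itv 0; rewrite add0r. Qed.

Lemma uniform01_lt Y x : uniform01 Y -> 0 <= x <= 1 ->
  P (Y @^-1` `]-oo, x[%classic) = x%:E.
Proof.
by move=> uY x01; rewrite uY//; have := lebesgue_ray_itv 0 x01; rewrite !add0r.
Qed.

Lemma uniform_itv_cdf (c : R) (Y : T -> R) : measurable_fun setT Y ->
  (forall x, 0 <= x <= 1 -> P (Y @^-1` `]-oo, c + x[%classic) = x%:E) ->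
  forall B : set R, measurable B ->
    P (Y @^-1` B) = lebesgue_measure (B `&` `[c, c + 1]%classic).
Proof.
move=> mY cY.
pose X : {mfun T >-> measurableTypeR R} := HB.pack (Y : T -> measurableTypeR R) (isMeasurableFun.Build _ _ T (measurableTypeR R) Y mY).
pose m2 := mrestr (@lebesgue_measure R) (measurable_itv `[c, c + 1]).
move=> B mB.
have fl : forall x : R, measurable (`]-oo, x[%classic `&` `[c, c + 1]%classic : set R).
  by move=> x; apply: measurableI; exact: measurable_itv.
have -> : lebesgue_measure (B `&` `[c, c + 1]%classic) = m2 B by [].
have -> : P (Y @^-1` B) = distribution P X B by [].
have uniq := @measure_unique _ R (measurableTypeR R) (@RGenInftyO.G R)
  (fun n => `]-oo, n%:R[%classic) _ _ _ _ (distribution P X) m2 _ _ B mB.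
apply: uniq => //.
- exact: RGenInftyO.measurableE.
- move=> _ _ [x ->] [y ->]; exists (Num.min x y).
  apply/seteqP; split=> z /=; rewrite !in_itv/= lt_min; first by move=> [-> ->].
  by move=> /andP[].
- by move=> n; exists n%:R.
- apply/seteqP; split => // x _; exists (Num.truncn x).+1 => //=.
  rewrite in_itv/=; exact: truncnS_gt.
- move=> _ [x ->].
  rewrite -[LHS]/(P (Y @^-1` _)) -[RHS]/(lebesgue_measure (_ `&` _)).
  have mpre y := measurable_preimage mY (measurable_itv `]-oo, y[).
  have c0 : P (Y @^-1` `]-oo, c[%classic) = 0%E.
    by have := cY 0; rewrite addr0; apply; rewrite lexx ler01.
  have l0 : lebesgue_measure (`]-oo, c[%classic `&` `[c, c + 1]%classic : set R) = 0%E.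
    by have := @lebesgue_ray_itv c 0; rewrite addr0; apply; rewrite lexx ler01.
  have [x0|x0] := ltP x c.
    have sub : `]-oo, x[ `<=` (`]-oo, c[ : set R).
      by move=> y /=; rewrite !in_itv/= => /lt_trans; apply.
    have -> : P (Y @^-1` `]-oo, x[%classic) = 0%E.
      apply/eqP; rewrite eq_le measure_ge0 andbT.
      rewrite -[leRHS]c0; apply: le_measure; rewrite ?inE//.
      by move=> w; exact: sub.
    apply/esym/eqP; rewrite eq_le measure_ge0 andbT.
    rewrite -[leRHS]l0; apply: le_measure; rewrite ?inE//.
    - exact: fl.
    - exact: fl.
    - by move=> y [yx y01]; split => //; exact: sub.
  have [x1|x1] := leP x (c + 1).
    have -> : x = c + (x - c) by rewrite addrC subrK.
    have xc : 0 <= x - c <= 1 by rewrite subr_ge0 x0 lerBlDl.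
    by rewrite cY// lebesgue_ray_itv.
  have sub : `]-oo, (c + 1)[ `<=` (`]-oo, x[ : set R).
    by move=> y /=; rewrite !in_itv/= => /lt_trans; apply.
  transitivity (1 : \bar R)%E.
    apply/eqP; rewrite eq_le probability_le1//=.
    rewrite -[leLHS](cY 1) ?lexx ?ler01//; apply: le_measure; rewrite ?inE//.
    by move=> w; exact: sub.
  rewrite setIidr ?lebesgue_unit_itv//.
  by move=> y /=; rewrite !in_itv/= => /andP[_ /le_lt_trans]; apply.
- by move=> k; apply: (le_lt_trans (probability_le1 _ _) (ltry 1)).
Qed.

Lemma uniform01_cdf (Y : T -> R) : measurable_fun setT Y ->
  (forall x, 0 <= x <= 1 -> P (Y @^-1` `]-oo, x[%classic) = x%:E) ->
  uniform01 Y.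
Proof.
move=> mY cY B mB; have := @uniform_itv_cdf 0 Y mY _ B mB; rewrite add0r; apply.
by move=> x x01; rewrite add0r cY.
Qed.

Lemma uniform01_shift (c : R) (Y : T -> R) : measurable_fun setT Y -> uniform01 Y ->
  forall B : set R, measurable B ->
    P ((fun w => c + Y w) @^-1` B) = lebesgue_measure (B `&` `[c, c + 1]%classic).
Proof.
move=> mY uY; apply: uniform_itv_cdf; first exact: measurable_funD.
move=> x x01; rewrite -(uniform01_lt uY x01); congr (P _).
by apply/seteqP; split=> w /=; rewrite !in_itv/= ltrD2l.
Qed.

End UniformLaw.

Section RayIndependence.
Context d (T : measurableType d) (R : realType) (P : probability T R).

(** Rays together with [setT] form a pi-system generating the Borel sets; indices carrying [setT]
    drop out of both sides, which leaves the hypothesis on rays. *)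
Lemma independent_rays (I : eqType) (Y : I -> T -> R) :
  (forall i, measurable_fun setT (Y i)) ->
  (forall (s : seq I) (x : I -> R), uniq s ->
    P (\big[setI/setT]_(i <- s) (Y i @^-1` `]-oo, x i[%classic)) =
    (\prod_(i <- s) P (Y i @^-1` `]-oo, x i[%classic))%E) ->
  mutually_independent P Y.
Proof.
move=> mY rY.
pose F i : set_system T := [set A | A = setT \/ exists x, A = Y i @^-1` `]-oo, x[%classic].
have FT i : F i setT by left.
have Fm i : F i `<=` measurable.
  by move=> A [->//|[x ->]]; exact: measurable_preimage.
have FI i : setI_closed (F i).
  move=> A B [->|[x ->]]; first by rewrite setTI.
  move=> [->|[y ->]]; first by rewrite setIT; right; exists x.
  right; exists (Num.min x y); apply/seteqP; split=> w /=; rewrite !in_itv/= lt_min.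
    by move=> [-> ->].
  by move=> /andP[].
have Fi : independent_systems P F.
  move=> s A us FA.
  have /choice[x hx] : forall i, exists x : option R,
      A i = if x is Some r then Y i @^-1` `]-oo, r[%classic else setT.
    by move=> i; case: (FA i) => [->|[r ->]]; [exists None|exists (Some r)].
  have e1 : \big[setI/setT]_(i <- s) A i = \big[setI/setT]_(i <- s | isSome (x i)) A i.
    rewrite [RHS]big_mkcond; apply: eq_bigr => i _; rewrite hx; by case: (x i).
  have e2 : (\prod_(i <- s) P (A i) = \prod_(i <- s | isSome (x i)) P (A i))%E.
    rewrite [RHS]big_mkcond; apply: eq_bigr => i _; rewrite hx; case: (x i) => //=.
    by rewrite probability_setT.
  rewrite e1 e2 -big_filter -[RHS]big_filter.
  have := rY [seq i <- s | x i] (fun i => odflt 0 (x i)) (filter_uniq _ us).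
  rewrite (@eq_big_seq _ _ _ _ _ _ A) => [->|i]; last first.
    by rewrite mem_filter hx => /andP[]; case: (x i).
  by apply: eq_big_seq => i; rewrite mem_filter hx => /andP[]; case: (x i).
have := independent_sigma FI Fm FT Fi.
move=> sFi s B us mB; apply: sFi => // i.
suff mYi : measurable_fun setT (Y i : g_sigma_algebraType (F i) -> R).
  by have := mYi measurableT _ (mB i); rewrite setTI.
apply: (measurability _ (RGenInftyO.measurableE R)) => //.
move=> A [_ [x ->] <-]; rewrite setTI.
by apply: sub_sigma_algebra; right; exists x.
Qed.

Lemma mutually_independent_reindex (I J : eqType) (Y : J -> T -> R) (h : I -> J) :
  injective h -> mutually_independent P Y -> mutually_independent P (Y \o h).
Proof.
move=> hinj iY s B us mB.
pose F j : set_system T := [set A | exists2 C : set R, measurable C & A = Y j @^-1` C].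
have iF : independent_systems P F.
  move=> t A ut FA.
  have /choice[C hC] : forall j, exists C : set R, measurable C /\ A j = Y j @^-1` C.
    by move=> j; case: (FA j) => C mC AC; exists C.
  have := iY t C ut (fun j => (hC j).1).
  under eq_bigr do rewrite -(hC _).2.
  by under [in RHS]eq_bigr do rewrite -(hC _).2.
have FT j : F j setT by exists setT.
apply: (independent_systems_reindex FT hinj iF) => // i.
by exists (B i).
Qed.

End RayIndependence.

(** * A countable family of independent uniform variables on the unit interval *)

Section UnitInterval.
Context (R : realType).

(** The sample space remains the whole line, with all mass on the unit interval; this avoids a
    subtype and its sigma-algebra. *)
Definition unit_lebesgue : set (measurableTypeR R) -> \bar R :=
  mrestr (@lebesgue_measure R) (measurable_itv `[0, 1]).

HB.instance Definition _ := Measure.on unit_lebesgue.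

Let unit_lebesgueT : unit_lebesgue setT = 1%E.
Proof. by rewrite /unit_lebesgue /mrestr setTI lebesgue01. Qed.

HB.instance Definition _ :=
  @Measure_isProbability.Build _ _ R unit_lebesgue unit_lebesgueT.

End UnitInterval.

Section BinaryDigits.
Context (R : realType).
Local Notation Om := (measurableTypeR R).
Local Notation P := (@unit_lebesgue R : probability Om R).

Definition first_bit (w : R) : R := if 2^-1 <= w then 1 else 0.
(** The expanding map [2 w mod 1] of the unit interval: the first bits along its orbit are the
    binary digits of [w]. *)
Definition doubling (w : R) : R := if w < 2^-1 then 2 * w else 2 * w - 1.
Definition binary_digit (n : nat) (w : R) : R := first_bit (iter n doubling w).

Lemma unit_lebesgue_itv (a b : R) (A : set R) : 0 <= a -> a <= b -> b <= 1 ->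
  A `&` `[0, 1]%classic = `[a, b[%classic -> P A = (b - a)%:E.
Proof.
move=> a0 ab b1 AE.
rewrite -[LHS]/(lebesgue_measure (A `&` `[0, 1]%classic)) AE.
rewrite lebesgue_measure_itv /= lte_fin -EFinD.
by case: ltgtP ab => // -> _; rewrite subrr.
Qed.

Lemma measurable_first_bit : measurable_fun setT (first_bit : Om -> R).
Proof.
apply: measurable_fun_ifT => //.
by apply: measurable_fun_ler.
Qed.

Lemma measurable_doubling : measurable_fun setT (doubling : Om -> R).
Proof.
apply: measurable_fun_ifT => //; first by apply: measurable_fun_ltr.
by apply: measurable_funB => //; exact: measurable_funM.
Qed.

Lemma measurable_binary_digit n : measurable_fun setT (binary_digit n : Om -> R).
Proof.
elim: n => [|n IH]; first exact: measurable_first_bit.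
rewrite (_ : binary_digit n.+1 = binary_digit n \o doubling).
  by apply: measurableT_comp => //; exact: measurable_doubling.
by apply/funext => w; rewrite /binary_digit iterSr.
Qed.

Lemma unit_lebesgue0 (A : set R) : A `&` `[0, 1]%classic = set0 -> P A = 0%E.
Proof.
by move=> A0; rewrite -[LHS]/(lebesgue_measure (A `&` `[0, 1]%classic)) A0 measure0.
Qed.

Lemma unit_lebesgue1 (A : set R) : `[0, 1[%classic `<=` A -> measurable A -> P A = 1%E.
Proof.
move=> A1 mA; apply/eqP; rewrite eq_le probability_le1//=.
have -> : 1%E = P (`[0, 1[%classic : set R).
  rewrite (@unit_lebesgue_itv 0 1) ?subr0 ?ler01//; apply/setIidPl => x /=.
  by rewrite !in_itv/= => /andP[-> /ltW ->].
by apply: le_measure; rewrite ?inE.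
Qed.

(** Inside the unit interval the preimage of [[0, x)] consists of one interval of length [x / 2] in
    each half. This gives both the invariance of the measure under [doubling] and its independence
    from the first bit. *)
Lemma first_bit_doubling_ray (x : R) : 0 <= x <= 1 ->
  [/\ P (doubling @^-1` `]-oo, x[%classic) = x%:E,
      P ([set w | first_bit w = 0] `&` doubling @^-1` `]-oo, x[%classic) = (x / 2)%:E &
      P ([set w | first_bit w = 0]) = (2^-1)%:E].
Proof.
move=> /andP[x0 x1].
have h0 : P ([set w | first_bit w = 0] `&` doubling @^-1` `]-oo, x[%classic) = (x / 2)%:E.
  rewrite (@unit_lebesgue_itv 0 (x / 2)) ?subr0//; [lra|lra|].
  apply/seteqP; split=> w /=; rewrite !in_itv/= /first_bit /doubling.
    move=> [[]]; case: (leP (2^-1) w) => [_ /= /eqP|w2 _]; first by rewrite oner_eq0.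
    by move=> hx /andP[-> _] /=; lra.
  move=> /andP[w0 wx]; have w2 : w < 2^-1 by lra.
  by rewrite w2 leNgt w2 /=; split; [split => //; lra|rewrite w0; lra].
have h1 : P ([set w | first_bit w = 1] `&` doubling @^-1` `]-oo, x[%classic) = (x / 2)%:E.
  rewrite (@unit_lebesgue_itv (2^-1) (2^-1 + x / 2)); [|lra|lra|lra|].
    by congr EFin; lra.
  apply/seteqP; split=> w /=; rewrite !in_itv/= /first_bit /doubling.
    move=> [[]]; case: (leP (2^-1) w) => [w2 _|w2 /= /esym/eqP]; last by rewrite oner_eq0.
    by move=> hx /andP[_ _]; lra.
  move=> /andP[w0 wx]; rewrite w0 [w < _]ltNge w0 /=; split; [split => //; lra|].
  apply/andP; split; lra.
have m0 c : measurable [set w : Om | first_bit w = c].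
  have -> : [set w : Om | first_bit w = c] = first_bit @^-1` [set c] by [].
  exact: (measurable_preimage measurable_first_bit).
have md : measurable (doubling @^-1` `]-oo, x[%classic : set Om).
  exact: (measurable_preimage measurable_doubling).
split=> //.
  rewrite (_ : doubling @^-1` `]-oo, x[%classic =
    ([set w | first_bit w = 0] `&` doubling @^-1` `]-oo, x[%classic) `|`
    ([set w | first_bit w = 1] `&` doubling @^-1` `]-oo, x[%classic)); last first.
    apply/seteqP; split=> w; last by move=> [[]|[]].
    by move=> hw; rewrite /setU/setI/= /first_bit; case: (leP (2^-1) w) => _; [right|left].
  rewrite measureU; [|exact: measurableI|exact: measurableI|].
    by rewrite [X in (X + _)%E]h0 [X in (_ + X)%E]h1 -EFinD; congr EFin; lra.
  apply/seteqP; split=> w //= [[-> _] [/= /esym/eqP]]; by rewrite oner_eq0.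
rewrite (@unit_lebesgue_itv 0 (2^-1)) ?subr0//; [lra|].
apply/seteqP; split=> w /=; rewrite !in_itv/= /first_bit.
  by case: (leP (2^-1) w) => [_ [/= /eqP]|w2 [_ /andP[-> _]]]; first by rewrite oner_eq0.
move=> /andP[w0 w2]; rewrite leNgt w2 w0 /=; split => //; lra.
Qed.

Lemma doubling_uniform : uniform01 P (doubling : Om -> R).
Proof.
apply: uniform01_cdf; first exact: measurable_doubling.
by move=> x /first_bit_doubling_ray[].
Qed.

Lemma doubling_preserves (A : set R) : measurable A -> P (doubling @^-1` A) = P A.
Proof. by move=> mA; rewrite doubling_uniform. Qed.

Lemma first_bit_doubling_independent (B A : set R) : measurable B -> measurable A ->
  P (first_bit @^-1` B `&` doubling @^-1` A) = (P (first_bit @^-1` B) * P A)%E.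
Proof.
move=> mB mA.
pose Y (b : bool) : Om -> R := if b then first_bit else doubling.
have mY b : measurable_fun setT (Y b).
  by case: b; [exact: measurable_first_bit|exact: measurable_doubling].
have Ywd x y : P (first_bit @^-1` `]-oo, x[%classic `&` doubling @^-1` `]-oo, y[%classic) =
    (P (first_bit @^-1` `]-oo, x[%classic) * P (doubling @^-1` `]-oo, y[%classic))%E.
  have mpx := measurable_preimage (mY true) (measurable_itv `]-oo, x[).
  have mpy := measurable_preimage (mY false) (measurable_itv `]-oo, y[).
  have [x0|x0] := leP x 0.
    rewrite (_ : first_bit @^-1` `]-oo, x[%classic = set0).
      by rewrite set0I measure0 mul0e.
    apply/seteqP; split=> w //=; rewrite in_itv/= /first_bit => hx.
    by have := lt_le_trans hx x0; case: ifP; rewrite ?ltxx// ltNge ler01.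
  have [x1|x1] := leP x 1; last first.
    rewrite (_ : first_bit @^-1` `]-oo, x[%classic = setT).
      by rewrite setTI probability_setT mul1e.
    apply/seteqP; split=> w //= _; rewrite in_itv/= /first_bit.
    by apply: le_lt_trans x1; case: ifP; rewrite ?ler01.
  have -> : first_bit @^-1` `]-oo, x[%classic = [set w | first_bit w = 0].
    apply/seteqP; split=> w /=; rewrite in_itv/= /first_bit; last by move=> ->.
    by case: (leP (2^-1) w) => // _ hx; have := lt_le_trans hx x1; rewrite ltxx.
  have [y0|y0] := ltP y 0.
    have e : P (doubling @^-1` `]-oo, y[%classic) = 0%E.
      rewrite doubling_preserves//; apply: unit_lebesgue0.
      apply/seteqP; split=> w //=; rewrite !in_itv/= => -[wy /andP[w0 _]].
      by have := lt_trans (le_lt_trans w0 wy) y0; rewrite ltxx.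
    rewrite e mule0; apply/eqP; rewrite eq_le measure_ge0 andbT -[leRHS]e.
    apply: le_measure; rewrite ?inE//; apply: measurableI => //.
    exact: (measurable_preimage measurable_first_bit (measurable_set1 0)).
  have [y1|y1] := leP y 1.
    by have [|-> -> ->] := @first_bit_doubling_ray y; [rewrite y0|rewrite -EFinM; congr EFin; lra].
  have e : P (doubling @^-1` `]-oo, y[%classic) = 1%E.
    rewrite doubling_preserves//; apply: unit_lebesgue1 => // w /=.
    by rewrite !in_itv/= => /andP[_ /lt_trans]; apply.
  rewrite e mule1.
  have mf := measurable_preimage measurable_first_bit (measurable_set1 0).
  apply/eqP; rewrite eq_le; apply/andP; split.
    by apply: le_measure; rewrite ?inE//; exact: measurableI.
  have [|_ e2 ->] := @first_bit_doubling_ray 1; first by rewrite ler01 lexx.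
  rewrite mul1r in e2; rewrite -e2; apply: le_measure; rewrite ?inE//.
  - apply: measurableI => //; exact: (measurable_preimage measurable_doubling).
  - exact: measurableI.
  - apply: setIS => w /=; rewrite !in_itv/= => /lt_trans; exact.
have iY : mutually_independent P Y.
  apply: independent_rays => // -[|b [|c [|e s]]] x /=.
  - by rewrite !big_nil probability_setT.
  - by rewrite !big_seq1.
  - rewrite !big_cons !big_nil setIT mule1.
    case: b; case: c => //= _; first by rewrite Ywd.
    by rewrite setIC Ywd muleC.
  - by rewrite !in_cons; case: b; case: c; case: e => //=; rewrite andbF.
have := iY [:: true; false] (fun b => if b then B else A) isT.
rewrite !big_cons !big_nil setIT mule1 /= => ->; last by case.
by rewrite doubling_preserves.
Qed.

(** [doubling] preserves the measure, is independent of the first bit and shifts the digits, so a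
    prefix of digits is treated by induction on its length; any finite set of digits is completed to
    a prefix by the empty condition [setT]. *)
Lemma binary_digit_independent : mutually_independent P (binary_digit : nat -> Om -> R).
Proof.
have pre N (B : nat -> set R) : (forall n, measurable (B n)) ->
    P (\big[setI/setT]_(n <- iota 0 N) (binary_digit n @^-1` B n)) =
    (\prod_(n <- iota 0 N) P (binary_digit n @^-1` B n))%E.
  elim: N B => [|N IH] B mB; first by rewrite !big_nil probability_setT.
  rewrite /= !big_cons -add1n iotaDl !big_map.
  have dd n : binary_digit (1 + n)%N @^-1` B (1 + n)%N =
      doubling @^-1` (binary_digit n @^-1` B (1 + n)%N).
    by apply/seteqP; split=> w /=; rewrite /binary_digit add1n iterSr.
  have -> : \big[setI/setT]_(n <- iota 0 N) (binary_digit (1 + n)%N @^-1` B (1 + n)%N) =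
     doubling @^-1` (\big[setI/setT]_(n <- iota 0 N) (binary_digit n @^-1` B (1 + n)%N)).
    apply/seteqP; split=> w /bigsetI_seqP h.
      by apply/bigsetI_seqP => n /h; rewrite dd.
    by apply/bigsetI_seqP => n /h; rewrite dd.
  rewrite first_bit_doubling_independent//.
    rewrite IH//; congr (_ * _)%E; apply: eq_bigr => n _.
    by rewrite dd doubling_preserves//; exact: (measurable_preimage (@measurable_binary_digit n)).
  apply: bigsetI_measurable_seq => n _.
  exact: (measurable_preimage (@measurable_binary_digit n)).
move=> s B us mB.
pose N := (\max_(n <- s) n).+1.
have sN n : n \in s -> n \in iota 0 N.
  by move=> ns; rewrite mem_iota /= add0n ltnS (big_rem n)//= leq_maxl.
pose B' n := if n \in s then B n else setT.
have mB' n : measurable (B' n) by rewrite /B'; case: ifP.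
have := pre N B' mB'.
have per : perm_eq [seq n <- iota 0 N | n \in s] s.
  apply: uniq_perm => //; first by rewrite filter_uniq ?iota_uniq.
  by move=> n; rewrite mem_filter; case: (boolP (n \in s)) => //= /sN.
have -> : \big[setI/setT]_(n <- iota 0 N) (binary_digit n @^-1` B' n) =
    \big[setI/setT]_(n <- s) (binary_digit n @^-1` B n).
  rewrite -(perm_big _ per) big_filter [RHS]big_mkcond; apply: eq_bigr => n _.
  by rewrite /B'; case: ifP.
move=> ->; rewrite -[RHS](perm_big _ per) big_filter [RHS]big_mkcond; apply: eq_bigr => n _.
rewrite /B'; case: ifP => // _; exact: probability_setT.
Qed.

Lemma binary_digit_fair n : P (binary_digit n @^-1` [set 0]) = (2^-1)%:E.
Proof.
elim: n => [|n IH].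
  by have [|_ _] := @first_bit_doubling_ray 1; first by rewrite ler01 lexx.
rewrite -IH -[RHS]doubling_preserves.
  congr (P _); apply/seteqP; split=> w /=; by rewrite /binary_digit iterSr.
exact: (measurable_preimage (@measurable_binary_digit n)).
Qed.

Lemma binary_digit01 n w : binary_digit n w = 0 \/ binary_digit n w = 1.
Proof. by rewrite /binary_digit /first_bit; case: (_ <= _); [right|left]. Qed.

End BinaryDigits.

Section UniformFamily.
Context (R : realType) (J : countType).
Local Notation Om := (measurableTypeR R).
Local Notation P := (@unit_lebesgue R : probability Om R).

(** One sequence of fair bits is dealt out along an injection of [J * nat] into the naturals; the
    bits received by [j] become the binary expansion of its uniform variable. *)
Definition digit (jm : J * nat) : Om -> R := @binary_digit R (pickle jm).

Lemma digit_independent : mutually_independent P digit.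
Proof.
have inj : injective (pickle : J * nat -> nat) by exact: (pcan_inj (@pickleK _)).
exact: (mutually_independent_reindex inj (@binary_digit_independent R)).
Qed.

Lemma measurable_digit jm : measurable_fun setT (digit jm).
Proof. exact: measurable_binary_digit. Qed.

Definition digit_term (j : J) (m : nat) (w : Om) (i : nat) : R :=
  digit (j, (m + i)%N) w / 2 ^+ i.+1.

Lemma digit_ge0 jm w : 0 <= digit jm w.
Proof. by rewrite /digit; case: (binary_digit01 (pickle jm) w) => ->; rewrite ?ler01. Qed.

Lemma digit_le1 jm w : digit jm w <= 1.
Proof. by rewrite /digit; case: (binary_digit01 (pickle jm) w) => ->; rewrite ?ler01. Qed.

Lemma digit_term_ge0 j m w i : 0 <= digit_term j m w i.
Proof. by rewrite divr_ge0 ?digit_ge0// exprn_ge0. Qed.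

Lemma digit_series_le j m w n : series (digit_term j m w) n <= 1 - 2^-1 ^+ n.
Proof.
elim: n => [|n IH]; first by rewrite /series/= big_geq// expr0 subrr.
rewrite seriesSr.
have : digit_term j m w n <= 2^-1 ^+ n.+1.
  rewrite /digit_term exprVn ler_pdivrMr ?exprn_gt0// mulVf ?digit_le1//.
move: IH; rewrite exprS; lra.
Qed.

Lemma digit_series_cvg j m w : cvgn (series (digit_term j m w)).
Proof.
apply: nondecreasing_is_cvgn.
  by apply/nondecreasing_seqP => n; rewrite seriesSr lerDl digit_term_ge0.
exists 1 => _ [n _ <-]; apply: le_trans (digit_series_le _ _ _ _) _.
by rewrite gerBl exprn_ge0 ?invr_ge0.
Qed.

(** All tails of the expansion are kept, not only the full series: each is the average of one fair
    digit and the next tail, and this self-similarity determines the distribution functions. *)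
Definition tail_value (j : J) (m : nat) (w : Om) : R := limn (series (digit_term j m w)).

Lemma tail_value_ge0 j m w : 0 <= tail_value j m w.
Proof.
apply: limr_ge; first exact: digit_series_cvg.
by apply: nearW => n; apply: sumr_ge0 => i _; exact: digit_term_ge0.
Qed.

Lemma tail_value_le1 j m w : tail_value j m w <= 1.
Proof.
apply: limr_le; first exact: digit_series_cvg.
apply: nearW => n; apply: le_trans (digit_series_le _ _ _ _) _.
by rewrite gerBl exprn_ge0 ?invr_ge0.
Qed.

Lemma tail_valueS j m w : tail_value j m w = (digit (j, m) w + tail_value j m.+1 w) / 2.
Proof.
have sE n : series (digit_term j m w) n.+1 =
    (digit (j, m) w + series (digit_term j m.+1 w) n) / 2.
  elim: n => [|n IH].
    by rewrite /series/= big_nat1 big_geq// /digit_term addn0 expr1 addr0.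
  rewrite seriesSr IH seriesSr addrA [RHS]mulrDl; congr (_ + _).
  by rewrite /digit_term addSn addnS [2 ^+ n.+2]exprS -mulrA invfM [2^-1 * _]mulrC.
apply/cvg_lim => //; rewrite -(cvg_shiftS (series _)).
under eq_fun do rewrite sE.
apply: cvgMl; apply: cvgD; first exact: cvg_cst.
exact: digit_series_cvg.
Qed.

Lemma measurable_tail_value j m (d : measure_display) (Om' : measurableType d) (h : Om' -> Om) :
  (forall i, measurable_fun setT (fun w => digit (j, (m + i)%N) (h w))) ->
  measurable_fun setT (fun w => tail_value j m (h w)).
Proof.
move=> mdig.
apply: (@measurable_fun_cvg _ _ _ _ (fun n w => series (digit_term j m (h w)) n)).
  move=> n; apply: measurable_sum => i; exact: measurable_funM.
by move=> w _; exact: digit_series_cvg.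
Qed.

Lemma measurable_tail_valueT j m : measurable_fun setT (tail_value j m).
Proof.
apply: (@measurable_tail_value j m _ Om id) => i; exact: measurable_digit.
Qed.

Lemma digit_tail_independent j m (A B : set R) : measurable A -> measurable B ->
  P (digit (j, m) @^-1` A `&` tail_value j m.+1 @^-1` B) =
  (P (digit (j, m) @^-1` A) * P (tail_value j m.+1 @^-1` B))%E.
Proof.
move=> mA mB; pose own (jm : J * nat) := jm == (j, m).
pose Y (b : bool) : Om -> R := if b then digit (j, m) else tail_value j m.+1.
have iY : mutually_independent P Y.
  apply: (block_mutually_independent (xi := digit) (own := own)).
  - exact: measurable_digit.
  - exact: digit_independent.
  - case=> /=.
      have -> : true = own (j, m) by rewrite /own eqxx.
      exact: measurable_block.
    apply: (@measurable_tail_value j m.+1 _ (blockType digit own false) id) => i.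
    have -> : false = own (j, (m.+1 + i)%N).
      by rewrite /own xpair_eqE eqxx /=; apply/esym/eqP; lia.
    exact: measurable_block.
have := iY [:: true; false] (fun b => if b then A else B) isT.
by rewrite !big_cons !big_nil setIT mule1 /= => ->//; case.
Qed.

Definition tail_cdf j m x : R := fine (P (tail_value j m @^-1` `]-oo, x[%classic)).

Lemma tail_cdfE j m x : P (tail_value j m @^-1` `]-oo, x[%classic) = (tail_cdf j m x)%:E.
Proof.
rewrite fineK// fin_num_measure//.
exact: (measurable_preimage (@measurable_tail_valueT j m)).
Qed.

Lemma tail_cdf0 j m x : x <= 0 -> tail_cdf j m x = 0.
Proof.
move=> x0; rewrite /tail_cdf (_ : _ @^-1` _ = set0) ?measure0//.
apply/seteqP; split=> w //=; rewrite in_itv/= => h.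
by have := lt_le_trans (le_lt_trans (tail_value_ge0 j m w) h) x0; rewrite ltxx.
Qed.

Lemma tail_cdf1 j m x : 1 < x -> tail_cdf j m x = 1.
Proof.
move=> x1; rewrite /tail_cdf (_ : _ @^-1` _ = setT) ?probability_setT//.
by apply/seteqP; split=> w //= _; rewrite in_itv/= (le_lt_trans (tail_value_le1 j m w)).
Qed.

Lemma tail_cdf01 j m x : 0 <= tail_cdf j m x <= 1.
Proof.
have mp := measurable_preimage (@measurable_tail_valueT j m) (measurable_itv `]-oo, x[).
by rewrite -!lee_fin -tail_cdfE measure_ge0 probability_le1.
Qed.

Lemma digit_half j m : P (digit (j, m) @^-1` [set 0]) = (2^-1)%:E /\
  P (digit (j, m) @^-1` [set 1]) = (2^-1)%:E.
Proof.
have h0 : P (digit (j, m) @^-1` [set 0]) = (2^-1)%:E by exact: binary_digit_fair.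
split=> //.
have -> : digit (j, m) @^-1` [set 1] = ~` (digit (j, m) @^-1` [set 0]).
  apply/seteqP; split=> w /=; first by move=> ->; apply/eqP; rewrite oner_eq0.
  by case: (binary_digit01 (pickle (j, m)) w).
rewrite probability_setC ?[X in (_ - X)%E]h0 -?EFinB; first by congr EFin; lra.
exact: (measurable_preimage (@measurable_digit (j, m)) (measurable_set1 0)).
Qed.

Lemma tail_cdf_rec j m x :
  tail_cdf j m x = (tail_cdf j m.+1 (2 * x) + tail_cdf j m.+1 (2 * x - 1)) / 2.
Proof.
apply: EFin_inj; rewrite -tail_cdfE.
have [h0 h1] := digit_half j m.
have md c := measurable_preimage (@measurable_digit (j, m)) (measurable_set1 c).
have mt y := measurable_preimage (@measurable_tail_valueT j m.+1) (measurable_itv `]-oo, y[).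
have -> : tail_value j m @^-1` `]-oo, x[%classic =
   (digit (j, m) @^-1` [set 0] `&` tail_value j m.+1 @^-1` `]-oo, 2 * x[%classic) `|`
   (digit (j, m) @^-1` [set 1] `&` tail_value j m.+1 @^-1` `]-oo, 2 * x - 1[%classic).
  apply/seteqP; split=> w /=; rewrite !in_itv/= (tail_valueS j m).
    by case: (binary_digit01 (pickle (j, m)) w) => dE; rewrite [digit _ _]dE => h;
      [left|right]; split=> //; lra.
  by move=> [[-> h]|[-> h]]; lra.
rewrite measureU.
- rewrite [X in (X + _)%E]digit_tail_independent//.
  rewrite [X in (_ + X)%E]digit_tail_independent//.
  by rewrite [X in (X * _ + _)%E]h0 [X in (_ + X * _)%E]h1 !tail_cdfE -!EFinM -EFinD; congr EFin; lra.
- exact: measurableI.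
- exact: measurableI.
- by apply/seteqP; split=> w //= [[-> _] [/esym/eqP]]; rewrite oner_eq0.
Qed.

(* Both cdfs satisfy F x = (F (2x) + F (2x - 1)) / 2, which contracts by 1/2 since one of
   the two terms is always trivial. *)
Lemma tail_cdf_close n j m x : 0 <= x <= 1 -> `|tail_cdf j m x - x| <= 2^-1 ^+ n.
Proof.
elim: n m x => [|n IH] m x /andP[x0 x1].
  have /andP[t0 t1] := tail_cdf01 j m x.
  by rewrite expr0 ler_norml; lra.
rewrite tail_cdf_rec exprS.
have [x2|x2] := leP x (2^-1).
  rewrite [tail_cdf _ _ (2 * x - 1)]tail_cdf0; last by lra.
  have := IH m.+1 (2 * x); rewrite !ler_norml => /(_ _)/andP[|]; lra.
rewrite [tail_cdf _ _ (2 * x)]tail_cdf1; last by lra.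
have := IH m.+1 (2 * x - 1); rewrite !ler_norml => /(_ _)/andP[|]; lra.
Qed.

Definition uniform_family (j : J) : Om -> R := tail_value j 0.

Lemma uniform_family_uniform j : uniform01 P (uniform_family j).
Proof.
apply: uniform01_cdf; first exact: measurable_tail_valueT.
move=> x x01; rewrite tail_cdfE; congr EFin; apply/eqP; rewrite -subr_eq0 -normr_le0.
have c : (2^-1 : R) ^+ n @[n --> \oo] --> 0.
  by apply: cvg_expr; rewrite ger0_norm ?invr_ge0//; lra.
rewrite -(cvg_lim (@Rhausdorff R) c); apply: limr_ge; first by apply/cvg_ex; exists 0.
by apply: nearW => n; exact: tail_cdf_close.
Qed.

Lemma uniform_family_independent : mutually_independent P uniform_family.
Proof.
apply: (block_mutually_independent (xi := digit) (own := fst)).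
- exact: measurable_digit.
- exact: digit_independent.
- move=> j; apply: (@measurable_tail_value j 0 _ (blockType digit fst j) id) => i.
  have mb := @measurable_block _ Om R (J * nat)%type J digit fst (j, (0 + i)%N).
  exact mb.
Qed.

End UniformFamily.

(** * Measurability of discrete functions; real-valued probabilities *)

Section DiscreteMeasurability.
Context d (T : measurableType d).

Lemma measurable_nat_fibers (N : T -> nat) :
  (forall n, measurable [set w | N w = n]) -> measurable_fun setT N.
Proof.
move=> mN _ B _; rewrite setTI.
rewrite (_ : _ @^-1` _ = \bigcup_(n in B) [set w | N w = n]); last first.
  by apply/seteqP; split=> [w Bw|w [n Bn /= e]]; [exists (N w)|rewrite e].
by apply: bigcup_measurable => n _; exact: mN.
Qed.

Lemma measurable_nat_fiber (N : T -> nat) n :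
  measurable_fun setT N -> measurable [set w | N w = n].
Proof. by move=> mN; have := mN measurableT [set n] Logic.I; rewrite setTI. Qed.

Lemma measurable_bool_fiber (X : T -> bool) :
  measurable_fun setT X -> measurable [set w | X w].
Proof. by move=> mX; have := mX measurableT [set true] Logic.I; rewrite setTI. Qed.

Lemma measurable_nat_select d' (T' : measurableType d') (N : T -> nat) (F : nat -> T -> T') :
  measurable_fun setT N -> (forall n, measurable_fun setT (F n)) ->
  measurable_fun setT (fun w => F (N w) w).
Proof.
move=> mN mF _ B mB; rewrite setTI.
rewrite (_ : _ @^-1` _ = \bigcup_n ([set w | N w = n] `&` F n @^-1` B)); last first.
  by apply/seteqP; split=> [w Bw|w [n _ [/= <-]]//]; exists (N w).
apply: bigcupT_measurable => n; apply: measurableI; first exact: measurable_nat_fiber.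
by have := mF n measurableT B mB; rewrite setTI.
Qed.

Lemma measurable_nat_comp d' (T' : measurableType d') (N : T -> nat) (F : nat -> T') :
  measurable_fun setT N -> measurable_fun setT (fun w => F (N w)).
Proof. by move=> mN; apply: (measurable_nat_select mN (F := fun n => cst (F n))). Qed.

Lemma measurable_all (I : eqType) (s : seq I) (X : I -> T -> bool) :
  (forall i, i \in s -> measurable_fun setT (X i)) ->
  measurable_fun setT (fun w => all (X^~ w) s).
Proof.
move=> mX; elim: s mX => [|i s IH] mX /=; first exact: measurable_cst.
apply: measurable_and; first by apply: mX; rewrite mem_head.
by apply: IH => j js; apply: mX; rewrite in_cons js orbT.
Qed.

Lemma measurable_has (I : eqType) (s : seq I) (X : I -> T -> bool) :
  (forall i, i \in s -> measurable_fun setT (X i)) ->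
  measurable_fun setT (fun w => has (X^~ w) s).
Proof.
move=> mX; elim: s mX => [|i s IH] mX /=; first exact: measurable_cst.
apply: measurable_or; first by apply: mX; rewrite mem_head.
by apply: IH => j js; apply: mX; rewrite in_cons js orbT.
Qed.

End DiscreteMeasurability.

Section RealProbability.
Context d (T : measurableType d) (R : realType) (P : probability T R).

Definition real_prob (A : set T) : R := fine (P A).

Lemma prE A : measurable A -> P A = (real_prob A)%:E.
Proof. by move=> mA; rewrite fineK// fin_num_measure. Qed.

Lemma pr_eq A x : P A = x%:E -> real_prob A = x.
Proof. by rewrite /real_prob => ->. Qed.

Lemma pr_ge0 A : 0 <= real_prob A.
Proof. exact: fine_ge0. Qed.

Lemma prC A : measurable A -> real_prob (~` A) = 1 - real_prob A.
Proof. by move=> mA; rewrite /real_prob probability_setC// prE. Qed.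

Lemma prU A B : measurable A -> measurable B -> A `&` B = set0 ->
  real_prob (A `|` B) = real_prob A + real_prob B.
Proof. move=> mA mB AB; apply: EFin_inj; rewrite -prE ?measureU ?EFinD -?prE//; exact: measurableU. Qed.

Lemma prDI A B : measurable A -> measurable B -> real_prob (A `&` ~` B) = real_prob A - real_prob (A `&` B).
Proof.
move=> mA mB; apply/eqP; rewrite eq_sym subr_eq; apply/eqP.
have mAB := measurableI _ _ mA mB; have mAC := measurableI _ _ mA (measurableC mB).
rewrite -prU// ?setIUr; first by rewrite -setIUr setUC setUv setIT.
by rewrite setIACA setIid setICl setI0.
Qed.

Lemma le_pr A B : measurable A -> measurable B -> A `<=` B -> real_prob A <= real_prob B.
Proof. by move=> mA mB AB; rewrite -lee_fin -!prE//; apply: le_measure; rewrite ?inE. Qed.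

Lemma pr_partition (A : set T) (N : T -> nat) n : measurable A -> measurable_fun setT N ->
  (forall w, N w < n)%N -> real_prob A = \sum_(i < n) real_prob (A `&` [set w | N w = i]).
Proof.
move=> mA mN Nn.
have mAN i : measurable (A `&` [set w | N w = i]).
  by apply: measurableI => //; exact: measurable_nat_fiber.
have H m : real_prob (A `&` [set w | (N w < m)%N]) = \sum_(i < m) real_prob (A `&` [set w | N w = i]).
  elim: m => [|m IH].
    rewrite big_ord0 (_ : _ `&` _ = set0) /real_prob ?measure0//.
    by apply/seteqP; split=> w // [].
  rewrite big_ord_recr/= -IH -prU//; last 2 first.
  - apply: measurableI => //.
    have := mN measurableT [set i | (i < m)%N] Logic.I; by rewrite setTI.
  - by apply/seteqP; split=> w //= [[_ lt] [_ e]]; rewrite e ltnn in lt.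
  congr real_prob; apply/seteqP; split=> w /=.
    by rewrite ltnS leq_eqVlt => -[Aw /orP[/eqP|]]; [right|left].
  by move=> [[Aw h]|[Aw ->]]; split => //; rewrite ltnS ltnW.
rewrite -H; congr real_prob; apply/seteqP; split=> w; last by case.
by move=> Aw; split => //; exact: Nn.
Qed.

Lemma pr_bool_partition (A : set T) (X : T -> bool) : measurable A -> measurable_fun setT X ->
  real_prob A = real_prob (A `&` [set w | X w]) + real_prob (A `&` [set w | ~~ X w]).
Proof.
move=> mA mX; have mX' := measurable_bool_fiber mX.
have e : [set w | ~~ X w] = ~` [set w | X w].
  by apply/seteqP; split=> w /=; [move/negP|move/negP].
by rewrite e prDI// addrC subrK.
Qed.

End RealProbability.

(** * Samplers, conditioned uniforms and the distributional transform *)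

Section UniformTools.
Context (R : realType).

Definition clamp01 (x : R) : R := Num.max 0 (Num.min x 1).

(* Uniform when [b] has probability [h] and is independent of the uniform [v]: then [b] is
   the event that the value lies in [[a, a + h]]. *)
Definition mix_uniform (a h : R) (b : bool) (v : R) : R :=
  if b then a + h * v else if (1 - h) * v < a then (1 - h) * v else (1 - h) * v + h.

Lemma mix_uniform_itv a h v : 0 <= h -> 0 <= v <= 1 -> a <= mix_uniform a h true v <= a + h.
Proof. by move=> h0 /andP[v0 v1]; rewrite /mix_uniform lerDl mulr_ge0//= lerD2l ler_piMr. Qed.

Lemma mix_uniform_ge0 a h b v : 0 <= a -> 0 <= h -> h <= 1 -> 0 <= v <= 1 -> 0 <= mix_uniform a h b v.
Proof.
move=> a0 h0 h1 /andP[v0 v1]; rewrite /mix_uniform; case: b; first by rewrite addr_ge0 ?mulr_ge0.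
have e : 0 <= (1 - h) * v by rewrite mulr_ge0// subr_ge0.
by case: ifP => // _; rewrite addr_ge0.
Qed.

Lemma measurable_mix_uniform d (T : measurableType d) a h (X : T -> bool) (V : T -> R) :
  measurable_fun setT X -> measurable_fun setT V ->
  measurable_fun setT (fun w => mix_uniform a h (X w) (V w)).
Proof.
move=> mX mV; rewrite /mix_uniform.
have m1 c : measurable_fun setT (fun w => c * V w) by exact: measurable_funM.
apply: measurable_fun_ifT => //; first exact: measurable_funD.
apply: measurable_fun_ifT => //; first exact: measurable_fun_ltr.
exact: measurable_funD.
Qed.

(* The least j with w < G (j + 1): inverts a cumulative distribution function, [G j] being
   the mass of [0, j). *)
Definition sampler (G : nat -> R) (dflt : nat) (w : R) : nat :=
  if pselect (exists j, w < G j.+1) is left e then ex_minn e else dflt.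

Lemma sampler_eq G dflt w j : {homo G : m n / (m <= n)%N >-> m <= n} ->
  G j <= w -> w < G j.+1 -> sampler G dflt w = j.
Proof.
move=> ndG Gj wG; rewrite /sampler; case: pselect => [e|[]]; last by exists j.
case: ex_minnP => m wm minm; apply/eqP; rewrite eqn_leq minm//= leqNgt; apply/negP => mj.
by have := lt_le_trans wm (ndG _ _ mj); rewrite ltNge Gj.
Qed.

Lemma samplerP G dflt w : 0 <= w -> G 0%N = 0 ->
  (G (sampler G dflt w) <= w < G (sampler G dflt w).+1) \/
  (sampler G dflt w = dflt /\ forall j, G j.+1 <= w).
Proof.
move=> w0 G0; rewrite /sampler; case: pselect => [e|ne].
  left; case: ex_minnP => m wm minm; rewrite wm andbT.
  case: m minm {wm} => [|m] minm; first by rewrite G0.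
  by rewrite leNgt; apply/negP => /minm; rewrite ltnn.
right; split=> // j; rewrite leNgt; apply/negP => h; apply: ne; by exists j.
Qed.

End UniformTools.

Ltac case_if_lra := repeat case: ifPn; rewrite -?leNgt -?ltNge; move=> *; lra.

Section UniformLaws.
Context d (T : measurableType d) (R : realType) (P : probability T R).
Local Notation pr := (real_prob P).

Lemma uniform01_pr (V : T -> R) x : measurable_fun setT V -> uniform01 P V ->
  pr (V @^-1` `]-oo, x[%classic) = clamp01 x.
Proof.
move=> mV uV; rewrite /clamp01.
have mp y := measurable_preimage mV (measurable_itv `]-oo, y[).
have [x0|x0] := ltP x 0.
  have -> : Num.max 0 (Num.min x 1) = 0 by rewrite /Num.max /Num.min; case_if_lra.
  apply/eqP; rewrite eq_le pr_ge0 andbT.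
  rewrite -[leRHS](pr_eq (uniform01_lt uV (x := 0) _)) ?lexx ?ler01//.
  by apply: le_pr => // w /=; rewrite !in_itv/= => /lt_trans; apply.
have [x1|x1] := leP x 1.
  have -> : Num.max 0 x = x by rewrite /Num.max; case_if_lra.
  by apply/pr_eq/uniform01_lt => //; rewrite x0.
have -> : Num.max 0 1 = 1 :> R by rewrite /Num.max; case_if_lra.
apply/eqP; rewrite eq_le; apply/andP; split.
  by rewrite -lee_fin -prE// probability_le1.
rewrite -[leLHS](pr_eq (uniform01_lt uV (x := 1) _)) ?lexx ?ler01//.
by apply: le_pr => // w /=; rewrite !in_itv/= => /lt_trans; apply.
Qed.

Lemma clamp01E (x : R) :
  clamp01 x = if x < 0 then 0 else if 1 < x then 1 else x.
Proof. by rewrite /clamp01 /Num.max /Num.min; case_if_lra. Qed.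

Lemma clamp01_id (x : R) : 0 <= x <= 1 -> clamp01 x = x.
Proof. by move=> /andP[x0 x1]; rewrite clamp01E; case_if_lra. Qed.

Lemma scaled_clamp01 (p x : R) : 0 < p -> p * clamp01 (x / p) =
  if x < 0 then 0 else if p < x then p else x.
Proof.
move=> p0; rewrite clamp01E ltr_pdivrMr// ltr_pdivlMr// mul0r mul1r.
case: ifP => _; first by rewrite mulr0.
by case: ifP => _; rewrite ?mulr1// mulrC divfK// gt_eqF.
Qed.

(** Given [X] the value is uniform on [[a, a + h]]. Otherwise [(1 - h) * v] sweeps an interval of
    length [1 - h], and what lies beyond [a] is pushed up by [h]: the value is uniform on the
    complement. *)
Lemma mix_uniform_law (a h : R) (X : T -> bool) (V : T -> R) :
  0 < h < 1 -> 0 <= a -> a + h <= 1 ->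
  measurable_fun setT X -> measurable_fun setT V -> uniform01 P V ->
  pr [set w | X w] = h ->
  (forall B : set R, measurable B ->
     pr ([set w | X w] `&` V @^-1` B) = pr [set w | X w] * pr (V @^-1` B)) ->
  uniform01 P (fun w => mix_uniform a h (X w) (V w)).
Proof.
move=> /andP[h0 h1] a0 ah mX mV uV prX ind.
have mW := measurable_mix_uniform a h mX mV.
have mX' := measurable_bool_fiber mX.
have mp y := measurable_preimage mV (measurable_itv `]-oo, y[).
apply: uniform01_cdf => // x /andP[x0 x1].
rewrite prE; last exact: (measurable_preimage mW).
congr EFin.
(* The length of [[0, x)] deprived of [[a, a + h)]. *)
pose c := if x <= a then x else if x <= a + h then a else x - h.
have -> : (fun w => mix_uniform a h (X w) (V w)) @^-1` `]-oo, x[%classic =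
    ([set w | X w] `&` V @^-1` `]-oo, (x - a) / h[%classic) `|`
    (V @^-1` `]-oo, c / (1 - h)[%classic `&` ~` [set w | X w]).
  apply/seteqP; split=> w /=; rewrite !in_itv/= !ltr_pdivlMr ?subr_gt0// /mix_uniform /c.
    case: (X w) => /=; first by left; split => //; lra.
    by right; split => //; move: H; case_if_lra.
  move=> [[-> hx]|[hx /negP]]; first by lra.
  by move/negbTE => ->; move: hx; case_if_lra.
rewrite prU; last first.
- by apply/seteqP; split=> w //= [[? _] [_]].
- by apply: measurableI => //; exact: measurableC.
- exact: measurableI.
rewrite ind// prDI// [X in _ + (_ - real_prob _ X)]setIC ind// prX !uniform01_pr//.
have -> : h * clamp01 ((x - a) / h) + (clamp01 (c / (1 - h)) - h * clamp01 (c / (1 - h))) =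
   h * clamp01 ((x - a) / h) + (1 - h) * clamp01 (c / (1 - h)) by lra.
rewrite !scaled_clamp01 ?subr_gt0// /c.
by case_if_lra.
Qed.

Lemma sampler_law (G : nat -> R) dflt (W : T -> R) :
  {homo G : m n / (m <= n)%N >-> m <= n} -> G 0%N = 0 -> (forall j, G j <= 1) ->
  G @ \oo --> (1 : R) ->
  measurable_fun setT W -> (forall w, 0 <= W w) -> uniform01 P W ->
  measurable_fun setT (fun w => sampler G dflt (W w)) /\
  forall j, pr [set w | sampler G dflt (W w) = j] = G j.+1 - G j.
Proof.
move=> ndG G0 G1 cG mW W0 uW.
have Gge0 j : 0 <= G j by rewrite -G0 ndG.
have mp y := measurable_preimage mW (measurable_itv `]-oo, y[).
(* On [Z] the sampler returns its default; the convergence of [G] to 1 makes [Z] null, so the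
   default does not affect the law. *)
pose Z := \bigcap_j ~` (W @^-1` `]-oo, G j.+1[%classic).
have mZ : measurable Z by apply: bigcapT_measurable => j; exact: measurableC.
have Z0 : pr Z = 0.
  apply/eqP; rewrite eq_le pr_ge0 andbT; apply/ler_addgt0Pr => e e0; rewrite add0r.
  have /cvgrPdist_lt /(_ _ e0)[N _ /(_ N.+1 (leqnSn N))] := cG.
  have := G1 N.+1; rewrite -subr_ge0 => hN; rewrite /= ger0_norm// => hlt.
  apply: le_trans (ltW hlt).
  apply: (@le_trans _ _ (pr (~` (W @^-1` `]-oo, G N.+1[%classic)))).
    by apply: le_pr => //; [exact: measurableC|move=> w; apply].
  by rewrite prC// uniform01_pr// clamp01_id ?Gge0 ?G1.
pose I j := W @^-1` `]-oo, G j.+1[%classic `&` ~` (W @^-1` `]-oo, G j[%classic).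
have mI j : measurable (I j) by apply: measurableI => //; exact: measurableC.
have fib j : [set w | sampler G dflt (W w) = j] = I j `|` (if j == dflt then Z else set0).
  apply/seteqP; split=> w /=.
    move=> <-; case: (@samplerP _ G dflt (W w)) => // [/andP[h1 h2]|[-> h]].
      by left; split; rewrite /= in_itv//=; apply/negP; rewrite -leNgt.
    by right; rewrite eqxx => i _ /=; rewrite in_itv/=; apply/negP; rewrite -leNgt.
  move=> [[/=]|]; rewrite ?in_itv/=.
    move=> h2 /negP; rewrite -leNgt => h1; exact: sampler_eq.
  case: eqP => // -> Zw; case: (@samplerP _ G dflt (W w)) => // [/andP[_ h2]|[]//].
  by have := Zw (sampler G dflt (W w)) Logic.I; rewrite /= in_itv/= h2.
have mfib j : measurable [set w | sampler G dflt (W w) = j].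
  by rewrite fib; apply: measurableU => //; case: ifP.
split; first exact: measurable_nat_fibers.
move=> j; rewrite fib prU//; [|by case: ifP|].
  rewrite [X in _ + X](_ : _ = 0) ?addr0; last by case: ifP => // _; rewrite /real_prob measure0.
  rewrite prDI// (_ : _ `&` _ = W @^-1` `]-oo, G j[%classic).
    by rewrite !uniform01_pr// !clamp01_id ?Gge0 ?G1.
  apply/setIidPr => w /=; rewrite !in_itv/= => /lt_le_trans; apply; exact: ndG.
case: ifP => _; last by rewrite setI0.
apply/seteqP; split=> w //= [[h _] /(_ j Logic.I)]; exact.
Qed.

(* Randomising inside the atoms of M turns its cumulative distribution function into a
   uniform variable. *)
Lemma distributional_transform (M : T -> nat) (V : T -> R) (p : nat -> R) n :
  measurable_fun setT M -> measurable_fun setT V -> uniform01 P V ->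
  (forall w, M w < n)%N -> (forall i, pr [set w | M w = i] = p i) ->
  (forall i (B : set R), measurable B ->
     pr ([set w | M w = i] `&` V @^-1` B) = pr [set w | M w = i] * pr (V @^-1` B)) ->
  uniform01 P (fun w => \sum_(i < M w) p i + p (M w) * V w).
Proof.
move=> mM mV uV Mn prM ind.
pose G m : R := \sum_(i < m) p i.
have p0 i : 0 <= p i by rewrite -prM pr_ge0.
have mW : measurable_fun setT (fun w => G (M w) + p (M w) * V w).
  apply: (measurable_nat_select (F := fun m w => G m + p m * V w) mM) => m.
  by apply: measurable_funD => //; exact: measurable_funM.
have G1 : G n = 1.
  rewrite /G; under eq_bigr do rewrite -prM.
  transitivity (pr setT); last by rewrite /real_prob probability_setT.
  rewrite (pr_partition _ _ mM Mn)//; apply: eq_bigr => i _; by rewrite setTI.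
apply: uniform01_cdf => // x /andP[x0 x1].
have mWx := measurable_preimage mW (measurable_itv `]-oo, x[).
rewrite prE//; congr EFin; rewrite (pr_partition _ mWx mM Mn).
(* Atom [i] is spread over the interval from [G i] to [G i.+1] and contributes the length of the
   part below [x]; these lengths telescope. *)
have step i : pr ((fun w => G (M w) + p (M w) * V w) @^-1` `]-oo, x[%classic `&`
    [set w | M w = i]) = Num.min x (G i.+1) - Num.min x (G i).
  have Gi : G i.+1 = G i + p i by rewrite /G big_ord_recr.
  have [pi0|pi0] := eqVneq (p i) 0.
    rewrite Gi pi0 addr0 subrr; apply/eqP; rewrite eq_le pr_ge0 andbT.
    rewrite -[leRHS]pi0 -prM; apply: le_pr.
    - by apply: measurableI => //; exact: measurable_nat_fiber.
    - exact: measurable_nat_fiber.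
    - by move=> w [].
  have pi_gt0 : 0 < p i by rewrite lt_neqAle eq_sym pi0 p0.
  rewrite (_ : _ `&` _ = [set w | M w = i] `&` V @^-1` `]-oo, (x - G i) / p i[%classic).
    rewrite ind// prM uniform01_pr// scaled_clamp01// Gi /Num.min.
    by case_if_lra.
  apply/seteqP; split=> w /=; rewrite !in_itv/= ltr_pdivlMr//.
    by move=> [+ e]; rewrite e; split => //; lra.
  by move=> [e +]; rewrite e; split => //; lra.
under eq_bigr do rewrite step.
rewrite -(big_mkord xpredT (fun i => Num.min x (G i.+1) - Num.min x (G i))) telescope_sumr//.
rewrite G1 /G big_ord0 /Num.min; by case_if_lra.
Qed.

End UniformLaws.

(** * Construction of the two coupled models *)

Definition cell := (int * int)%type.

(* [inl a] is a main point of the coupling, [inr a] a net point. *)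
Definition ilabel := (label + label)%type.

Definition icell (a : ilabel) : cell := match a with inl b => b.1 | inr b => b.1 end.

(* Resources requested by a crowded cell: the net of a cell, the position of a net point,
   the openness of an edge at a net point. *)
Definition item := (cell + (ilabel * bool) + (ilabel * ilabel))%type.

Definition flag_item (k : cell) : item := inl (inl k).
Definition coord_item (a : ilabel) (c : bool) : item := inl (inr (a, c)).
Definition edge_item (e : ilabel * ilabel) : item := inr e.

(** The requesters of a resource are sought in the block around this cell. For an edge one endpoint
    is enough, since a cell requests only edges with both endpoints in its block. *)
Definition home (it : item) : cell :=
  match it with
  | inl (inl k) => k
  | inl (inr ac) => icell ac.1
  | inr e => icell e.1
  end.

Definition prim :=
  ((nat * cell) + (ilabel * bool) + (ilabel * ilabel) + (label * label) +
   (label * label) + (item * cell))%type.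

(** [n = 0] and [n = 1] sample the low and the high count, [n = 2] randomises inside the atoms in
    [rest_uniform], [n = 3] is the coin of [crowded]. *)
Definition prim_cell (n : nat) (k : cell) : prim := inl (inl (inl (inl (inl (n, k))))).
Definition prim_coord (a : ilabel) (c : bool) : prim := inl (inl (inl (inl (inr (a, c))))).
Definition prim_edge (e : ilabel * ilabel) : prim := inl (inl (inl (inr e))).
(* Edge variables of pairs of labels in the order never read by [edge_var]. *)
Definition prim_spare (a b : label) : prim := inl (inl (inr (a, b))).
Definition prim_veto (a b : label) : prim := inl (inr (a, b)).
Definition prim_piece (it : item) (Q : cell) : prim := inr (it, Q).

Definition unordered (a b : ilabel) : ilabel * ilabel :=
  if (pickle a < pickle b)%N then (a, b) else (b, a).

Lemma unorderedC a b : unordered a b = unordered b a.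
Proof.
by rewrite /unordered; case: ltngtP => // /(pcan_inj (@pickleK _)) ->.
Qed.

(* [K]: largest count of an uncrowded cell; [g * g]: number of net points per cell, one in
   each square of a [g * g] subdivision; [D]: range of [f] in cells; [s1], [sf]: probability
   that one cell requests a given resource, respectively a given net; [low], [high]: laws of
   the count of model 1 given at most, respectively more than, [K] points; [rest]: law of the
   count of model 2 in a cell without net; [coin]: probability that a cell all of whose
   requests are made is declared crowded. *)
Record coupling_data (R : realType) := CouplingData {
  cd_q : R;
  cd_K : nat;
  cd_g : nat;
  cd_D : nat;
  cd_s1 : R;
  cd_sf : R;
  cd_low : nat -> R;
  cd_high : nat -> R;
  cd_rest : nat -> R;
  cd_coin : cell -> R }.

Section Definitions.
Context (R : realType) (T : Type) (cd : coupling_data R) (xi : prim -> T -> R).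
Local Notation q := (cd_q cd).
Local Notation K := (cd_K cd).
Local Notation g := (cd_g cd).
Local Notation D := (cd_D cd).
Local Notation s1 := (cd_s1 cd).
Local Notation sf := (cd_sf cd).

Definition net_size : nat := (g * g)%N.

Definition block (k : cell) : seq cell :=
  [seq (k.1 + (x%:Z - D%:Z), k.2 + (y%:Z - D%:Z)) | x <- iota 0 (2 * D).+1, y <- iota 0 (2 * D).+1].

Definition block_size : nat := ((2 * D).+1 * (2 * D).+1)%N.

Definition nets (Q : cell) : seq ilabel :=
  [seq (inr (k, j) : ilabel) | k <- block Q, j <- iota 0 net_size].

Definition mains (Q : cell) : seq ilabel :=
  [seq (inl (k, j) : ilabel) | k <- block Q, j <- iota 0 K].

(** An edge between two net points is listed from both ends; without duplicates the requests are
    distinct variables and their probabilities multiply. *)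
Definition items (Q : cell) : seq item :=
  undup ([seq flag_item k | k <- block Q] ++
         [seq coord_item a c | a <- nets Q, c <- [:: true; false]] ++
         [seq edge_item (unordered a b) | a <- nets Q, b <- nets Q ++ mains Q]).

Definition threshold (it : item) : R := if it is inl (inl _) then sf else s1.

(** Every cell of the block has a say, whether or not [it] is among its [items]; so the probability
    depends only on the kind of the resource. *)
Definition granted (it : item) (w : T) : bool :=
  has (fun Q => xi (prim_piece it Q) w < threshold it) (block (home it)).

(** The natural order is reversed: crowding is decided from the requests, with a coin that adjusts
    its probability, and the count is then drawn from the corresponding conditional law. *)
Definition crowded (Q : cell) (w : T) : bool :=
  (xi (prim_cell 3 Q) w < cd_coin cd Q) &&
  all (fun it => xi (prim_piece it Q) w < threshold it) (items Q).

Definition cumul (p : nat -> R) (n : nat) : R := \sum_(i < n) p i.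

(** The default [K] keeps the count at most [K] at every sample point, null sets included, as the
    inclusion of components is proved pointwise. *)
Definition low_count (k : cell) (w : T) : nat :=
  sampler (cumul (cd_low cd)) K (xi (prim_cell 0 k) w).
Definition high_count (k : cell) (w : T) : nat :=
  sampler (cumul (cd_high cd)) K.+1 (xi (prim_cell 1 k) w).
Definition count1 (k : cell) (w : T) : nat :=
  if crowded k w then high_count k w else low_count k w.

Definition vetoable (v : label) : seq label := [seq (k, j) | k <- block v.1, j <- iota 0 K].

Definition vetoes (v u : label) (w : T) : bool := Num.sqrt q <= xi (prim_veto v u) w.

Definition isolated (v : label) (w : T) : bool := all (fun u => vetoes v u w) (vetoable v).

(* Among the points of an uncrowded cell only the last one may be discarded, when all its
   potential edges are vetoed. *)
Definition survivors (k : cell) (w : T) : nat :=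
  if low_count k w is m.+1 then if isolated (k, m) w then m else m.+1 else 0%N.

Definition isolation_prob : R := (1 - Num.sqrt q) ^+ (block_size * K).

(** [i] points survive out of [i] when the last is kept, or out of [i.+1] when it is discarded; an
    empty cell has nothing to discard, whence the special case. *)
Definition survivor_law (i : nat) : R :=
  (if i is 0%N then cd_low cd 0%N else (1 - isolation_prob) * cd_low cd i) +
  isolation_prob * cd_low cd i.+1.

(* A uniform variable whose quantile for [survivor_law] is [survivors]; feeding it to the
   sampler of [cd_rest] couples the two counts monotonically. *)
Definition rest_uniform (k : cell) (w : T) : R :=
  cumul survivor_law (survivors k w) + survivor_law (survivors k w) * xi (prim_cell 2 k) w.

Definition rest_count (k : cell) (w : T) : nat :=
  sampler (cumul (cd_rest cd)) K (rest_uniform k w).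

Definition has_net (k : cell) (w : T) : bool := granted (flag_item k) w.

Definition item_prob : R := 1 - (1 - s1) ^+ block_size.
Definition net_prob : R := 1 - (1 - sf) ^+ block_size.

(** Column and row of a square of the grid. Reducing the row modulo [g] keeps the square inside the
    cell for every label, so that all net coordinates, even beyond [net_size], are uniform. *)
Definition subcell (j : nat) (c : bool) : nat := if c then (j %% g)%N else ((j %/ g) %% g)%N.

Definition icoord (a : ilabel) (c : bool) (w : T) : R :=
  match a with
  | inl _ => xi (prim_coord a c) w
  | inr b => mix_uniform ((subcell b.2 c)%:R / g%:R) item_prob
               (granted (coord_item a c) w) (xi (prim_coord a c) w)
  end.

Definition iedge (e : ilabel * ilabel) (w : T) : R :=
  match e with
  | (inl _, inl _) => xi (prim_edge e) w
  | _ => mix_uniform 0 item_prob (granted (edge_item e) w) (xi (prim_edge e) w)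
  end.

Definition no_veto (a b : label) (w : T) : bool := ~~ vetoes a b w && ~~ vetoes b a w.

(** Without veto the edge variable is [q] times the one that model 2 compares with [f], so an edge
    for [q * f] is an edge for [f]. A veto from either end moves it to [[q, 1]], where it gives no
    edge. *)
Definition model1 (i : idx) (w : T) : R :=
  match i with
  | inl (inl k) => (count1 k w)%:R
  | inl (inr ac) => cell_lo ac.1 ac.2 + xi (prim_coord (inl ac.1) ac.2) w
  | inr ab =>
    if (pickle ab.1 < pickle ab.2)%N then
      mix_uniform 0 q (no_veto ab.1 ab.2 w) (xi (prim_edge (unordered (inl ab.1) (inl ab.2))) w)
    else xi (prim_spare ab.1 ab.2) w
  end.

(* When the net is present ([s = true]) its points take the first [net_size] labels. *)
Definition relabel (s : bool) (a : label) : ilabel :=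
  if s then if (a.2 < net_size)%N then inr a else inl (a.1, a.2 - net_size)%N else inl a.

(** Because of relabelling, the primitives read by a variable of model 2 depend on which nets are
    present. With the flags frozen at [s] each variable reads fixed primitives; the random flags are
    restored afterwards by the mixture argument. *)
Definition model2_given (s : cell -> bool) (i : idx) (w : T) : R :=
  match i with
  | inl (inl k) => if s k then (net_size + low_count k w)%:R else (rest_count k w)%:R
  | inl (inr ac) => cell_lo ac.1 ac.2 + icoord (relabel (s ac.1.1) ac.1) ac.2 w
  | inr ab =>
    if (pickle ab.1 < pickle ab.2)%N then
      iedge (unordered (relabel (s ab.1.1) ab.1) (relabel (s ab.2.1) ab.2)) w
    else xi (prim_spare ab.1 ab.2) w
  end.

Definition model2 (i : idx) (w : T) : R := model2_given (fun k => has_net k w) i w.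

Lemma model1_count k w : model1 (inl (inl k)) w = (count1 k w)%:R.
Proof. by []. Qed.

Lemma model1_coord a c w :
  model1 (coord a c) w = cell_lo a c + xi (prim_coord (inl a) c) w.
Proof. by []. Qed.

Lemma model1_edge a b w : model1 (inr (a, b)) w =
  if (pickle a < pickle b)%N then
    mix_uniform 0 q (no_veto a b w) (xi (prim_edge (unordered (inl a) (inl b))) w)
  else xi (prim_spare a b) w.
Proof. by []. Qed.

Lemma model2_count s k w : model2_given s (inl (inl k)) w =
  if s k then (net_size + low_count k w)%:R else (rest_count k w)%:R.
Proof. by []. Qed.

Lemma model2_coord s a c w :
  model2_given s (coord a c) w = cell_lo a c + icoord (relabel (s a.1) a) c w.
Proof. by []. Qed.

Lemma model2_edge s a b w : model2_given s (inr (a, b)) w =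
  if (pickle a < pickle b)%N then
    iedge (unordered (relabel (s a.1) a) (relabel (s b.1) b)) w
  else xi (prim_spare a b) w.
Proof. by []. Qed.

End Definitions.

Arguments block : simpl never.
Arguments unordered : simpl never.
Arguments items : simpl never.
Arguments model1 : simpl never.
Arguments model2_given : simpl never.
Arguments model2 : simpl never.
Arguments edge_var : simpl never.

(** * Pointwise inclusion of infinite components *)

Section CellBlocks.
Context (R : realType) (cd : coupling_data R).
Local Notation D := (cd_D cd).

Lemma mem_block (Q k : cell) :
  (Q \in block cd k) = (`|Q.1 - k.1|%N <= D)%N && (`|Q.2 - k.2|%N <= D)%N.
Proof.
apply/allpairsP/andP => [[[x y] []]|[h1 h2]].
  by rewrite !mem_iota /= => xD yD -> /=; split; lia.
exists (absz (Q.1 - k.1 + D%:Z), absz (Q.2 - k.2 + D%:Z)); split.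
- by rewrite mem_iota /=; lia.
- by rewrite mem_iota /=; lia.
- by case: Q h1 h2 => Q1 Q2 /= h1 h2; congr (_, _); lia.
Qed.

Lemma block_sym Q k : (Q \in block cd k) = (k \in block cd Q).
Proof. by rewrite !mem_block; congr (_ && _); congr (_ <= _)%N; lia. Qed.

Lemma block_uniq k : uniq (block cd k).
Proof.
apply: allpairs_uniq; try exact: iota_uniq.
by move=> [x y] [x' y'] _ _ /= [] /addrI/addIr[->] /addrI/addIr[->].
Qed.

Lemma size_block k : size (block cd k) = block_size cd.
Proof. by rewrite size_allpairs !size_iota. Qed.

Lemma block_self k : k \in block cd k.
Proof. by rewrite mem_block !subrr. Qed.

Lemma mem_nets Q k j : k \in block cd Q -> (j < net_size cd)%N -> (inr (k, j) : ilabel) \in nets cd Q.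
Proof. by move=> kQ jn; apply/allpairsP; exists (k, j); rewrite mem_iota. Qed.

Lemma mem_mains Q k j : k \in block cd Q -> (j < cd_K cd)%N -> (inl (k, j) : ilabel) \in mains cd Q.
Proof. by move=> kQ jn; apply/allpairsP; exists (k, j); rewrite mem_iota. Qed.

Lemma icell_nets Q a : a \in nets cd Q ++ mains cd Q -> icell a \in block cd Q.
Proof. by rewrite mem_cat => /orP[] /allpairsP[[k j] /= [kQ _ ->]]. Qed.

Lemma home_items Q it : it \in items cd Q -> home it \in block cd Q.
Proof.
rewrite mem_undup 2!mem_cat => /or3P[/mapP[k kQ ->//]||].
  move=> /allpairsP[[a c] /= [aQ _ ->]] /=; apply: icell_nets; by rewrite mem_cat aQ.
move=> /allpairsP[[a b] /= [aQ bQ ->]] /=.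
by rewrite /unordered; case: ifP => _ /=; apply: icell_nets => //; rewrite mem_cat aQ.
Qed.

End CellBlocks.

Section Inclusion.
Context (R : realType) (T : Type) (cd : coupling_data R) (xi : prim -> T -> R).
Local Notation q := (cd_q cd).
Local Notation K := (cd_K cd).
Local Notation g := (cd_g cd).
Local Notation D := (cd_D cd).
Local Notation m0 := (net_size cd).
Local Notation hp := (item_prob cd).

Variables (f : R -> R) (a1 : R).
Hypothesis xi01 : forall j w, 0 <= xi j w <= 1.
Hypothesis q01 : 0 < q < 1.
Hypothesis f_mono : forall r s, 0 <= r -> r <= s -> f s <= f r.
Hypothesis f_le1 : forall r, 0 <= r -> f r <= 1.
Hypothesis f_range : forall r, 0 <= r -> 0 < f r -> r + 1 <= D%:R.
Hypothesis a1_ge0 : 0 <= a1.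
Hypothesis hp_lt : hp < f a1.
Hypothesis g_gt0 : (0 < g)%N.
Hypothesis g_a1 : 3 <= g%:R * a1.
Hypothesis hp_ge0 : 0 <= hp.
Hypothesis hp_g : hp <= g%:R^-1.
Hypothesis low_K : forall k w, (low_count cd xi k w <= K)%N.
Hypothesis rest_survivors : forall k w, (survivors cd xi k w <= rest_count cd xi k w)%N.

Variable w : T.
Local Notation Y1 := (model1 cd xi).
Local Notation Y2 := (model2 cd xi).
Local Notation crowd k := (crowded cd xi k w).
Local Notation net k := (has_net cd xi k w).
Local Notation adj2 := (rcm_adj f Y2 w).
Local Notation conn := (clos_refl_trans label adj2).

Lemma g_gt0R : 0 < g%:R :> R. Proof. by rewrite ltr0n. Qed.

Lemma m0_gt0 : (0 < m0)%N. Proof. by rewrite muln_gt0 g_gt0. Qed.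

Lemma crowded_granted Q it : crowd Q -> it \in items cd Q -> granted cd xi it w.
Proof.
move=> /andP[_ /allP h] itQ; apply/hasP; exists Q; last exact: h.
by rewrite block_sym; exact: home_items.
Qed.

Lemma crowded_net Q k : crowd Q -> k \in block cd Q -> net k.
Proof.
by move=> cQ kQ; apply: (crowded_granted cQ); rewrite mem_undup mem_cat map_f.
Qed.

Definition count2 (k : cell) : nat :=
  if net k then (m0 + low_count cd xi k w)%N else rest_count cd xi k w.

Lemma is_vertex2 (a : label) : is_vertex Y2 w a <-> (a.2 < count2 a.1)%N.
Proof.
case: a => [[k1 k2] i]; rewrite /is_vertex /= /model2 model2_count /count2.
by case: ifP => _; rewrite ltr_nat.
Qed.

Lemma is_vertex1 (a : label) : is_vertex Y1 w a <-> (a.2 < count1 cd xi a.1 w)%N.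
Proof. by case: a => [[k1 k2] i]; rewrite /is_vertex /= model1_count ltr_nat. Qed.

Lemma edge2E (a b : label) : a <> b ->
  Y2 (edge_var a b) w = iedge cd xi (unordered (relabel cd (net a.1) a) (relabel cd (net b.1) b)) w.
Proof.
move=> ab; rewrite /edge_var /model2.
case: ltngtP => [h|h|/(pcan_inj (@pickleK _))/ab[]].
  by rewrite model2_edge h.
by rewrite model2_edge h unorderedC.
Qed.

Lemma edge_varC (a b : label) : a <> b -> edge_var a b = edge_var b a.
Proof.
move=> ab; rewrite /edge_var; case: ltngtP => [h|h|/(pcan_inj (@pickleK _))/ab[]]; reflexivity.
Qed.

Lemma pdistC (Y : idx -> T -> R) a b : pdist Y w a b = pdist Y w b a.
Proof. by rewrite /pdist -sqrrN opprB -[X in _ + X]sqrrN opprB. Qed.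

Lemma adj2_sym a b : adj2 a b -> adj2 b a.
Proof.
move=> [ab va vb e]; split=> //; first by move=> h; apply: ab.
rewrite edge_varC; first by rewrite pdistC.
by move=> h; apply: ab.
Qed.

Lemma conn_sym a b : conn a b -> conn b a.
Proof.
elim=> [x y /adj2_sym|x|x y z _ h1 _ h2]; first exact: rt_step.
  exact: rt_refl.
exact: rt_trans h2 h1.
Qed.

(** The distance is at most [2 * sqrt 2 / g], below [3 / g]; this is the origin of the constant in
    [3 <= g%:R * a1]. *)
Lemma pdist_near (Y : idx -> T -> R) a b :
  (forall c, `|Y (coord a c) w - Y (coord b c) w| <= 2 / g%:R) -> pdist Y w a b <= a1.
Proof.
move=> h; rewrite -[leRHS]ger0_norm// -sqrtr_sqr; apply: ler_wsqrtr.
have e c : (Y (coord a c) w - Y (coord b c) w) ^+ 2 <= 4 * (g%:R^-1) ^+ 2.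
  by rewrite -real_normK ?num_real// (_ : 4 * _ = (2 / g%:R) ^+ 2) ?lerXn2r ?nnegrE ?divr_ge0//; rewrite exprMn; congr (_ * _); ring.
have ga : 3 * g%:R^-1 <= a1 by rewrite ler_pdivrMr ?g_gt0R// mulrC.
have gi : 0 <= g%:R^-1 :> R by rewrite invr_ge0.
have := e true; have := e false; nra.
Qed.

(** Granting confines the edge variable to [[0, hp]], and [hp < f a1]: by monotonicity the edge is
    then open at every distance up to [a1]. *)
Lemma iedge_wired Q u v : crowd Q -> u \in nets cd Q -> v \in nets cd Q ++ mains cd Q ->
  iedge cd xi (unordered u v) w < f a1.
Proof.
move=> cQ uQ vQ; apply: le_lt_trans hp_lt.
have gr : granted cd xi (edge_item (unordered u v)) w.
  apply: (crowded_granted cQ); rewrite mem_undup 2!mem_cat.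
  by apply/or3P; apply: Or33; apply/allpairsP; exists (u, v).
have : iedge cd xi (unordered u v) w =
    mix_uniform 0 hp (granted cd xi (edge_item (unordered u v)) w) (xi (prim_edge (unordered u v)) w).
  move: uQ => /allpairsP[[k j] /= [_ _ ->]]; rewrite /unordered; case: ifP => //.
  by case: v {vQ gr} => [b|b].
move=> ->; rewrite gr; have /andP[_] := mix_uniform_itv 0 hp_ge0 (xi01 (prim_edge (unordered u v)) w).
by rewrite add0r.
Qed.

Lemma net_coord Q k j c : crowd Q -> k \in block cd Q -> (j < m0)%N ->
  cell_lo (k, j) c + (subcell cd j c)%:R / g%:R <= Y2 (coord (k, j) c) w
    <= cell_lo (k, j) c + (subcell cd j c)%:R / g%:R + g%:R^-1.
Proof.
move=> cQ kQ jm; rewrite /model2 model2_coord /relabel /= (crowded_net cQ kQ) /= jm /=.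
have -> : granted cd xi (coord_item (inr (k, j)) c) w.
  apply: (crowded_granted cQ); rewrite mem_undup 2!mem_cat.
  apply/or3P; apply: Or32; apply/allpairsP; exists (inr (k, j), c) => /=.
  by rewrite mem_nets//; split => //; case: c.
have /andP[h1 h2] := mix_uniform_itv ((subcell cd j c)%:R / g%:R) hp_ge0
   (xi01 (prim_coord (inr (k, j)) c) w).
by rewrite lerD2l h1 /= -addrA lerD2l (le_trans h2)// lerD2l.
Qed.

Lemma net_vertex Q k j : crowd Q -> k \in block cd Q -> (j < m0)%N -> is_vertex Y2 w (k, j).
Proof.
move=> cQ kQ jm; apply/is_vertex2; rewrite /count2 /= (crowded_net cQ kQ).
exact: leq_trans jm (leq_addr _ _).
Qed.

Lemma net_adj Q k j (b : label) : crowd Q -> k \in block cd Q -> (j < m0)%N ->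
  (k, j) <> b -> is_vertex Y2 w b -> relabel cd (net b.1) b \in nets cd Q ++ mains cd Q ->
  (forall c, `|Y2 (coord (k, j) c) w - Y2 (coord b c) w| <= 2 / g%:R) ->
  adj2 (k, j) b.
Proof.
move=> cQ kQ jm ab vb bQ near; split=> //; first exact: net_vertex cQ kQ jm.
rewrite edge2E// (crowded_net cQ kQ : net (k, j).1) {1}/relabel /= jm.
apply: (lt_le_trans (iedge_wired cQ (mem_nets kQ jm) bQ)).
by apply: f_mono; [exact: sqrtr_ge0|exact: pdist_near].
Qed.

(* The net points of the block of [Q] form a square grid of side (2D+1)g. *)
Definition grid_cell (Q : cell) (x y : nat) : cell :=
  (Q.1 + ((x %/ g)%N%:Z - D%:Z), Q.2 + ((y %/ g)%N%:Z - D%:Z)).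
Definition grid (Q : cell) (x y : nat) : label :=
  (grid_cell Q x y, (x %% g + g * (y %% g))%N).
Definition grid_side : nat := ((2 * D).+1 * g)%N.

Lemma grid_cell_block Q x y : (x < grid_side)%N -> (y < grid_side)%N ->
  grid_cell Q x y \in block cd Q.
Proof.
move=> xs ys; have : (x %/ g < (2 * D).+1)%N by rewrite ltn_divLR.
have : (y %/ g < (2 * D).+1)%N by rewrite ltn_divLR.
rewrite mem_block /=; move: (x %/ g)%N (y %/ g)%N => a b ha hb.
by apply/andP; split; lia.
Qed.

Lemma grid_index_lt x y : (x %% g + g * (y %% g) < m0)%N.
Proof.
rewrite /net_size.
have : (x %% g < g)%N by rewrite ltn_mod.
have : (y %% g < g)%N by rewrite ltn_mod.
move: (x %% g)%N (y %% g)%N => a b bg ag.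
apply: (@leq_trans (g + g * b)); first by rewrite ltn_add2r.
by rewrite -mulnS leq_mul2l bg orbT.
Qed.

Lemma subcell_grid x y c :
  subcell cd (x %% g + g * (y %% g)) c = if c then (x %% g)%N else (y %% g)%N.
Proof.
rewrite /subcell addnC mulnC; case: c; first by rewrite modnMDl modn_mod.
by rewrite divnMDl// (divn_small (ltn_pmod x g_gt0)) addn0 modn_mod.
Qed.

Definition grid_corner (Q : cell) (x y : nat) (c : bool) : R :=
  (if c then Q.1 else Q.2)%:~R - D%:R + (if c then x else y)%:R / g%:R.

Lemma grid_coord Q x y c : crowd Q -> (x < grid_side)%N -> (y < grid_side)%N ->
  grid_corner Q x y c <= Y2 (coord (grid Q x y) c) w <= grid_corner Q x y c + g%:R^-1.
Proof.
move=> cQ xs ys.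
have := net_coord c cQ (grid_cell_block Q xs ys) (grid_index_lt x y).
rewrite subcell_grid.
suff -> : cell_lo (grid_cell Q x y, (x %% g + g * (y %% g))%N) c +
   (if c then (x %% g)%N else (y %% g)%N)%:R / g%:R = grid_corner Q x y c by [].
have e z : ((z %/ g)%N)%:R + (z %% g)%N%:R / g%:R = z%:R / g%:R :> R.
  by rewrite [in RHS](divn_eq z g) natrD natrM mulrDl mulfK// gt_eqF ?g_gt0R.
rewrite /grid_corner /cell_lo /grid_cell; case: c => /=;
  rewrite -[in RHS]e intrD intrB -!pmulrn -!addrA; congr (_ + _); exact: addrCA.
Qed.

(** Points in squares that touch, diagonally included, differ by at most [2 / g] in each
    coordinate. *)
Lemma grid_step Q x y x' y' : crowd Q -> (x < grid_side)%N -> (y < grid_side)%N ->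
  (x' < grid_side)%N -> (y' < grid_side)%N ->
  (x' <= x.+1)%N -> (x <= x'.+1)%N -> (y' <= y.+1)%N -> (y <= y'.+1)%N ->
  conn (grid Q x y) (grid Q x' y').
Proof.
move=> cQ xs ys xs' ys' h1 h2 h3 h4.
have [<-|ne] := pselect (grid Q x y = grid Q x' y'); first exact: rt_refl.
apply: rt_step; apply: (net_adj cQ) => //.
- exact: grid_cell_block.
- exact: grid_index_lt.
- apply: (net_vertex cQ); [exact: grid_cell_block|exact: grid_index_lt].
- rewrite /relabel (crowded_net cQ (grid_cell_block Q xs' ys')) grid_index_lt mem_cat.
  by rewrite mem_nets//; [exact: grid_cell_block|exact: grid_index_lt].
- move=> c; have /andP[l1 l2] := grid_coord c cQ xs ys.
  have /andP[l3 l4] := grid_coord c cQ xs' ys'.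
  rewrite /grid_corner in l1 l2 l3 l4; rewrite ler_distl -/(grid Q x y).
  have gi : 0 <= g%:R^-1 :> R by rewrite invr_ge0.
  have b1 : (if c then x' else y')%:R <= (if c then x else y)%:R + 1 :> R.
    by rewrite natr1 ler_nat; case: (c).
  have b2 : (if c then x else y)%:R <= (if c then x' else y')%:R + 1 :> R.
    by rewrite natr1 ler_nat; case: (c).
  have b3 := ler_wpM2r gi b1; have b4 := ler_wpM2r gi b2.
  by rewrite !mulrDl mul1r in b3 b4; apply/andP; split; lra.
Qed.

Lemma grid_origin Q x y : crowd Q -> (x < grid_side)%N -> (y < grid_side)%N ->
  conn (grid Q x y) (grid Q 0 0).
Proof.
move=> cQ; elim: x => [|x IH] xs ys.
  elim: y ys => [|y IHy] ys; first exact: rt_refl.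
  apply: rt_trans (IHy (ltnW ys)); apply: grid_step => //; exact: ltnW.
by apply: rt_trans (IH (ltnW xs) ys); apply: grid_step => //; exact: ltnW.
Qed.

Lemma absz_shift (x y : int) (n : nat) : (absz (x - y)%R <= n)%N ->
  (absz (x - y + n%:Z)%R < (2 * n).+1)%N /\ x = y + ((absz (x - y + n%:Z)%R)%:Z - n%:Z).
Proof. by move=> h; split; lia. Qed.

Lemma mixed_radix_lt (a b m n : nat) : (a < m)%N -> (b < n)%N -> (a * n + b < m * n)%N.
Proof.
move=> am bn; apply: (@leq_trans (a * n + n)); first by rewrite ltn_add2l.
by rewrite addnC -mulSn leq_mul2r am orbT.
Qed.

Lemma net_grid Q k j : k \in block cd Q -> (j < m0)%N ->
  exists x y, [/\ (x < grid_side)%N, (y < grid_side)%N & (k, j) = grid Q x y].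
Proof.
rewrite mem_block => /andP[k1 k2] jm.
have jg : (j %/ g < g)%N by rewrite ltn_divLR.
exists (absz (k.1 - Q.1 + D%:Z)%R * g + j %% g)%N, (absz (k.2 - Q.2 + D%:Z)%R * g + j %/ g)%N.
have [h1 e1] := absz_shift k1; have [h2 e2] := absz_shift k2.
have jm2 : (j %% g < g)%N by rewrite ltn_mod.
split.
- exact: mixed_radix_lt.
- exact: mixed_radix_lt.
- rewrite /grid /grid_cell !divnMDl// !modnMDl modn_mod (divn_small jm2) (divn_small jg).
  rewrite (modn_small jg) !addn0 mulnC addnC -divn_eq; congr (_, _).
  by rewrite [LHS]surjective_pairing [X in (X, _)]e1 [X in (_, X)]e2.
Qed.

Lemma net_conn Q k j k' j' : crowd Q -> k \in block cd Q -> k' \in block cd Q ->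
  (j < m0)%N -> (j' < m0)%N -> conn (k, j) (k', j').
Proof.
move=> cQ kQ kQ' jm jm'.
have [x [y [xs ys ->]]] := net_grid kQ jm; have [x' [y' [xs' ys' ->]]] := net_grid kQ' jm'.
by apply: rt_trans (grid_origin cQ xs ys) _; apply: conn_sym; exact: grid_origin.
Qed.

Lemma unit_subcell (x : R) : 0 <= x <= 1 ->
  exists2 j : nat, (j < g)%N & j%:R / g%:R <= x <= j%:R / g%:R + g%:R^-1.
Proof.
move=> /andP[x0 x1].
have gi := g_gt0R.
have [xlt|xge] := ltP x 1; last first.
  (* The endpoint 1 is assigned to the last square. *)
  exists g.-1; first by rewrite prednK.
  have -> : x = 1 by apply/eqP; rewrite eq_le x1.
  have e : g.-1%:R + 1 = g%:R :> R by rewrite natr1 prednK.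
  rewrite -[X in _ <= _ + X]mul1r -mulrDl e divff ?gt_eqF// lexx andbT.
  by rewrite ler_pdivrMr// mul1r -e lerDl.
have xg0 : 0 <= x * g%:R by rewrite mulr_ge0// ltW.
have /andP[t1 t2] := truncn_itv xg0.
exists (Num.truncn (x * g%:R)).
  by rewrite -(@ltr_nat R); apply: le_lt_trans t1 _; rewrite gtr_pMl.
rewrite ler_pdivrMr// t1 /= -[X in _ <= _ + X]mul1r -mulrDl ler_pdivlMr// natr1; exact: ltW.
Qed.

(** The main point is adjacent to the net point of the square in which it lies. Their edge was
    requested because the label of a main point is below [K], even in a cell which is crowded in
    model 1, since model 2 uses the low count there. *)
Lemma main_conn Q k i j : crowd Q -> k \in block cd Q -> (i < low_count cd xi k w)%N ->
  (j < m0)%N -> conn (k, j) (k, (i + m0)%N).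
Proof.
move=> cQ kQ il jm; have nk := crowded_net cQ kQ.
have [j1 j1g /andP[a1l a1u]] := unit_subcell (xi01 (prim_coord (inl (k, i)) true) w).
have [j2 j2g /andP[a2l a2u]] := unit_subcell (xi01 (prim_coord (inl (k, i)) false) w).
have jj : (j1 %% g + g * (j2 %% g) < m0)%N by exact: grid_index_lt.
apply: rt_trans (net_conn cQ kQ kQ jm jj) _; apply: rt_step.
have rl : relabel cd (net k) (k, (i + m0)%N) = inl (k, i).
  by rewrite /relabel nk /= ltnNge leq_addl /= addnK.
apply: (net_adj cQ kQ jj).
- by case=> e; move: jj; rewrite e ltnNge leq_addl.
- by apply/is_vertex2; rewrite /count2 /= nk addnC ltn_add2l.
- by rewrite /= rl mem_cat mem_mains ?orbT//; exact: leq_trans il (low_K _ _).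
- move=> c; have /andP[l1 l2] := net_coord c cQ kQ jj.
  have e : Y2 (coord (k, (i + m0)%N) c) w = cell_lo (k, 0%N) c + xi (prim_coord (inl (k, i)) c) w.
    rewrite /model2 model2_coord /= rl /=; congr (_ + _); by case: (k).
  have gi : 0 <= g%:R^-1 :> R by rewrite invr_ge0.
  have lo j' : cell_lo (k, j') c = cell_lo (k, 0%N) c :> R by case: (k).
  rewrite lo subcell_grid !modn_small// in l1 l2.
  rewrite e ler_distl !modn_small//; case: c l1 l2 {e lo} => /= l1 l2; apply/andP; split; lra.
Qed.

(* A vertex of an uncrowded cell is kept; a crowded cell collapses to one net point. *)
Definition phi (v : label) : label :=
  if crowd v.1 then (v.1, 0%N) else (v.1, (v.2 + (if net v.1 then m0 else 0))%N).

Lemma coord1_itv (a : label) c : cell_lo a c <= Y1 (coord a c) w <= cell_lo a c + 1.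
Proof. by have /andP[h1 h2] := xi01 (prim_coord (inl a) c) w; rewrite model1_coord lerDl h1 /= lerD2l. Qed.

Lemma edge1_ge0 a b : 0 <= Y1 (edge_var a b) w.
Proof.
have /andP[q0 q1] := q01.
have H (a' b' : label) : 0 <= Y1 (inr (a', b')) w.
  rewrite model1_edge; case: ifP => _; last by have /andP[] := xi01 (prim_spare a' b') w.
  by apply: mix_uniform_ge0 => //; exact: ltW.
by rewrite /edge_var; case: ifP.
Qed.

(** Points at distance [r] lie in cells whose indices differ by at most [r + 1] in each direction;
    hence the [+ 1] in [f_range]. *)
Lemma adj1_block a b : rcm_adj (fun r => q * f r) Y1 w a b -> b.1 \in block cd a.1.
Proof.
have /andP[q0 q1] := q01.
move=> [ab va vb e].
have p0 : 0 <= pdist Y1 w a b by exact: sqrtr_ge0.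
have fpos : 0 < f (pdist Y1 w a b).
  by have := le_lt_trans (edge1_ge0 a b) e; rewrite pmulr_rgt0.
have rng := f_range p0 fpos.
have dc c : `|Y1 (coord a c) w - Y1 (coord b c) w| <= pdist Y1 w a b.
  rewrite -sqrtr_sqr; apply: ler_wsqrtr.
  by case: c; rewrite ?lerDl ?lerDr sqr_ge0.
have H c (x y : int) : (if c then a.1.1 else a.1.2) = x -> (if c then b.1.1 else b.1.2) = y ->
   (`|y - x|%N <= D)%N.
  move=> ax bx.
  have lo (u : label) (z : int) : (if c then u.1.1 else u.1.2) = z -> cell_lo u c = z%:~R :> R.
    by case: u => [[u1 u2] u3] /= <-; case: (c).
  have := dc c; have := coord1_itv a c; have := coord1_itv b c.
  rewrite (lo _ _ ax) (lo _ _ bx) ler_distl => /andP[y1 y2] /andP[x1 x2] /andP[d1 d2].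
  have h1 : (y - x)%:~R <= (D%:Z)%:~R :> R by rewrite rmorphB /=; lra.
  have h2 : (x - y)%:~R <= (D%:Z)%:~R :> R by rewrite rmorphB /=; lra.
  by move: h1 h2; rewrite !ler_int; clear; lia.
by rewrite mem_block (H true _ _ erefl erefl) (H false _ _ erefl erefl).
Qed.

Lemma edge1E (a b : label) : a <> b ->
  Y1 (edge_var a b) w = mix_uniform 0 q (no_veto cd xi a b w) (xi (prim_edge (unordered (inl a) (inl b))) w).
Proof.
move=> ab; rewrite /edge_var; case: ltngtP => [h|h|/(pcan_inj (@pickleK _))/ab[]].
  by rewrite model1_edge h.
by rewrite model1_edge h unorderedC /no_veto andbC.
Qed.

(** Only the last point of the cell can be discarded, and only if it vetoes everything in
    [vetoable]; a single missing veto keeps it. *)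
Lemma not_removed v u : ~~ crowd v.1 -> ~~ net v.1 -> is_vertex Y1 w v ->
  u.1 \in block cd v.1 -> (u.2 < K)%N -> ~~ vetoes cd xi v u w -> (v.2 < rest_count cd xi v.1 w)%N.
Proof.
move=> nc nn /is_vertex1; rewrite /count1 (negbTE nc) => vl uv uK nv.
apply: leq_trans (rest_survivors _ _); rewrite /survivors.
case: (low_count _ _ _ _) vl => // m; rewrite ltnS leq_eqVlt => /orP[/eqP vm|vm]; last by case: ifP => // _; exact: ltnW.
case: ifP => [/allP iso|_]; last by rewrite vm.
case/negP: nv; have := iso u; rewrite -vm -surjective_pairing; apply.
by apply/allpairsP; exists u; rewrite mem_iota -surjective_pairing.
Qed.

(** If an endpoint is crowded, the connected net around it joins both images. Otherwise both
    endpoints are kept, as the edge shows that neither vetoes the other, and the same edge is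
    present for [f]. *)
Lemma phi_step a b : rcm_adj (fun r => q * f r) Y1 w a b -> conn (phi a) (phi b).
Proof.
have crowd_case u v : rcm_adj (fun r => q * f r) Y1 w u v -> v.1 \in block cd u.1 ->
    crowd u.1 -> conn (phi u) (phi v).
  move=> [_ _ vv _] uv cu; rewrite {1}/phi cu /phi.
  have nv := crowded_net cu uv; rewrite nv.
  have uu := block_self cd u.1.
  case: ifP => [_|/negbT cv]; first by apply: (net_conn cu) => //; exact: m0_gt0.
  apply: rt_trans (net_conn cu uu uv m0_gt0 m0_gt0) _.
  apply: (main_conn cu) => //; last exact: m0_gt0.
  by move/is_vertex1: vv; rewrite /count1 (negbTE cv).
move=> adj; have bl := adj1_block adj.
have [ca|ca] := boolP (crowd a.1); first exact: crowd_case.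
have [cb|cb] := boolP (crowd b.1).
  apply: conn_sym; apply: crowd_case => //; last by rewrite block_sym.
  case: adj => [ab va vb e]; split => //; first by move=> h; apply: ab.
  rewrite edge_varC; first by rewrite pdistC.
by move=> h; apply: ab.
case: adj => [ab va vb e]; apply: rt_step.
have low v : ~~ crowd v.1 -> is_vertex Y1 w v -> (v.2 < low_count cd xi v.1 w)%N.
  by move=> cv /is_vertex1; rewrite /count1 (negbTE cv).
have lowK v : ~~ crowd v.1 -> is_vertex Y1 w v -> (v.2 < K)%N.
  by move=> cv /low => /(_ cv) h; exact: leq_trans h (low_K _ _).
have /andP[q0 q1] := q01.
have pd0 : 0 <= pdist Y1 w a b by exact: sqrtr_ge0.
rewrite edge1E// in e.
(* Under a veto the edge variable is at least [q], whereas an edge needs a value below [q * f],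
   which is at most [q]. *)
have nv : no_veto cd xi a b w.
  apply/negPn/negP => /negbTE nve; move: e; rewrite nve /mix_uniform /=.
  have /andP[x0 x1] := xi01 (prim_edge (unordered (inl a) (inl b))) w.
  have := f_le1 pd0; case: ifP; nra.
move: e; rewrite nv /mix_uniform add0r ltr_pM2l// => e.
have [va' vb'] : is_vertex Y2 w (phi a) /\ is_vertex Y2 w (phi b).
  have [nva nvb] := andP nv.
  have vx u v : ~~ crowd u.1 -> ~~ crowd v.1 -> is_vertex Y1 w u -> is_vertex Y1 w v ->
      v.1 \in block cd u.1 -> ~~ vetoes cd xi u v w -> is_vertex Y2 w (phi u).
    move=> cu cv vu vv uv nvuv; apply/is_vertex2; rewrite /phi (negbTE cu) /count2 /=.
    case: ifPn => [_|nn]; first by rewrite addnC ltn_add2l; exact: low.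
    by rewrite addn0; apply: (not_removed cu nn vu uv) => //; exact: lowK.
  by split; [apply: (vx a b)|apply: (vx b a) => //; rewrite block_sym].
have rl v : ~~ crowd v.1 -> relabel cd (net (phi v).1) (phi v) = inl v.
  move=> cv; rewrite /phi (negbTE cv) /= /relabel; case: (net v.1) => /=.
    by rewrite ltnNge leq_addl /= addnK -surjective_pairing.
  by rewrite addn0 -surjective_pairing.
have nphi : phi a <> phi b.
  move=> h; have := rl a ca; rewrite h rl// => -[ba]; exact: ab.
split=> //; rewrite edge2E// !rl//.
have -> : iedge cd xi (unordered (inl a) (inl b)) w = xi (prim_edge (unordered (inl a) (inl b))) w.
  by rewrite /unordered; case: ifP.
have cE v c : ~~ crowd v.1 -> Y2 (coord (phi v) c) w = Y1 (coord v c) w.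
  move=> cv; rewrite /model2 model2_coord rl//= model1_coord; congr (_ + _).
  by rewrite /phi (negbTE cv); case: v {cv} => [[v1 v2] v3].
by rewrite /pdist !cE.
Qed.

(** [phi] is not injective, but it preserves cells. Each cell holds finitely many vertices, so an
    infinite component meets infinitely many cells, and so does its image. *)
Lemma infinite_component_inclusion :
  infinite_component (fun r => q * f r) Y1 w -> infinite_component f Y2 w.
Proof.
move=> [a [va inf]].
have phi_conn b : clos_refl_trans label (rcm_adj (fun r => q * f r) Y1 w) a b -> conn (phi a) (phi b).
  elim=> [x y|x|x y z _ h1 _ h2]; [exact: phi_step|exact: rt_refl|exact: rt_trans h1 h2].
pose reach := [set b | clos_refl_trans label (rcm_adj (fun r => q * f r) Y1 w) a b].
have reach_vertex b : reach b -> is_vertex Y1 w b.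
  have H x y : clos_refl_trans label (rcm_adj (fun r => q * f r) Y1 w) x y ->
     is_vertex Y1 w x -> is_vertex Y1 w y.
    by elim=> [u v [_ _ vv _]|//|u v z _ h1 _ h2 /h1/h2].
  by move=> rb; exact: H rb va.
have cells_inf : infinite_set (fst @` reach).
  move=> fin; apply: inf.
  have sub : reach `<=` \bigcup_(k in fst @` reach) [set (k, i) | i in `I_(count1 cd xi k w)].
    move=> b rb; exists b.1; first by exists b.
    exists b.2; first by exact/is_vertex1/reach_vertex.
    by rewrite -surjective_pairing.
  apply: sub_finite_set sub _; apply: bigcup_finite => // k _.
  exact: finite_image.
have inf2 : infinite_set [set b | conn (phi a) b].
  move=> fin; apply: cells_inf.
  apply: (@sub_finite_set _ _ (fst @` [set b | conn (phi a) b])); last exact: finite_image.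
  move=> _ [b rb <-]; exists (phi b); first exact: phi_conn.
  by rewrite /phi; case: ifP.
exists (phi a); split => //.
(* [phi a] might have been discarded; it is a vertex because its infinite cluster provides it with
   an edge. *)
have [y] : exists y, conn (phi a) y /\ y <> phi a.
  apply: contra_notP inf2 => none.
  apply: (@sub_finite_set _ _ [set phi a]) => // y cy /=.
  by apply: contra_notP none => ne; exists y.
move=> [cy ne]; have /clos_rt_rt1n_iff cy1 := cy.
by case: cy1 ne => [//|u v [_ + _ _] _].
Qed.

End Inclusion.

(** * Measurability and laws of the ingredients *)

Lemma measurable_sampler d (T : measurableType d) (R : realType) (G : nat -> R) dflt (W : T -> R) :
  measurable_fun setT W -> measurable_fun setT (fun w => sampler G dflt (W w)).
Proof.
move=> mW; apply: measurable_nat_fibers => j.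
pose L i := W @^-1` `]-oo, G i.+1[%classic.
have mL i : measurable (L i) by exact: measurable_preimage.
have -> : [set w | sampler G dflt (W w) = j] =
    (L j `&` \bigcap_(i in `I_j) ~` L i) `|` (if j == dflt then \bigcap_i ~` L i else set0).
  apply/seteqP; split=> w /=; rewrite /sampler; case: pselect => [e|ne].
  - case: ex_minnP => m wm minm <-; left; split; first by rewrite /L /= in_itv.
    move=> i /= im; rewrite /L /= in_itv /= => /minm; by rewrite leqNgt im.
  - move=> <-; right; rewrite eqxx => i _; rewrite /L /= in_itv /= => h.
    by apply: ne; exists i.
  - case: ex_minnP => m wm minm [[wj lj]|].
      apply/eqP; rewrite eqn_leq minm; last by move: wj; rewrite /L /= in_itv.
      rewrite leqNgt; apply/negP => mj; apply: (lj m mj); by rewrite /L /= in_itv.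
    by case: eqP => // _ /(_ m Logic.I); rewrite /L /= in_itv /= wm.
  - case=> [[wj _]|]; last by case: eqP => // ->.
    by exfalso; apply: ne; exists j; move: wj; rewrite /L /= in_itv.
apply: measurableU.
  apply: measurableI => //.
  have [->|j0] := eqVneq j 0%N; first by rewrite (_ : `I_0 = set0) ?bigcap_set0// II0.
  by apply: bigcap_measurable => [|i _]; [exists 0%N; rewrite /= lt0n|exact: measurableC].
by case: ifP => // _; apply: bigcapT_measurable => i; exact: measurableC.
Qed.

Section GenericMeasurability.
Context (R : realType) (T : Type) (cd : coupling_data R) (xi : prim -> T -> R).
Context d (T' : measurableType d) (h : T' -> T).
Local Notation K := (cd_K cd).
(** With [h] the identity and [T'] a [blockType], the lemmas below tell which primitives a function
    reads; with [T'] equal to [T] they give plain measurability. *)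
Let M (j : prim) := measurable_fun setT (fun w => xi j (h w)).

Lemma measurable_prim_lt j x : M j -> measurable_fun setT (fun w => xi j (h w) < x).
Proof. by move=> mj; apply: measurable_fun_ltr. Qed.

Lemma measurable_prim_ge j x : M j -> measurable_fun setT (fun w => x <= xi j (h w)).
Proof. by move=> mj; apply: measurable_fun_ler. Qed.

Lemma measurable_granted it : (forall Q, M (prim_piece it Q)) ->
  measurable_fun setT (fun w => granted cd xi it (h w)).
Proof.
move=> mi; apply: (measurable_has (X := fun Q w => xi (prim_piece it Q) (h w) < threshold cd it)).
by move=> Q _; exact: measurable_prim_lt.
Qed.

Lemma measurable_crowded Q : (forall it, M (prim_piece it Q)) -> M (prim_cell 3 Q) ->
  measurable_fun setT (fun w => crowded cd xi Q (h w)).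
Proof.
move=> mi mc; apply: measurable_and; first exact: measurable_prim_lt.
apply: (measurable_all (X := fun it w => xi (prim_piece it Q) (h w) < threshold cd it)).
by move=> it _; exact: measurable_prim_lt.
Qed.

Lemma measurable_low k : M (prim_cell 0 k) ->
  measurable_fun setT (fun w => low_count cd xi k (h w)).
Proof. by move=> m; exact: measurable_sampler. Qed.

Lemma measurable_high k : M (prim_cell 1 k) ->
  measurable_fun setT (fun w => high_count cd xi k (h w)).
Proof. by move=> m; exact: measurable_sampler. Qed.

Lemma measurable_vetoes v u : M (prim_veto v u) ->
  measurable_fun setT (fun w => vetoes cd xi v u (h w)).
Proof. by move=> m; exact: measurable_prim_ge. Qed.

Lemma measurable_isolated v : (forall u, M (prim_veto v u)) ->
  measurable_fun setT (fun w => isolated cd xi v (h w)).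
Proof.
move=> m; apply: (measurable_all (X := fun u w => vetoes cd xi v u (h w))).
by move=> u _; exact: measurable_vetoes.
Qed.

Lemma measurable_survivors k : M (prim_cell 0 k) -> (forall i u, M (prim_veto (k, i) u)) ->
  measurable_fun setT (fun w => survivors cd xi k (h w)).
Proof.
move=> ml mv; rewrite /survivors.
apply: (measurable_nat_select (F := fun n w => if n is m.+1 then
   if isolated cd xi (k, m) (h w) then m else m.+1 else 0%N) (measurable_low ml)).
case=> [|m]; first exact: measurable_cst.
by apply: measurable_fun_ifT => //; exact: measurable_isolated.
Qed.

Lemma measurable_rest k : (forall n, M (prim_cell n k)) -> (forall i u, M (prim_veto (k, i) u)) ->
  measurable_fun setT (fun w => rest_count cd xi k (h w)).
Proof.
move=> ml mv; apply: measurable_sampler; rewrite /rest_uniform.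
apply: (measurable_nat_select (F := fun n w => cumul (survivor_law cd) n +
   survivor_law cd n * xi (prim_cell 2 k) (h w)) (measurable_survivors (ml 0%N) mv)) => n.
by apply: measurable_funD => //; apply: measurable_funM => //; exact: ml.
Qed.

Lemma measurable_no_veto a b : M (prim_veto a b) -> M (prim_veto b a) ->
  measurable_fun setT (fun w => no_veto cd xi a b (h w)).
Proof.
by move=> m1 m2; apply: measurable_and; apply: measurable_neg; exact: measurable_vetoes.
Qed.

Lemma measurable_icoord a c : M (prim_coord a c) -> (forall Q, M (prim_piece (coord_item a c) Q)) ->
  measurable_fun setT (fun w => icoord cd xi a c (h w)).
Proof.
case: a => [a|[k j]] m1 m2; first exact: m1.
by apply: measurable_mix_uniform => //; exact: measurable_granted.
Qed.

Lemma measurable_iedge e : M (prim_edge e) -> (forall Q, M (prim_piece (edge_item e) Q)) ->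
  measurable_fun setT (fun w => iedge cd xi e (h w)).
Proof.
move=> m1 m2.
have mm : measurable_fun setT (fun w => mix_uniform 0 (item_prob cd)
    (granted cd xi (edge_item e) (h w)) (xi (prim_edge e) (h w))).
  by apply: measurable_mix_uniform => //; exact: measurable_granted.
by case: e m1 m2 mm => [[a|a] [b|b]].
Qed.

End GenericMeasurability.

Section PrimitiveLaws.
Context d (T : measurableType d) (R : realType) (P : probability T R).
Context (cd : coupling_data R) (xi : prim -> T -> R).
Hypothesis mxi : forall j, measurable_fun setT (xi j).
Hypothesis xi01 : forall j w, 0 <= xi j w <= 1.
Hypothesis uxi : forall j, uniform01 P (xi j).
Hypothesis ixi : mutually_independent P xi.
Local Notation pr := (real_prob P).

Lemma measurable_block_prim (I : eqType) (own : prim -> I) j i : own j = i ->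
  measurable_fun setT (xi j : blockType xi own i -> R).
Proof. by move=> <-; exact: measurable_block. Qed.

Lemma measurable_block_bool (I : eqType) (own : prim -> I) i (X : T -> bool) :
  measurable_fun setT (X : blockType xi own i -> bool) -> block_sigma xi own i [set w | X w].
Proof.
move=> mX; have -> : [set w | X w] = X @^-1` [set true] by [].
exact: (measurable_block_fun mX).
Qed.

Lemma measurable_block_nat (I : eqType) (own : prim -> I) i (N : T -> nat) n :
  measurable_fun setT (N : blockType xi own i -> nat) -> block_sigma xi own i [set w | N w = n].
Proof.
move=> mN; have -> : [set w | N w = n] = N @^-1` [set n] by [].
exact: (measurable_block_fun mN).
Qed.

Lemma pr_independent (I : eqType) (F : I -> set_system T) (s : seq I) (A : I -> set T) :
  independent_systems P F -> (forall i, F i `<=` measurable) -> uniq s -> (forall i, F i (A i)) ->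
  pr (\big[setI/setT]_(i <- s) A i) = \prod_(i <- s) pr (A i).
Proof.
move=> iF mF us FA; rewrite /real_prob iF//.
rewrite (eq_bigr (fun i => (pr (A i))%:E)) => [|i _]; last by rewrite prE//; exact: mF.
by rewrite -(big_morph EFin EFinM erefl).
Qed.

Lemma pr_two_blocks (own : prim -> bool) A B :
  block_sigma xi own false A -> block_sigma xi own true B -> pr (A `&` B) = pr A * pr B.
Proof.
move=> sA sB.
have := @pr_independent _ (block_sigma xi own) [:: false; true] (fun b => if b then B else A)
  (block_independent (own := own) mxi ixi) (fun i => @block_sigma_measurable _ _ _ _ _ _ _ mxi i) isT.
by rewrite !big_cons !big_nil setIT mulr1 => ->//; case.
Qed.

Lemma prim_lt j x : 0 <= x <= 1 -> pr [set w | xi j w < x] = x.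
Proof.
move=> x01; have -> : [set w | xi j w < x] = xi j @^-1` `]-oo, x[%classic.
  by apply/seteqP; split=> w /=; rewrite in_itv.
exact/pr_eq/uniform01_lt.
Qed.

Lemma measurable_lt_set j x : measurable [set w | xi j w < x].
Proof.
have -> : [set w | xi j w < x] = xi j @^-1` `]-oo, x[%classic.
  by apply/seteqP; split=> w /=; rewrite in_itv.
exact: measurable_preimage.
Qed.

Lemma prim_ge j x : 0 <= x <= 1 -> pr [set w | x <= xi j w] = 1 - x.
Proof.
move=> x01; have -> : [set w | x <= xi j w] = ~` [set w | xi j w < x].
  by apply/seteqP; split=> w /=; rewrite leNgt; move/negP.
by rewrite prC ?prim_lt//; exact: measurable_lt_set.
Qed.

Lemma prim_all (s : seq prim) (X : prim -> R -> bool) : uniq s ->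
  (forall j, measurable [set x | X j x]) ->
  pr [set w | all (fun j => X j (xi j w)) s] = \prod_(j <- s) pr [set w | X j (xi j w)].
Proof.
move=> us mX.
pose B j : set R := [set x | X j x].
have -> : [set w | all (fun j => X j (xi j w)) s] = \big[setI/setT]_(j <- s) (xi j @^-1` B j).
  apply/seteqP; split=> w /=.
    by move/allP => h; apply/bigsetI_seqP => j /h.
  by move/bigsetI_seqP => h; apply/allP => j /h.
rewrite /real_prob ixi// (eq_bigr (fun j => (pr [set w | X j (xi j w)])%:E)).
  by rewrite -(big_morph EFin EFinM erefl).
by move=> j _; rewrite -prE//; exact: (measurable_preimage (mxi j) (mX j)).
Qed.

Lemma measurable_set_lt (x : R) : measurable [set y | y < x].
Proof.
have -> : [set y | y < x] = `]-oo, x[%classic by apply/seteqP; split=> y /=; rewrite in_itv.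
exact: measurable_itv.
Qed.

Lemma measurable_set_ge (x : R) : measurable [set y | x <= y].
Proof.
have -> : [set y | x <= y] = `[x, +oo[%classic.
  by apply/seteqP; split=> y /=; rewrite in_itv /= andbT.
exact: measurable_itv.
Qed.

Lemma granted_prob it : 0 <= threshold cd it <= 1 ->
  pr [set w | granted cd xi it w] = 1 - (1 - threshold cd it) ^+ block_size cd.
Proof.
move=> th.
pose s := [seq prim_piece it Q | Q <- block cd (home it)].
have us : uniq s by rewrite map_inj_uniq ?block_uniq// => Q Q' [].
have mg : measurable [set w | all (fun j => threshold cd it <= xi j w) s].
  apply: measurable_bool_fiber; apply: (measurable_all (X := fun j w => threshold cd it <= xi j w)).
  by move=> j _; exact: measurable_fun_ler.
have -> : [set w | granted cd xi it w] = ~` [set w | all (fun j => threshold cd it <= xi j w) s].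
  apply/seteqP; split=> w; rewrite /setC /mkset /granted.
    move/hasP => [Q Qb lt]; move/allP => /(_ (prim_piece it Q)).
    by rewrite map_f// => /(_ isT); rewrite leNgt lt.
  move/negP; rewrite -has_predC has_map; apply: sub_has => Q; by rewrite /= -ltNge.
rewrite prC// (prim_all (X := fun _ x => threshold cd it <= x))//; last first.
  by move=> _; exact: measurable_set_ge.
rewrite (eq_bigr (fun _ => 1 - threshold cd it)) => [|j _]; last exact: prim_ge.
by rewrite big_const_seq count_predT size_map size_block iter_mulr_1.
Qed.

Lemma crowded_prob Q : 0 <= cd_coin cd Q <= 1 -> (forall it, 0 <= threshold cd it <= 1) ->
  pr [set w | crowded cd xi Q w] = cd_coin cd Q * \prod_(it <- items cd Q) threshold cd it.
Proof.
move=> c01 th.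
pose s := prim_cell 3 Q :: [seq prim_piece it Q | it <- items cd Q].
pose thr (j : prim) : R := match j with inr itQ => threshold cd itQ.1 | _ => cd_coin cd Q end.
have us : uniq s.
  rewrite /= map_inj_uniq ?undup_uniq ?andbT; last by move=> it it' [].
  by apply/negP => /mapP[].
have -> : [set w | crowded cd xi Q w] = [set w | all (fun j => xi j w < thr j) s].
  by apply/seteqP; split=> w; rewrite /mkset /crowded /s [all _ (_ :: _)]/= all_map.
rewrite (prim_all (X := fun j x => x < thr j))//; last by move=> j; exact: measurable_set_lt.
have t01 j : 0 <= thr j <= 1 by rewrite /thr; case: j => // [_|[it Q']].
rewrite (eq_bigr thr) => [|j _]; last exact: prim_lt.
by rewrite big_cons big_map.
Qed.

Hypothesis q01 : 0 < cd_q cd < 1.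

Lemma sqrt_q01 : 0 <= Num.sqrt (cd_q cd) <= 1.
Proof.
have /andP[q0 q1] := q01; rewrite sqrtr_ge0 /=.
by rewrite -[leRHS]sqrtr1 ler_wsqrtr// ltW.
Qed.

Lemma no_veto_prob a b : a <> b -> pr [set w | no_veto cd xi a b w] = cd_q cd.
Proof.
move=> ab; have /andP[q0 q1] := q01.
have -> : [set w | no_veto cd xi a b w] =
   [set w | all (fun j => xi j w < Num.sqrt (cd_q cd)) [:: prim_veto a b; prim_veto b a]].
  by apply/seteqP; split=> w /=; rewrite /no_veto /vetoes -!ltNge andbT.
rewrite (prim_all (X := fun _ x => x < Num.sqrt (cd_q cd)))//.
- rewrite !big_cons big_nil mulr1 !prim_lt ?sqrt_q01//.
  by rewrite -expr2 sqr_sqrtr// ltW.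
- by rewrite /= inE andbT; apply/eqP => -[].
- by move=> _; exact: measurable_set_lt.
Qed.

Lemma isolated_prob v : pr [set w | isolated cd xi v w] = isolation_prob cd.
Proof.
pose s := [seq prim_veto v u | u <- vetoable cd v].
have us : uniq s.
  rewrite map_inj_uniq; last by move=> u u' [].
  by apply: allpairs_uniq; rewrite ?block_uniq ?iota_uniq// => -[? ?] [? ?].
have -> : [set w | isolated cd xi v w] = [set w | all (fun j => Num.sqrt (cd_q cd) <= xi j w) s].
  by apply/seteqP; split=> w; rewrite /mkset /isolated /s all_map.
rewrite (prim_all (X := fun _ x => Num.sqrt (cd_q cd) <= x))//; last first.
  by move=> _; exact: measurable_set_ge.
rewrite (eq_bigr (fun _ => 1 - Num.sqrt (cd_q cd))) => [|j _]; last exact/prim_ge/sqrt_q01.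
by rewrite big_const_seq count_predT size_map size_allpairs size_block size_iota iter_mulr_1.
Qed.

End PrimitiveLaws.

Definition is_pmf (R : realType) (p : nat -> R) :=
  (forall i, 0 <= p i) /\ cumul p @ \oo --> (1 : R).

Section Pmf.
Context (R : realType) (p : nat -> R).
Hypothesis pp : is_pmf p.

Lemma cumul0 : cumul p 0 = 0. Proof. by rewrite /cumul big_ord0. Qed.

Lemma cumulS n : cumul p n.+1 = cumul p n + p n.
Proof. by rewrite /cumul big_ord_recr. Qed.

Lemma cumul_homo : {homo cumul p : m n / (m <= n)%N >-> m <= n}.
Proof.
apply: homo_leq; [by []|by move=> y x z; exact: le_trans|].
by move=> n; rewrite cumulS lerDl; case: pp.
Qed.

Lemma cumul_le1 n : cumul p n <= 1.
Proof.
have [_ c] := pp; rewrite -(cvg_lim (@Rhausdorff R) c).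
apply: limr_ge; first by apply/cvg_ex; exists 1.
by exists n => // m /= nm; exact: cumul_homo.
Qed.

End Pmf.

Lemma sampler_pmf d (T : measurableType d) (R : realType) (P : probability T R)
    (p : nat -> R) dflt (W : T -> R) :
  is_pmf p -> measurable_fun setT W -> (forall w, 0 <= W w) -> uniform01 P W ->
  forall j, real_prob P [set w | sampler (cumul p) dflt (W w) = j] = p j.
Proof.
move=> pp mW W0 uW j.
have [_ ->] := sampler_law dflt (cumul_homo pp) (cumul0 p) (cumul_le1 pp) pp.2 mW W0 uW.
by rewrite cumulS addrC addKr.
Qed.

(* Each variable of [model1] reads only the primitives it owns, whence independence. *)
Definition owner1 (j : prim) : idx :=
  match j with
  | inl (inl (inl (inl (inl nk)))) => inl (inl nk.2)
  | inl (inl (inl (inl (inr (inl a, c))))) => inl (inr (a, c))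
  | inl (inl (inl (inr (inl a, inl b)))) => edge_var a b
  | inl (inl (inr ab)) => inr ab
  | inl (inr ab) => edge_var ab.1 ab.2
  | inr itQ => inl (inl itQ.2)
  | _ => inl (inl (0, 0))
  end.

(** * The law of model 1 *)

Section Model1.
Context d (T : measurableType d) (R : realType) (P : probability T R).
Context (cd : coupling_data R) (xi : prim -> T -> R).
Hypothesis mxi : forall j, measurable_fun setT (xi j).
Hypothesis xi01 : forall j w, 0 <= xi j w <= 1.
Hypothesis uxi : forall j, uniform01 P (xi j).
Hypothesis ixi : mutually_independent P xi.
Local Notation pr := (real_prob P).
Hypothesis q01 : 0 < cd_q cd < 1.
Hypothesis low_pmf : is_pmf (cd_low cd).

Lemma xi_ge0 j w : 0 <= xi j w. Proof. by case/andP: (xi01 j w). Qed.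

Lemma low_law k j : pr [set w | low_count cd xi k w = j] = cd_low cd j.
Proof. by apply: sampler_pmf => // w; exact: xi_ge0. Qed.

Lemma edge_var_lt (a b : label) : (pickle a < pickle b)%N -> edge_var a b = inr (a, b).
Proof. by rewrite /edge_var => ->. Qed.

Lemma edge_var_gt (a b : label) : (pickle a < pickle b)%N -> edge_var b a = inr (a, b).
Proof. by move=> h; rewrite /edge_var ltnNge (ltnW h). Qed.

Lemma owner1_edge (a b : label) : (pickle a < pickle b)%N ->
  owner1 (prim_edge (unordered (inl a) (inl b))) = inr (a, b).
Proof.
by move=> h; rewrite /unordered; case: ifP => _ /=; [exact: edge_var_lt|exact: edge_var_gt].
Qed.

Lemma measurable_model1 i : measurable_fun setT (model1 cd xi i : blockType xi owner1 i -> R).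
Proof.
have mb j i' := @measurable_block_prim _ T R xi _ owner1 j i'.
case: i => [[k|[a c]]|[a b]].
- have -> : model1 cd xi (inl (inl k)) = fun w => (count1 cd xi k w)%:R by [].
  apply: (@measurable_nat_comp _ (blockType xi owner1 (inl (inl k))) _ _ (count1 cd xi k)
    (fun n => n%:R : R)).
  apply: measurable_fun_ifT.
  + apply: (@measurable_crowded R T cd xi _ (blockType xi owner1 (inl (inl k))) id).
      by move=> it; exact: mb.
    exact: mb.
  + by apply: (@measurable_high R T cd xi _ (blockType xi owner1 (inl (inl k))) id); exact: mb.
  + by apply: (@measurable_low R T cd xi _ (blockType xi owner1 (inl (inl k))) id); exact: mb.
- have -> : model1 cd xi (inl (inr (a, c))) = fun w => cell_lo a c + xi (prim_coord (inl a) c) w by [].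
  by apply: measurable_funD => //; exact: mb.
- have [h|h] := boolP (pickle a < pickle b)%N; last first.
    have -> : model1 cd xi (inr (a, b)) = xi (prim_spare a b).
      by apply/funext => w; rewrite model1_edge (negbTE h).
    exact: mb.
  have -> : model1 cd xi (inr (a, b)) = fun w => mix_uniform 0 (cd_q cd) (no_veto cd xi a b w)
      (xi (prim_edge (unordered (inl a) (inl b))) w).
    by apply/funext => w; rewrite model1_edge h.
  apply: measurable_mix_uniform; last by apply: mb; exact: owner1_edge.
  apply: (@measurable_no_veto R T cd xi _ (blockType xi owner1 (inr (a, b))) id).
    by apply: mb; exact: edge_var_lt.
  by apply: mb; exact: edge_var_gt.
Qed.

Lemma mix_prim_law (x h : R) (X : T -> bool) j : 0 < h < 1 -> 0 <= x -> x + h <= 1 ->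
  measurable_fun setT (X : blockType xi (fun i => i == j) false -> bool) ->
  pr [set w | X w] = h -> uniform01 P (fun w => mix_uniform x h (X w) (xi j w)).
Proof.
move=> h01 x0 xh mX prX; apply: mix_uniform_law => //.
  exact: (block_measurable_fun mxi mX).
move=> B mB; apply: (pr_two_blocks mxi ixi (own := fun i => i == j)); first exact: measurable_block_bool.
apply: measurable_block_fun => //; apply: measurable_block_prim; exact: eqxx.
Qed.

Variables (lam cp : R).
Hypothesis high_pmf : is_pmf (cd_high cd).
Hypothesis coin01 : forall Q, 0 <= cd_coin cd Q <= 1.
Hypothesis thr01 : forall it, 0 <= threshold cd it <= 1.
Hypothesis coin_prob : forall Q, cd_coin cd Q * \prod_(it <- items cd Q) threshold cd it = cp.
Hypothesis count1_law : forall j, cp * cd_high cd j + (1 - cp) * cd_low cd j = poisson_pmf lam j.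

Lemma high_law k j : pr [set w | high_count cd xi k w = j] = cd_high cd j.
Proof. by apply: sampler_pmf => // w; exact: xi_ge0. Qed.

(** Separates the variables that sample the low and high counts from the coin and the requests, so
    that both counts are independent of crowding. *)
Definition owner_count (j : prim) : bool :=
  if j is inl (inl (inl (inl (inl (n, _))))) then (n < 2)%N else false.

Lemma model1_rcm : rcm_model P lam (model1 cd xi).
Proof.
have mm i := block_measurable_fun mxi (@measurable_model1 i).
split.
- exact: mm.
- move=> k n.
  have mset1 : measurable [set n%:R : R] by [].
  rewrite prE; last exact: measurable_preimage.
  congr EFin; rewrite -count1_law.
  have -> : model1 cd xi (cell_count k) @^-1` [set n%:R] = [set w | count1 cd xi k w = n].
    apply/seteqP; split=> w /=; first by move/eqP; rewrite model1_count eqr_nat => /eqP.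
    by rewrite model1_count => ->.
  have mb j b := @measurable_block_prim _ T R xi _ owner_count j b.
  have mc : measurable_fun setT (crowded cd xi k : blockType xi owner_count false -> bool).
    apply: (@measurable_crowded R T cd xi _ (blockType xi owner_count false) id) => [it|]; exact: mb.
  have ml : measurable_fun setT (low_count cd xi k : blockType xi owner_count true -> nat).
    by apply: (@measurable_low R T cd xi _ (blockType xi owner_count true) id); exact: mb.
  have mh : measurable_fun setT (high_count cd xi k : blockType xi owner_count true -> nat).
    by apply: (@measurable_high R T cd xi _ (blockType xi owner_count true) id); exact: mb.
  have mc' := block_measurable_fun mxi mc.
  have ml' := block_measurable_fun mxi ml.
  have mh' := block_measurable_fun mxi mh.
  have mcount : measurable [set w | count1 cd xi k w = n].
    by apply: measurable_nat_fiber; apply: measurable_fun_ifT.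
  rewrite (pr_bool_partition _ mcount mc').
  have -> : [set w | count1 cd xi k w = n] `&` [set w | crowded cd xi k w] =
      [set w | crowded cd xi k w] `&` [set w | high_count cd xi k w = n].
    by apply/seteqP; split=> w /= [h1 h2]; split => //; move: h1 h2; rewrite /count1;
      case: (crowded cd xi k w).
  have -> : [set w | count1 cd xi k w = n] `&` [set w | ~~ crowded cd xi k w] =
      [set w | ~~ crowded cd xi k w] `&` [set w | low_count cd xi k w = n].
    by apply/seteqP; split=> w /= [h1 h2]; split => //; move: h1 h2; rewrite /count1;
      case: (crowded cd xi k w).
  rewrite (pr_two_blocks mxi ixi (own := owner_count)); last 2 first.
  + exact: measurable_block_bool.
  + exact: measurable_block_nat.
  rewrite (pr_two_blocks mxi ixi (own := owner_count)); last 2 first.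
  + apply: (@measurable_block_bool _ _ _ _ _ owner_count false (fun w => ~~ crowded cd xi k w)).
    exact: measurable_neg.
  + exact: measurable_block_nat.
  have -> : [set w | ~~ crowded cd xi k w] = ~` [set w | crowded cd xi k w].
    by apply/seteqP; split=> w /=; [move/negP|move/negP].
  rewrite prC; last exact: measurable_bool_fiber.
  by rewrite (crowded_prob mxi uxi ixi) ?coin_prob// high_law low_law.
- move=> a c B mB.
  have -> : model1 cd xi (coord a c) = fun w => cell_lo a c + xi (prim_coord (inl a) c) w by [].
  exact: uniform01_shift.
- move=> a b; rewrite -/(uniform01 P (model1 cd xi (inr (a, b)))).
  have [h|h] := boolP (pickle a < pickle b)%N; last first.
    have -> : model1 cd xi (inr (a, b)) = xi (prim_spare a b).
      by apply/funext => w; rewrite model1_edge (negbTE h).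
    exact: uxi.
  have -> : model1 cd xi (inr (a, b)) = fun w => mix_uniform 0 (cd_q cd) (no_veto cd xi a b w)
      (xi (prim_edge (unordered (inl a) (inl b))) w).
    by apply/funext => w; rewrite model1_edge h.
  have /andP[q0 q1] := q01.
  apply: mix_prim_law => //; first by rewrite add0r ltW.
    pose own (i : prim) := i == prim_edge (unordered (inl a) (inl b)).
    by apply: (@measurable_no_veto R T cd xi _ (blockType xi own false) id); exact: measurable_block_prim.
  apply: (no_veto_prob mxi uxi ixi) => //.
  by move=> ab; rewrite ab ltnn in h.
- exact: (block_mutually_independent mxi ixi measurable_model1).
Qed.

End Model1.

(* Given the flags [S = s] the family [Ys s] is independent, and the law of its member [i]
   depends on at most the flag [cnt i], a different flag for each [i]; averaging over the flags
   one at a time shows that the family selected by random flags is still independent. *)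
Section Mixture.
Context d (T : measurableType d) (R : realType) (P : probability T R).
Local Notation pr := (real_prob P).
Context (I C : eqType) (S : C -> T -> bool) (Ys : (C -> bool) -> I -> T -> R).
Context (dep : I -> seq C) (cnt : I -> option C).

Definition update (s : C -> bool) (k : C) (b : bool) : C -> bool :=
  fun k' => if k' == k then b else s k'.

Definition mixed (i : I) (w : T) : R := Ys (fun k => S k w) i w.

Hypothesis mS : forall k, measurable_fun setT (S k).
Hypothesis mYs : forall s i, measurable_fun setT (Ys s i).
Hypothesis given_independent : forall s (fs : seq C) (t : seq I) (B : I -> set R),
  uniq fs -> uniq t -> (forall i, measurable (B i)) ->
  pr ([set w | forall k, k \in fs -> S k w = s k] `&` [set w | forall i, i \in t -> B i (Ys s i w)]) =
  \prod_(k <- fs) pr [set w | S k w = s k] * \prod_(i <- t) pr (Ys s i @^-1` B i).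
Hypothesis depP : forall s s' i, (forall k, k \in dep i -> s k = s' k) -> Ys s i = Ys s' i.
Hypothesis cnt_inj : forall i i' k, cnt i = Some k -> cnt i' = Some k -> i = i'.
Hypothesis given_law : forall s i k b B, measurable B -> cnt i <> Some k ->
  pr (Ys (update s k b) i @^-1` B) = pr (Ys s i @^-1` B).

(** Interpolates between frozen and random flags: those in [cs] are random, the others are frozen at
    [s]. *)
Let mix (cs : seq C) (s : C -> bool) (w : T) : C -> bool :=
  fun k => if k \in cs then S k w else s k.

Let event (cs : seq C) s (t : seq I) (B : I -> set R) : set T :=
  [set w | forall i, i \in t -> B i (Ys (mix cs s w) i w)].

Let fixed (fs : seq C) s : set T := [set w | forall k, k \in fs -> S k w = s k].

Let flag_mean (s : C -> bool) (k : C) (f : bool -> R) : R :=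
  pr [set w | S k w = true] * f true + pr [set w | S k w = false] * f false.

Let factor (cs : seq C) s (B : I -> set R) (i : I) : R :=
  if cnt i is Some k then
    if k \in cs then flag_mean s k (fun b => pr (Ys (update s k b) i @^-1` B i))
    else pr (Ys s i @^-1` B i)
  else pr (Ys s i @^-1` B i).

Let measurable_flag k b : measurable [set w | S k w = b].
Proof. by have := @mS k measurableT [set b] Logic.I; rewrite setTI. Qed.

Let measurable_fixed fs s : measurable (fixed fs s).
Proof.
have -> : fixed fs s = \big[setI/setT]_(k <- fs) [set w | S k w = s k].
  by apply/seteqP; split=> w /=; [move=> h; apply/bigsetI_seqP|move/bigsetI_seqP].
exact: bigsetI_measurable_seq.
Qed.

Let updC s k b k' b' : k' != k -> update (update s k b) k' b' = update (update s k' b') k b.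
Proof.
move=> kk'; apply/funext => c; rewrite /update.
by have [->|//] := eqVneq c k'; rewrite (negbTE kk').
Qed.

Let mix_cons k cs s w : k \notin cs -> mix (k :: cs) s w = mix cs (update s k (S k w)) w.
Proof.
move=> kcs; apply/funext => c; rewrite /mix /update in_cons.
by have [->|_] := eqVneq c k; rewrite ?(negbTE kcs).
Qed.

Let event_cons k cs s t B b : k \notin cs ->
  event (k :: cs) s t B `&` [set w | S k w = b] = event cs (update s k b) t B `&` [set w | S k w = b].
Proof.
by move=> kcs; apply/seteqP; split=> w [ev /= Sk]; split => // i it; have := ev i it;
  rewrite mix_cons// Sk.
Qed.

Let measurable_event cs s t B : uniq cs -> (forall i, measurable (B i)) -> measurable (event cs s t B).
Proof.
move=> + mB; elim: cs s => [|k cs IH] s /=.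
  move=> _; have -> : event [::] s t B = \big[setI/setT]_(i <- t) (Ys s i @^-1` B i).
    by apply/seteqP; split=> w /=; [move=> h; apply/bigsetI_seqP|move/bigsetI_seqP].
  by apply: bigsetI_measurable_seq => i _; exact: measurable_preimage.
move=> /andP[kcs ucs].
have -> : event (k :: cs) s t B =
  (event (k :: cs) s t B `&` [set w | S k w = true]) `|`
  (event (k :: cs) s t B `&` [set w | S k w = false]).
  rewrite -setIUr (_ : _ `|` _ = setT) ?setIT//.
  by apply/seteqP; split=> w //= _; case: (S k w); [left|right].
by rewrite !event_cons//; apply: measurableU; apply: measurableI => //; exact: IH.
Qed.

Let flag_total k : pr [set w | S k w = true] + pr [set w | S k w = false] = 1.
Proof.
have -> : [set w | S k w = false] = ~` [set w | S k w = true].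
  by apply/seteqP; split=> w /=; case: (S k w).
by rewrite prC// addrC subrK.
Qed.

Let factor_other k cs s b B i : (forall j, measurable (B j)) -> k \notin cs -> cnt i <> Some k ->
  factor cs (update s k b) B i = factor (k :: cs) s B i.
Proof.
move=> mB kcs ni; rewrite /factor; case e : (cnt i) => [k'|]; last by rewrite given_law// e.
have kk' : k' != k by apply/eqP => h; apply: ni; rewrite e h.
rewrite in_cons (negbTE kk') /=; case: ifP => _; last by rewrite given_law.
have law b' := @given_law (update s k' b') i k b (B i) (mB i) ni.
by rewrite /flag_mean (updC s b true kk') (updC s b false kk') !law.
Qed.

(** Induction on [cs]: splitting along the value of a flag [k] moves it from the random to the
    prescribed flags [fs]. At most one member has a law depending on [k], so the average over both
    values acts on a single factor and the product form persists. *)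
Let mixture_formula cs fs s t B : uniq (cs ++ fs) -> uniq t -> (forall i, measurable (B i)) ->
  pr (fixed fs s `&` event cs s t B) =
  \prod_(k <- fs) pr [set w | S k w = s k] * \prod_(i <- t) factor cs s B i.
Proof.
move=> + ut mB; elim: cs fs s => [|k cs IH] fs s.
  move=> ufs; rewrite -[LHS]/(pr (_ `&` _)) given_independent//; congr (_ * _).
  by apply: eq_bigr => i _; rewrite /factor; case: (cnt i).
rewrite cat_cons cons_uniq mem_cat negb_or -andbA => /and3P[kcs kfs ucf].
have ucs : uniq cs by move: ucf; rewrite cat_uniq => /and3P[].
have mE : measurable (fixed fs s `&` event (k :: cs) s t B).
  apply: measurableI; first exact: measurable_fixed.
  by apply: measurable_event => //=; rewrite kcs.
have IHb b : pr ((fixed fs s `&` event (k :: cs) s t B) `&` [set w | S k w = b]) =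
    \prod_(k <- fs) pr [set w | S k w = s k] *
    (pr [set w | S k w = b] * \prod_(i <- t) factor cs (update s k b) B i).
  have ucf' : uniq (cs ++ k :: fs).
    by rewrite -cat1s uniq_catCA cat1s cons_uniq mem_cat negb_or kcs kfs.
  have := IH (k :: fs) (update s k b) ucf'; rewrite big_cons /update eqxx.
  rewrite (@eq_big_seq _ _ _ _ fs _ (fun k' => pr [set w | S k' w = s k'])); last first.
    by move=> k' k'fs; have [e|//] := eqVneq k' k; rewrite -e k'fs in kfs.
  rewrite -/(update s k b) => IHk.
  rewrite mulrCA mulrA -IHk -setIA event_cons// setIA setIAC; congr (pr (_ `&` _)).
  apply/seteqP; split=> w /=.
    move=> [fx Sk] k'; rewrite /update in_cons; have [->//|_ /= k'fs] := eqVneq k' k.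
    exact: fx.
  move=> fx; split; last by have := fx k (mem_head _ _); rewrite /update eqxx.
  move=> k' k'fs; have := fx k'; rewrite in_cons k'fs orbT /update => /(_ isT).
  by have [e|//] := eqVneq k' k; rewrite -e k'fs in kfs.
rewrite (pr_bool_partition _ mE (mS k)).
have -> : [set w | S k w] = [set w | S k w = true] by [].
have -> : [set w | ~~ S k w] = [set w | S k w = false].
  by apply/seteqP; split=> w /=; case: (S k w).
rewrite !IHb -mulrDr; congr (_ * _).
have [[i0 it ci0]|none] := pselect (exists2 i, i \in t & cnt i = Some k).
  have oth b i : i != i0 -> factor cs (update s k b) B i = factor (k :: cs) s B i.
    by move=> ii0; apply: factor_other => // ci; move/eqP: ii0; apply; exact: cnt_inj ci ci0.
  rewrite !(bigD1_seq i0)//= !mulrA.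
  under eq_bigr do rewrite oth//.
  under [in X in _ + X]eq_bigr do rewrite oth//.
  rewrite -mulrDl; congr (_ * _).
  by rewrite /factor ci0 in_cons eqxx (negbTE kcs).
have oth b i : i \in t -> factor cs (update s k b) B i = factor (k :: cs) s B i.
  by move=> it; apply: factor_other => // ci; apply: none; exists i.
rewrite !(eq_big_seq _ (oth _)) -mulrDl.
by rewrite flag_total mul1r.
Qed.

Let support (t : seq I) : seq C := undup (flatten [seq dep i | i <- t]).

Let mixed_event (t t' : seq I) s B : {subset t' <= t} ->
  [set w | forall i, i \in t' -> B i (mixed i w)] = event (support t) s t' B.
Proof.
move=> tt'; apply/seteqP.
have e i w : i \in t' -> Ys (mix (support t) s w) i = Ys (fun k => S k w) i.
  move=> it; apply: depP => k kd; rewrite /mix mem_undup; case: flattenP => // -[].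
  by exists (dep i) => //; apply: map_f; exact: tt'.
by split=> w h i it; have := h i it; rewrite e.
Qed.

(** The flags are those of the larger list [t]: the joint event of [t] and each event of a single
    member are then expressed by the same factors. *)
Let mixed_formula t t' s B : {subset t' <= t} -> uniq t' -> (forall i, measurable (B i)) ->
  pr [set w | forall i, i \in t' -> B i (mixed i w)] = \prod_(i <- t') factor (support t) s B i.
Proof.
move=> tt' ut mB; rewrite (@mixed_event t t' s B tt').
have := @mixture_formula (support t) [::] s t' B; rewrite cats0 undup_uniq big_nil mul1r => <-//.
by congr pr; apply/seteqP; split=> [w|w []].
Qed.

Lemma measurable_mixed i : measurable_fun setT (mixed i).
Proof.
move=> _ B mB; rewrite setTI.
have -> : mixed i @^-1` B = [set w | forall j, j \in [:: i] -> B (mixed j w)].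
  apply/seteqP; split=> w; last by apply; rewrite mem_head.
  by move=> h j; rewrite mem_seq1 => /eqP ->.
rewrite (@mixed_event [:: i] [:: i] (fun=> false) (fun=> B))//.
by apply: measurable_event => //; exact: undup_uniq.
Qed.

Let mixed_pr t i s B : i \in t -> (forall i, measurable (B i)) ->
  pr (mixed i @^-1` B i) = factor (support t) s B i.
Proof.
move=> it mB.
have := @mixed_formula t [:: i] s B; rewrite big_seq1 => <-//.
  congr pr; apply/seteqP; split=> w; last by apply; rewrite mem_head.
  by move=> h j; rewrite mem_seq1 => /eqP ->.
by move=> j; rewrite mem_seq1 => /eqP ->.
Qed.

Lemma mixed_independent : mutually_independent P mixed.
Proof.
move=> t B ut mB.
have mp i : measurable (mixed i @^-1` B i) by exact: (measurable_preimage (@measurable_mixed i)).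
rewrite prE; last by apply: bigsetI_measurable_seq.
rewrite (eq_bigr (fun i => (pr (mixed i @^-1` B i))%:E)) => [|i _]; last by rewrite prE.
rewrite -(big_morph EFin EFinM erefl); congr EFin.
rewrite (@eq_big_seq _ _ _ _ t _ (factor (support t) (fun=> false) B)); last first.
  by move=> i it; exact: mixed_pr.
rewrite -mixed_formula//; congr pr.
by apply/seteqP; split=> w /=; [move/bigsetI_seqP|move=> h; apply/bigsetI_seqP].
Qed.

Lemma mixed_law_other i s B : measurable B -> cnt i = None ->
  pr (mixed i @^-1` B) = pr (Ys s i @^-1` B).
Proof.
move=> mB ci; rewrite (@mixed_pr [:: i] i s (fun=> B)) ?mem_head//.
by rewrite /factor ci.
Qed.

Lemma mixed_law_count i k s B : measurable B -> cnt i = Some k -> k \in dep i ->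
  pr (mixed i @^-1` B) =
  pr [set w | S k w] * pr (Ys (update s k true) i @^-1` B) +
  (1 - pr [set w | S k w]) * pr (Ys (update s k false) i @^-1` B).
Proof.
move=> mB ci kd; rewrite (@mixed_pr [:: i] i s (fun=> B)) ?mem_head//.
rewrite /factor ci mem_undup /= cats0 kd /flag_mean.
congr (_ + _ * _); apply/eqP; rewrite eq_sym subr_eq addrC; exact/eqP/esym/flag_total.
Qed.

End Mixture.

(** * The law of model 2 *)

Definition slot :=
  (cell + cell + (ilabel * bool) + (ilabel * ilabel) + (label * label))%type.
Definition slot_flag (k : cell) : slot := inl (inl (inl (inl k))).
Definition slot_count (k : cell) : slot := inl (inl (inl (inr k))).
Definition slot_coord (ac : ilabel * bool) : slot := inl (inl (inr ac)).
Definition slot_edge (e : ilabel * ilabel) : slot := inl (inr e).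
Definition slot_spare (ab : label * label) : slot := inr ab.

(** In contrast with [owner1], a veto belongs to the count of the vetoing cell rather than to the
    pair, and a piece to the requested resource rather than to the requesting cell. *)
Definition owner2 (j : prim) : slot :=
  match j with
  | inl (inl (inl (inl (inl nk)))) => slot_count nk.2
  | inl (inl (inl (inl (inr ac)))) => slot_coord ac
  | inl (inl (inl (inr e))) => slot_edge e
  | inl (inl (inr ab)) => slot_spare ab
  | inl (inr ab) => slot_count ab.1.1
  | inr (inl (inl k), _) => slot_flag k
  | inr (inl (inr ac), _) => slot_coord ac
  | inr (inr e, _) => slot_edge e
  end.

Section Slots.
Context (R : realType) (cd : coupling_data R).

Definition slot_of (s : cell -> bool) (i : idx) : slot :=
  match i with
  | inl (inl k) => slot_count k
  | inl (inr ac) => slot_coord (relabel cd (s ac.1.1) ac.1, ac.2)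
  | inr ab => if (pickle ab.1 < pickle ab.2)%N then
      slot_edge (unordered (relabel cd (s ab.1.1) ab.1) (relabel cd (s ab.2.1) ab.2))
    else slot_spare ab
  end.

Lemma slot_of_count s k : slot_of s (inl (inl k)) = slot_count k.
Proof. by []. Qed.

Lemma slot_of_coord s a c : slot_of s (inl (inr (a, c))) = slot_coord (relabel cd (s a.1) a, c).
Proof. by []. Qed.

Lemma slot_of_edge s a b : slot_of s (inr (a, b)) =
  if (pickle a < pickle b)%N then
    slot_edge (unordered (relabel cd (s a.1) a) (relabel cd (s b.1) b))
  else slot_spare (a, b).
Proof. by []. Qed.

Definition cells_of (i : idx) : seq cell :=
  match i with
  | inl (inl k) => [:: k]
  | inl (inr ac) => [:: ac.1.1]
  | inr ab => [:: ab.1.1; ab.2.1]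
  end.

(** Counts alone have a law that depends on a flag: coordinates and edges are uniform whichever main
    or net points they are read from. *)
Definition counted_cell (i : idx) : option cell :=
  if i is inl (inl k) then Some k else None.

Lemma relabel_inj (s : cell -> bool) (a b : label) :
  relabel cd (s a.1) a = relabel cd (s b.1) b -> a = b.
Proof.
case: a b => [k i] [k' i']; rewrite /relabel /=.
have kk (x : ilabel) (y : ilabel) : x = y -> icell x = icell y by move=> ->.
move=> e; have {kk} /= ke := kk _ _ e.
have kE : k = k' by move: ke; do 4 case: ifP => //=.
move: e; rewrite -kE {ke kE}; case: (s k) => [|[->//]].
case: ifP => h1; case: ifP => h2 // [].
  by move=> ->.
move=> e; congr (_, _); move/negbT: h1; move/negbT: h2; rewrite -!leqNgt => h2 h1.
by rewrite -(subnK h1) e subnK.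
Qed.

Lemma unordered_inj (a b a' b' : ilabel) : unordered a b = unordered a' b' ->
  (a = a' /\ b = b') \/ (a = b' /\ b = a').
Proof.
by rewrite /unordered; case: ifP => _; case: ifP => _ [-> ->]; [left|right|right|left].
Qed.

(** For frozen flags distinct variables of model 2 read distinct slots; this is where their
    independence comes from. *)
Lemma slot_of_inj s : injective (slot_of s).
Proof.
case=> [[k|[a c]]|[a b]] [[k'|[a' c']]|[a' b']];
  rewrite ?slot_of_count ?slot_of_coord ?slot_of_edge //; try by case: ifP.
- by case=> ->.
- by case=> /relabel_inj -> ->.
- case: ifP => h; case: ifP => h' //; last by case=> -> ->.
  case=> /unordered_inj[[/relabel_inj -> /relabel_inj ->]//|[/relabel_inj e1 /relabel_inj e2]].
  by move: h'; rewrite -e1 -e2 => h'; have := ltn_trans h h'; rewrite ltnn.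
Qed.

Definition slot_all (s : cell -> bool) (ki : cell + idx) : slot :=
  match ki with inl k => slot_flag k | inr i => slot_of s i end.

Lemma slot_all_inj s : injective (slot_all s).
Proof.
case=> [k|i] [k'|i']; rewrite /slot_all.
- by case=> ->.
- by case: i' => [[?|[? ?]]|[? ?]]; rewrite ?slot_of_edge //; case: ifP.
- by case: i => [[?|[? ?]]|[? ?]]; rewrite ?slot_of_edge //; case: ifP.
- by move/slot_of_inj ->.
Qed.

End Slots.

Section Model2.
Context d (T : measurableType d) (R : realType) (P : probability T R).
Context (cd : coupling_data R) (xi : prim -> T -> R).
Hypothesis mxi : forall j, measurable_fun setT (xi j).
Hypothesis xi01 : forall j w, 0 <= xi j w <= 1.
Hypothesis uxi : forall j, uniform01 P (xi j).
Hypothesis ixi : mutually_independent P xi.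
Local Notation pr := (real_prob P).
Local Notation Ys := (model2_given cd xi).
Local Notation m0 := (net_size cd).
Hypothesis q01 : 0 < cd_q cd < 1.
Hypothesis low_pmf : is_pmf (cd_low cd).
Hypothesis thr01 : forall it, 0 <= threshold cd it <= 1.
Hypothesis hp01 : 0 < item_prob cd < 1.
Hypothesis g_gt0 : (0 < cd_g cd)%N.
Hypothesis hp_g : item_prob cd <= (cd_g cd)%:R^-1.

Lemma measurable_model2_given s i :
  measurable_fun setT (Ys s i : blockType xi owner2 (slot_of cd s i) -> R).
Proof.
have mb j i' := @measurable_block_prim _ T R xi _ owner2 j i'.
case: i => [[k|[a c]]|[a b]].
- have mlow : measurable_fun setT (low_count cd xi k : blockType xi owner2 (slot_count k) -> nat).
    by apply: (@measurable_low R T cd xi _ (blockType xi owner2 (slot_count k)) id); exact: mb.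
  have mrest : measurable_fun setT (rest_count cd xi k : blockType xi owner2 (slot_count k) -> nat).
    by apply: (@measurable_rest R T cd xi _ (blockType xi owner2 (slot_count k)) id) => *; exact: mb.
  have -> : Ys s (inl (inl k)) = fun w => if s k then (m0 + low_count cd xi k w)%:R
     else (rest_count cd xi k w)%:R by [].
  case: (s k).
    exact: (@measurable_nat_comp _ (blockType xi owner2 (slot_count k)) _ _ (low_count cd xi k)
      (fun n => (m0 + n)%:R : R)).
  exact: (@measurable_nat_comp _ (blockType xi owner2 (slot_count k)) _ _ (rest_count cd xi k)
      (fun n => n%:R : R)).
- have -> : Ys s (inl (inr (a, c))) =
    fun w => cell_lo a c + icoord cd xi (relabel cd (s a.1) a) c w by [].
  apply: measurable_funD => //=; set a' := relabel _ _ _.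
  by apply: (@measurable_icoord R T cd xi _ (blockType xi owner2 (slot_coord (a', c))) id) => [|Q];
    exact: mb.
- rewrite slot_of_edge; have [h|h] := boolP (pickle a < pickle b)%N; last first.
    have -> : Ys s (inr (a, b)) = xi (prim_spare a b).
      by apply/funext => w; rewrite model2_edge (negbTE h).
    exact: mb.
  have -> : Ys s (inr (a, b)) =
      iedge cd xi (unordered (relabel cd (s a.1) a) (relabel cd (s b.1) b)).
    by apply/funext => w; rewrite model2_edge h.
  set e := unordered _ _.
  by apply: (@measurable_iedge R T cd xi _ (blockType xi owner2 (slot_edge e)) id) => [|Q];
    exact: mb.
Qed.

Lemma measurable_has_net k :
  measurable_fun setT (has_net cd xi k : blockType xi owner2 (slot_flag k) -> bool).
Proof.
apply: (@measurable_granted R T cd xi _ (blockType xi owner2 (slot_flag k)) id) => Q.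
exact: measurable_block_prim.
Qed.

Lemma granted_uniform (x : R) it j : (forall Q, prim_piece it Q != j) ->
  0 <= x -> x + item_prob cd <= 1 -> threshold cd it = cd_s1 cd ->
  uniform01 P (fun w => mix_uniform x (item_prob cd) (granted cd xi it w) (xi j w)).
Proof.
move=> nj x0 xh th; apply: mix_prim_law => //.
  apply: (@measurable_granted R T cd xi _ (blockType xi (fun i => i == j) false) id) => Q.
  by apply: measurable_block_prim; exact: negbTE.
by rewrite (granted_prob mxi uxi ixi) ?th// -th.
Qed.

Lemma icoord_uniform a c : uniform01 P (icoord cd xi a c).
Proof.
case: a => [a|[k j]]; first exact: uxi.
have gR : 0 < (cd_g cd)%:R :> R by rewrite ltr0n.
apply: (@granted_uniform _ (coord_item (inr (k, j)) c)) => //=.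
apply: (@le_trans _ _ (((subcell cd j c)%:R + 1) / (cd_g cd)%:R)).
  by rewrite mulrDl mul1r lerD2l.
rewrite ler_pdivrMr// mul1r natr1 ler_nat /subcell.
by case: c; rewrite ltn_mod.
Qed.

Lemma iedge_uniform e : uniform01 P (iedge cd xi e).
Proof.
have /andP[h0 h1] := hp01.
have mm : uniform01 P (fun w => mix_uniform 0 (item_prob cd)
    (granted cd xi (edge_item e) w) (xi (prim_edge e) w)).
  by apply: granted_uniform => //; rewrite add0r ltW.
by case: e mm => [[a|a] [b|b]] mm //; exact: uxi.
Qed.

Lemma given_coord_law s a c B : measurable B ->
  P (Ys s (inl (inr (a, c))) @^-1` B) =
  lebesgue_measure (B `&` `[cell_lo a c, cell_lo a c + 1]%classic).
Proof.
move=> mB.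
have -> : Ys s (inl (inr (a, c))) =
    fun w => cell_lo a c + icoord cd xi (relabel cd (s a.1) a) c w by [].
apply: uniform01_shift => //; last exact: icoord_uniform.
by apply: (@measurable_icoord R T cd xi _ T id).
Qed.

Lemma given_edge_law s a b : uniform01 P (Ys s (inr (a, b))).
Proof.
have [h|h] := boolP (pickle a < pickle b)%N; last first.
  have -> : Ys s (inr (a, b)) = xi (prim_spare a b).
    by apply/funext => w; rewrite model2_edge (negbTE h).
  exact: uxi.
have -> : Ys s (inr (a, b)) = iedge cd xi (unordered (relabel cd (s a.1) a) (relabel cd (s b.1) b)).
  by apply/funext => w; rewrite model2_edge h.
exact: iedge_uniform.
Qed.

Let mYs s i : measurable_fun setT (Ys s i).
Proof. exact: (block_measurable_fun mxi (@measurable_model2_given s i)). Qed.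

Let mS k : measurable_fun setT (has_net cd xi k).
Proof. exact: (block_measurable_fun mxi (@measurable_has_net k)). Qed.

Lemma given_independence s (fs : seq cell) (t : seq idx) (B : idx -> set R) :
  uniq fs -> uniq t -> (forall i, measurable (B i)) ->
  pr ([set w | forall k, k \in fs -> has_net cd xi k w = s k] `&`
      [set w | forall i, i \in t -> B i (Ys s i w)]) =
  \prod_(k <- fs) pr [set w | has_net cd xi k w = s k] * \prod_(i <- t) pr (Ys s i @^-1` B i).
Proof.
move=> ufs ut mB.
pose A (ki : cell + idx) : set T :=
  match ki with inl k => [set w | has_net cd xi k w = s k] | inr i => Ys s i @^-1` B i end.
have iF := independent_systems_reindex (@block_sigmaT _ T R _ _ xi owner2)
  (@slot_all_inj R cd s) (block_independent (own := owner2) mxi ixi).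
pose l : seq (cell + idx) := [seq inl k | k <- fs] ++ [seq inr i | i <- t].
have ul : uniq l.
  rewrite cat_uniq !map_inj_uniq ?ufs ?ut ?andbT//=; last 2 first.
  - by move=> ? ? [].
  - by move=> ? ? [].
  by apply/hasPn => _ /mapP[i _ ->]; apply/negP => /mapP[].
have FA ki : (block_sigma xi owner2 \o slot_all cd s) ki (A ki).
  case: ki => [k|i] /=.
    exact: (@measurable_block_fun _ T R _ _ xi owner2 _ _ _ _ (@measurable_has_net k) [set s k]).
  exact: (@measurable_block_fun _ T R _ _ xi owner2 _ _ _ _ (@measurable_model2_given s i) (B i)).
have := pr_independent iF (fun ki => @block_sigma_measurable _ _ _ _ _ _ _ mxi _) ul FA.
rewrite !big_cat /= !big_map => <-; congr (pr _).
apply/seteqP; split=> w [h1 h2]; split.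
- by apply/bigsetI_seqP => k /h1.
- by apply/bigsetI_seqP => i /h2.
- by move/bigsetI_seqP: h1.
- by move/bigsetI_seqP: h2.
Qed.

Lemma given_dep s s' i : (forall k, k \in cells_of i -> s k = s' k) -> Ys s i = Ys s' i.
Proof.
case: i => [[k|[a c]]|[a b]] h; apply/funext => w.
- by rewrite !model2_count h ?mem_head.
- by rewrite !model2_coord h ?mem_head.
- by rewrite !model2_edge !h// !inE eqxx ?orbT.
Qed.

Lemma given_law_update s i k b B : measurable B -> counted_cell i <> Some k ->
  pr (Ys (update s k b) i @^-1` B) = pr (Ys s i @^-1` B).
Proof.
move=> mB; case: i => [[k'|[a c]]|[a e]] /= ne.
- rewrite (@given_dep _ s)// => k''; rewrite mem_seq1 /update => /eqP ->.
  by have [kk|//] := eqVneq k' k; case: ne; rewrite kk.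
- by rewrite /real_prob !given_coord_law.
- by rewrite /real_prob !given_edge_law.
Qed.

Hypothesis low_K : cumul (cd_low cd) (cd_K cd).+1 = 1.

Lemma low_count_le k w : (low_count cd xi k w <= cd_K cd)%N.
Proof.
rewrite /low_count.
case: (@samplerP _ (cumul (cd_low cd)) (cd_K cd) (xi (prim_cell 0 k) w)).
- by case/andP: (xi01 (prim_cell 0 k) w).
- exact: cumul0.
- move=> /andP[h1 h2]; rewrite leqNgt; apply/negP => lt.
  have := le_lt_trans (le_trans (cumul_homo low_pmf lt) h1) h2.
  by rewrite low_K ltNge cumul_le1.
- by case=> ->.
Qed.

Definition is_veto (j : prim) : bool := if j is inl (inr _) then true else false.

Lemma low_isolated_pr k i m : 
  pr ([set w | low_count cd xi k w = i] `&` [set w | isolated cd xi (k, m) w]) =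
  cd_low cd i * isolation_prob cd.
Proof.
rewrite (pr_two_blocks mxi ixi (own := is_veto)).
- by rewrite (low_law mxi xi01 uxi low_pmf) (isolated_prob mxi uxi ixi).
- apply: measurable_block_nat.
  by apply: (@measurable_low R T cd xi _ (blockType xi is_veto false) id); exact: measurable_block_prim.
- apply: measurable_block_bool.
  by apply: (@measurable_isolated R T cd xi _ (blockType xi is_veto true) id) => u; exact: measurable_block_prim.
Qed.

Let mlow k : measurable_fun setT (low_count cd xi k).
Proof. by apply: (@measurable_low R T cd xi _ T id). Qed.

Let miso v : measurable_fun setT (isolated cd xi v).
Proof. by apply: (@measurable_isolated R T cd xi _ T id). Qed.

Let msurv k : measurable_fun setT (survivors cd xi k).
Proof. by apply: (@measurable_survivors R T cd xi _ T id). Qed.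

Lemma survivors_pr k i : pr [set w | survivors cd xi k w = i] = survivor_law cd i.
Proof.
have ml n : measurable [set w | low_count cd xi k w = n] by exact: measurable_nat_fiber.
have mi m : measurable [set w | isolated cd xi (k, m) w] by exact: measurable_bool_fiber.
have up : pr ([set w | low_count cd xi k w = i.+1] `&` [set w | isolated cd xi (k, i) w]) =
    isolation_prob cd * cd_low cd i.+1 by rewrite low_isolated_pr mulrC.
rewrite /survivor_law -up; case: i up => [|i] _.
  rewrite -(low_law mxi xi01 uxi low_pmf k) -prU//.
  - congr pr; apply/seteqP; split=> w /=; rewrite /survivors.
      case: (low_count cd xi k w) => [|[|m]]; [by left| |by case: ifP].
      by case: ifP => // iso _; right.
    by move=> [->//|[-> ->]].
  - exact: measurableI.
  - by apply/seteqP; split=> w //= [-> []].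
have -> : (1 - isolation_prob cd) * cd_low cd i.+1 =
    pr ([set w | low_count cd xi k w = i.+1] `&` ~` [set w | isolated cd xi (k, i) w]).
  by rewrite prDI// low_isolated_pr (low_law mxi xi01 uxi low_pmf) mulrBl mul1r mulrC.
rewrite -prU.
- congr pr; apply/seteqP; split=> w /=; rewrite /survivors.
    case: (low_count cd xi k w) => [//|m]; case: ifP => [iso <-|/negP iso e]; first by right.
    by left; split=> //; case: e iso => ->.
  by move=> [[-> /negP/negbTE ->]|[-> ->]].
- by apply: measurableI => //; exact: measurableC.
- exact: measurableI.
- by apply/seteqP; split=> w //= [[-> _] [[/eqP]]]; rewrite -[X in X == _]addn0 -addn1 eqn_add2l.
Qed.

Lemma survivors_le k w : (survivors cd xi k w <= cd_K cd)%N.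
Proof.
have := low_count_le k w; rewrite /survivors; case: (low_count _ _ _ _) => // m mK.
by case: ifP => // _; exact: ltnW.
Qed.

Lemma rest_uniform_law k : uniform01 P (rest_uniform cd xi k).
Proof.
apply: (@distributional_transform _ T R P (survivors cd xi k) (xi (prim_cell 2 k))
  (survivor_law cd) (cd_K cd).+1) => //.
- by move=> w; rewrite ltnS survivors_le.
- exact: survivors_pr.
- move=> i B mB; pose own j := j == prim_cell 2 k.
  apply: (pr_two_blocks mxi ixi (own := own)).
    apply: measurable_block_nat.
    by apply: (@measurable_survivors R T cd xi _ (blockType xi own false) id) => *;
      exact: measurable_block_prim.
  by apply: measurable_block_fun => //; apply: measurable_block_prim; exact: eqxx.
Qed.

Lemma survivor_law_ge0 i : 0 <= survivor_law cd i.
Proof.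
rewrite -(survivors_pr (0, 0)); exact: pr_ge0.
Qed.

Lemma cumul_survivor_homo : {homo cumul (survivor_law cd) : m n / (m <= n)%N >-> m <= n}.
Proof.
apply: homo_leq; [by []|by move=> y x z; exact: le_trans|].
by move=> n; rewrite cumulS lerDl survivor_law_ge0.
Qed.

Lemma rest_uniform_ge0 k w : 0 <= rest_uniform cd xi k w.
Proof.
apply: addr_ge0; first by rewrite -(cumul0 (survivor_law cd)); exact: cumul_survivor_homo.
by rewrite mulr_ge0 ?survivor_law_ge0//; case/andP: (xi01 (prim_cell 2 k) w).
Qed.

Hypothesis rest_pmf : is_pmf (cd_rest cd).
Hypothesis rest_le : forall j, (0 < j <= cd_K cd)%N ->
  cumul (cd_rest cd) j <= cumul (survivor_law cd) j.

(** Quantile coupling: were [rest_count] smaller than [survivors], then [rest_uniform] would lie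
    below the cumulated [cd_rest], hence below the cumulated [survivor_law] at [survivors], which by
    construction it is not. The default [K] of the sampler bounds [survivors] as well. *)
Lemma survivors_rest k w : (survivors cd xi k w <= rest_count cd xi k w)%N.
Proof.
rewrite [leqRHS]/rest_count.
case: (@samplerP _ (cumul (cd_rest cd)) (cd_K cd) (rest_uniform cd xi k w)).
- exact: rest_uniform_ge0.
- exact: cumul0.
- move=> /andP[_ h2]; rewrite leqNgt; apply/negP => lt.
  have := lt_le_trans h2 (rest_le _); rewrite (leq_trans lt (survivors_le k w)) => /(_ isT).
  apply/negP; rewrite -leNgt; apply: (le_trans (cumul_survivor_homo lt)).
  rewrite /rest_uniform lerDl mulr_ge0 ?survivor_law_ge0//.
  by case/andP: (xi01 (prim_cell 2 k) w).
- by case=> -> _; exact: survivors_le.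
Qed.

Lemma rest_law k j : pr [set w | rest_count cd xi k w = j] = cd_rest cd j.
Proof.
apply: sampler_pmf => //.
- rewrite /rest_uniform.
  apply: (measurable_nat_select (F := fun n w => cumul (survivor_law cd) n +
    survivor_law cd n * xi (prim_cell 2 k) w) (@msurv k)) => n.
  by apply: measurable_funD => //; exact: measurable_funM.
- by move=> w; exact: rest_uniform_ge0.
- exact: rest_uniform_law.
Qed.

Variable lam : R.
Hypothesis count2_law : forall j,
  net_prob cd * (if (m0 <= j)%N then cd_low cd (j - m0) else 0) +
  (1 - net_prob cd) * cd_rest cd j = poisson_pmf lam j.

Lemma model2_rcm : rcm_model P lam (model2 cd xi).
Proof.
have e : model2 cd xi = mixed (has_net cd xi) Ys by [].
have cinj i i' k : counted_cell i = Some k -> counted_cell i' = Some k -> i = i'.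
  by case: i => [[?|?]|?] //=; case: i' => [[?|?]|?] //= [->] [->].
have mm i : measurable_fun setT (mixed (has_net cd xi) Ys i).
  exact: (measurable_mixed mS mYs (@given_dep)).
split.
- exact: mm.
- move=> k n; rewrite e prE; last by apply: measurable_preimage; [exact: mm|].
  congr EFin.
  rewrite (mixed_law_count mS mYs given_independence (@given_dep) cinj
    given_law_update (fun=> false) _ (erefl (counted_cell (cell_count k))))//; last by rewrite mem_head.
  rewrite -count2_law (granted_prob mxi uxi ixi)// -/(net_prob cd); congr (_ * _ + _ * _).
    have -> : Ys (update (fun=> false) k true) (cell_count k) @^-1` [set n%:R] =
        [set w | (m0 + low_count cd xi k w)%N = n].
      apply/seteqP; split=> w /=; rewrite model2_count /update eqxx.
        by move/eqP; rewrite eqr_nat => /eqP.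
      by move=> ->.
    case: leqP => mn.
      rewrite -(low_law mxi xi01 uxi low_pmf k); congr pr; apply/seteqP; split=> w /=.
        by move=> <-; rewrite addKn.
      by move=> ->; rewrite subnKC.
    rewrite (_ : [set w | _] = set0) /real_prob ?measure0//; apply/seteqP; split=> w //= h.
    by move: mn; rewrite -h ltnNge leq_addr.
  rewrite -(rest_law k); congr pr; apply/seteqP; split=> w /=; rewrite model2_count /update eqxx.
    by move/eqP; rewrite eqr_nat => /eqP.
  by move=> ->.
- move=> a c B mB; rewrite e prE; last by apply: measurable_preimage; [exact: mm|].
  rewrite (mixed_law_other mS mYs given_independence (@given_dep) cinj
    given_law_update (fun=> false))// -prE ?given_coord_law//.
  by apply: measurable_preimage.
- move=> a b B mB; rewrite e prE; last by apply: measurable_preimage; [exact: mm|].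
  rewrite (mixed_law_other mS mYs given_independence (@given_dep) cinj
    given_law_update (fun=> false))// -prE ?given_edge_law//.
  by apply: measurable_preimage.
- exact: (mixed_independent mS mYs given_independence (@given_dep) cinj
    given_law_update).
Qed.

End Model2.

(** * Poisson estimates *)

Section Poisson.
Context (R : realType).
Implicit Types mu : R.

Lemma poisson_pmfE mu l : 0 < mu -> poisson_pmf mu l = exp_coeff mu l * expR (- mu).
Proof. by rewrite /poisson_pmf => ->. Qed.

Lemma poisson_pmf_gt0 mu l : 0 < mu -> 0 < poisson_pmf mu l.
Proof.
move=> m0; rewrite poisson_pmfE// mulr_gt0 ?expR_gt0// divr_gt0 ?exprn_gt0//.
Qed.

Lemma poisson_is_pmf mu : 0 < mu -> is_pmf (poisson_pmf mu).
Proof.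
move=> m0; split; first by move=> i; exact/ltW/poisson_pmf_gt0.
have -> : cumul (poisson_pmf mu) = fun n => series (exp_coeff mu) n * expR (- mu).
  apply/funext => n; rewrite /cumul /series /= big_mkord mulr_suml.
  by apply: eq_bigr => i _; rewrite poisson_pmfE.
have -> : 1 = expR mu * expR (- mu) by rewrite expRN mulfV ?gt_eqF ?expR_gt0.
by apply: cvgMl; exact: is_cvg_series_exp_coeff.
Qed.

(** [(K + 1 + i)!] is at least [(K + 1)! * i!], so the tail is dominated term by term by the
    right-hand side times a Poisson law. *)
Lemma poisson_tail mu K : 0 < mu ->
  1 - cumul (poisson_pmf mu) K.+1 <= mu ^+ K.+1 / K.+1`!%:R.
Proof.
move=> m0; have [_ c1] := poisson_is_pmf m0; have pp := poisson_is_pmf m0.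
rewrite lerBlDr -[leLHS](cvg_lim (@Rhausdorff R) c1).
apply: limr_le; first by apply/cvg_ex; exists 1.
exists K.+1 => // n /= /subnKC <-; move: (n - K.+1)%N => {}n.
have -> : cumul (poisson_pmf mu) (K.+1 + n) = cumul (poisson_pmf mu) K.+1 +
    \sum_(i < n) poisson_pmf mu (K.+1 + i).
  by rewrite /cumul big_split_ord.
rewrite addrC lerD2r.
apply: (@le_trans _ _ (mu ^+ K.+1 / K.+1`!%:R * cumul (poisson_pmf mu) n)); last first.
    by apply: ler_piMr; [rewrite divr_ge0 ?exprn_ge0// ltW|exact: cumul_le1].
rewrite /cumul mulr_sumr; apply: ler_sum => i _.
rewrite !poisson_pmfE// mulrA ler_wpM2r ?expR_ge0//.
rewrite /exp_coeff /= exprD mulrACA ler_wpM2l ?mulr_ge0 ?exprn_ge0 ?(ltW m0)//.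
have f0 m : 0 < m`!%:R :> R by rewrite ltr0n fact_gt0.
rewrite -invfM lef_pV2 ?posrE ?mulr_gt0// -natrM ler_nat.
rewrite -(bin_fact (leq_addr i K.+1)) addKn leq_pmull// bin_gt0.
exact: leq_addr.
Qed.

(** From [y ^ b <= b! * exp y] the polynomial factor costs only a geometric rate; what remains is
    [x ^ n / n!] with [x = mu * e / r], which tends to 0. *)
Lemma factorial_decay mu (A r : R) (b m : nat) : 0 < mu -> 0 < A -> 0 < r ->
  exists K : nat, mu ^+ K.+1 / K.+1`!%:R * (K + m)%:R ^+ b < A * r ^+ K.
Proof.
move=> mu0 A0 r0.
pose c : R := b`!%:R * expR m%:R.
have f0 n : 0 < n`!%:R :> R by rewrite ltr0n fact_gt0.
have c0 : 0 < c by rewrite mulr_gt0 ?expR_gt0.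
pose x : R := mu * expR 1 / r.
have x0 : 0 < x by rewrite divr_gt0// mulr_gt0// expR_gt0.
have e0 : 0 < A / (c * (r / expR 1)) by rewrite divr_gt0// mulr_gt0// divr_gt0// expR_gt0.
have /cvgrPdist_lt /(_ _ e0)[N _ /(_ N.+1 (leqnSn N))] := cvg_exp_coeff x.
rewrite /= sub0r normrN ger0_norm; last by rewrite divr_ge0 ?exprn_ge0// ltW.
move=> hN; exists N.
have bound : (N + m)%:R ^+ b <= c * expR 1 ^+ N.
  have y0 : 0 <= (N + m)%:R :> R by [].
  have : (N + m)%:R ^+ b / b`!%:R <= expR (N + m)%:R :> R.
    have -> : (N + m)%:R ^+ b / b`!%:R = exp_coeff (N + m)%:R b :> R by [].
    apply: (@le_trans _ _ (series (exp_coeff (N + m)%:R) b.+1)).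
      rewrite seriesSr lerDr; apply: sumr_ge0 => i _; exact: exp_coeff_ge0.
    apply: nondecreasing_cvgn_le; last exact: is_cvg_series_exp_coeff.
    by apply/nondecreasing_seqP => n; rewrite seriesSr lerDl exp_coeff_ge0.
  rewrite ler_pdivrMr// natrD expRD => h; apply: le_trans h _.
  by rewrite /c -[X in expR X * _]mulr1 expRM_natl; lra.
apply: (@le_lt_trans _ _ (mu ^+ N.+1 / N.+1`!%:R * (c * expR 1 ^+ N))).
  by rewrite ler_wpM2l// divr_ge0 ?exprn_ge0// ltW.
move: hN; rewrite ltr_pdivlMr ?mulr_gt0 ?divr_gt0 ?expR_gt0// => hN.
have -> : mu ^+ N.+1 / N.+1`!%:R * (c * expR 1 ^+ N) =
   x ^+ N.+1 / N.+1`!%:R * (c * (r / expR 1)) * r ^+ N.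
  have re : r != 0 by rewrite gt_eqF.
  have ee : expR 1 != 0 :> R by rewrite gt_eqF ?expR_gt0.
  rewrite /x !exprMn exprVn !exprS; move: (N.+1`!%:R^-1 : R) (expR 1 ^+ N) (mu ^+ N) => F E M.
  have rN : r ^+ N != 0 by rewrite expf_neq0.
  by field; rewrite re ee rN.
by rewrite ltr_pM2r ?exprn_gt0.
Qed.

(** The ratio is a falling factorial of [t] factors, each at most [N], divided by [mu ^ t]. *)
Lemma poisson_ratio mu (u : R) N t j : 0 < mu -> 1 <= u -> mu^-1 <= u -> (0 < N)%N -> (j <= N)%N ->
  (t <= j)%N -> poisson_pmf mu (j - t) <= (u * N%:R) ^+ t * poisson_pmf mu j.
Proof.
move=> m0 u1 mu_u N0 jN tj; rewrite !poisson_pmfE// mulrA ler_wpM2r ?expR_ge0// /exp_coeff /=.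
have f0 m : 0 < m`!%:R :> R by rewrite ltr0n fact_gt0.
rewrite ler_pdivrMr// -mulrA mulrAC.
have -> : mu ^+ j = mu ^+ t * mu ^+ (j - t) by rewrite -exprD subnKC.
have nz : mu ^+ (j - t) != 0 by rewrite expf_neq0// gt_eqF.
suff h : 1 <= (u * N%:R) ^+ t * mu ^+ t * ((j - t)`!%:R / j`!%:R).
  have := ler_wpM2r (exprn_ge0 (j - t) (ltW m0)) h; rewrite mul1r => h'.
  by apply: le_trans h' _; rewrite le_eqVlt; apply/orP; left; apply/eqP; ring.
have h1 : 1 <= u * mu by rewrite -(mulVf (lt0r_neq0 m0)) ler_wpM2r// ltW.
rewrite -exprMn mulrAC exprMn -mulrA.
apply: mulr_ege1; first exact: exprn_ege1.
rewrite mulrA ler_pdivlMr// mul1r -natrX -natrM ler_nat.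
rewrite -(ffact_fact tj) leq_mul2r orbC.
suff -> : (j ^_ t <= N ^ t)%N by [].
rewrite ffact_prod -[X in (_ <= _ ^ X)%N]card_ord -prod_nat_const.
by apply: leq_prod => i _; exact: leq_trans (leq_subr _ _) jN.
Qed.

Lemma near_forall_lt (Q : nat -> nat -> Prop) N :
  (forall j, (j < N)%N -> \forall n \near \oo, Q j n) ->
  \forall n \near \oo, forall j, (j < N)%N -> Q j n.
Proof.
elim: N => [|N IH] h; first by apply: nearW.
have h1 := IH (fun j jN => h j (ltnW jN)); have h2 := h N (ltnSn N).
near=> n => j; rewrite ltnS leq_eqVlt => /orP[/eqP ->|].
  by near: n.
by move: j; near: n.
Unshelve. all: by end_near.
Qed.

Lemma cvg_poisson (lam : nat -> R) mu l : 0 < mu -> (forall n, 0 < lam n) ->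
  lam @ \oo --> mu -> (fun n => poisson_pmf (lam n) l) @ \oo --> poisson_pmf mu l.
Proof.
move=> m0 l0 cl.
under eq_fun do rewrite poisson_pmfE//.
rewrite poisson_pmfE//; apply: cvgM.
  apply: cvgMl; apply: (@cvg_comp _ _ _ lam (fun x => x ^+ l) _ (nbhs mu)) => //.
  exact: exprn_continuous.
apply: (@cvg_comp _ _ _ lam (fun x => expR (- x)) _ (nbhs mu)) => //.
apply: (@cvg_comp _ _ _ (@GRing.opp R) (@expR R) _ (nbhs (- mu))); first exact: opp_continuous.
exact: continuous_expR.
Qed.

Lemma cvg_cumul_poisson (lam : nat -> R) mu N : 0 < mu -> (forall n, 0 < lam n) ->
  lam @ \oo --> mu ->
  (fun n => cumul (poisson_pmf (lam n)) N) @ \oo --> cumul (poisson_pmf mu) N.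
Proof.
move=> m0 l0 cl; elim: N => [|N IH].
  under eq_fun do rewrite cumul0.
  rewrite cumul0; exact: cvg_cst.
under eq_fun do rewrite cumulS.
by rewrite cumulS; apply: cvgD => //; exact: cvg_poisson.
Qed.

Lemma cvg_lt_near (a b : nat -> R) (x y : R) : a @ \oo --> x -> b @ \oo --> y -> x < y ->
  \forall n \near \oo, a n < b n.
Proof.
move=> ca cb xy; have c : (fun n => b n - a n) @ \oo --> y - x by exact: cvgB.
have h : 0 < y - x by rewrite subr_gt0.
have H : \forall n \near \oo, 0 < b n - a n by apply: (cvgr_gt (y - x)).
by apply: filterS H => n; rewrite subr_gt0.
Qed.

End Poisson.

(** * Laws of the counts for given parameters *)

Lemma prod_undup_ge (R : realType) (I : eqType) (s : seq I) (t : I -> R) :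
  (forall i, 0 <= t i <= 1) -> \prod_(i <- s) t i <= \prod_(i <- undup s) t i.
Proof.
move=> t01; elim: s => [|i s IH] /=; first by rewrite !big_nil.
have /andP[t0 t1] := t01 i; rewrite big_cons.
have p0 : 0 <= \prod_(j <- s) t j by apply: prodr_ge0 => j _; case/andP: (t01 j).
case: ifP => _; last by rewrite big_cons ler_wpM2l.
by apply: le_trans IH; rewrite ler_piMl.
Qed.

Lemma prod_const_seq (R : realType) (I : eqType) (s : seq I) (t : I -> R) c :
  (forall i, i \in s -> t i = c) -> \prod_(i <- s) t i = c ^+ size s.
Proof. by move=> h; rewrite (eq_big_seq _ h) big_const_seq count_predT iter_mulr_1. Qed.

Section Threshold.
Context (R : realType) (cd : coupling_data R).

(** The number of requests other than nets, repetitions included. Edges between net points and main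
    points contribute the only term in [K], which is linear. *)
Definition request_size : nat :=
  (block_size cd * net_size cd * 2 +
   block_size cd * net_size cd * (block_size cd * net_size cd + block_size cd * cd_K cd))%N.

Lemma threshold_prod Q : (forall it, 0 <= threshold cd it <= 1) ->
  cd_sf cd ^+ block_size cd * cd_s1 cd ^+ request_size <=
  \prod_(it <- items cd Q) threshold cd it.
Proof.
move=> t01; apply: le_trans (prod_undup_ge _ t01).
have e1 : \prod_(it <- [seq flag_item k | k <- block cd Q]) threshold cd it =
    cd_sf cd ^+ block_size cd.
  rewrite (prod_const_seq (c := cd_sf cd)); first by rewrite size_map size_block.
  by move=> it /mapP[k _ ->].
have sn : size (nets cd Q) = (block_size cd * net_size cd)%N.
  by rewrite size_allpairs size_block size_iota.
have sm : size (mains cd Q) = (block_size cd * cd_K cd)%N.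
  by rewrite size_allpairs size_block size_iota.
have e2 : \prod_(it <- [seq coord_item a c | a <- nets cd Q, c <- [:: true; false]])
    threshold cd it = cd_s1 cd ^+ (block_size cd * net_size cd * 2).
  rewrite (prod_const_seq (c := cd_s1 cd)); first by rewrite size_allpairs sn.
  by move=> it /allpairsP[x [_ _ ->]].
have e3 : \prod_(it <- [seq edge_item (unordered a b) | a <- nets cd Q, b <- nets cd Q ++ mains cd Q])
    threshold cd it = cd_s1 cd ^+ (block_size cd * net_size cd *
      (block_size cd * net_size cd + block_size cd * cd_K cd)).
  rewrite (prod_const_seq (c := cd_s1 cd)); first by rewrite size_allpairs size_cat sn sm.
  by move=> it /allpairsP[x [_ _ ->]].
by rewrite 2!big_cat /= e1 e2 e3 -exprD.
Qed.

End Threshold.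

Section CouplingParameters.
Context (R : realType) (q : R) (K g D : nat) (s1 sf lam1 lam2 : R).

Definition bulk : R := cumul (poisson_pmf lam1) K.+1.
Definition low_pmf (l : nat) : R := if (l <= K)%N then poisson_pmf lam1 l / bulk else 0.
Definition high_pmf (l : nat) : R := if (l <= K)%N then 0 else poisson_pmf lam1 l / (1 - bulk).
(* The parameters entering the side conditions; none of these depends on the intensities. *)
Definition frame : coupling_data R :=
  CouplingData q K g D s1 sf (fun=> 0) (fun=> 0) (fun=> 0) (fun=> 0).
Local Notation nu := (net_prob frame).
Local Notation m0 := (net_size frame).
Definition shifted_low (j : nat) : R := if (m0 <= j)%N then low_pmf (j - m0) else 0.
(** Solves the equation which makes the mixture of the counts with and without net a Poisson law of
    intensity [lam2]. *)
Definition rest_pmf (j : nat) : R := (poisson_pmf lam2 j - nu * shifted_low j) / (1 - nu).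
Definition coin (Q : cell) : R :=
  (1 - bulk) / \prod_(it <- items frame Q) threshold frame it.
Definition coupling : coupling_data R :=
  CouplingData q K g D s1 sf low_pmf high_pmf rest_pmf coin.

Hypothesis q01 : 0 < q < 1.
Hypothesis lam1_gt0 : 0 < lam1.
Hypothesis lam2_gt0 : 0 < lam2.
Hypothesis s1_01 : 0 < s1 <= 1.
Hypothesis sf_01 : 0 < sf <= 1.
Hypothesis nu_lt1 : nu < 1.
(** With denominators cleared, [net_fits] is the nonnegativity of [rest_pmf], [thinning_fits] its
    stochastic domination of the survivors, and [crowd_fits] ensures that the coin has probability
    at most 1. *)
Hypothesis net_fits : forall j, (m0 <= j)%N -> (j <= K + m0)%N ->
  nu * poisson_pmf lam1 (j - m0) <= poisson_pmf lam2 j * bulk.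
Hypothesis thinning_fits : forall j, (0 < j <= K)%N ->
  cumul (poisson_pmf lam2) j * bulk - nu * cumul (poisson_pmf lam1) (j - m0) <=
  (1 - nu) * (cumul (poisson_pmf lam1) j + isolation_prob frame * poisson_pmf lam1 j).
Hypothesis crowd_fits :
  1 - bulk <= sf ^+ block_size frame * s1 ^+ request_size frame.

Lemma pois_pmf1 : is_pmf (poisson_pmf lam1). Proof. exact: poisson_is_pmf. Qed.

Lemma bulk_gt0 : 0 < bulk.
Proof.
apply: (@lt_le_trans _ _ (cumul (poisson_pmf lam1) 1)); last exact: (cumul_homo pois_pmf1 (isT : (1 <= K.+1)%N)).
by rewrite cumulS cumul0 add0r poisson_pmf_gt0.
Qed.

Lemma bulk_lt1 : bulk < 1.
Proof.
apply: lt_le_trans (cumul_le1 pois_pmf1 K.+2).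
by rewrite cumulS ltrDl poisson_pmf_gt0.
Qed.

Lemma cumul_low n : (n <= K.+1)%N -> cumul low_pmf n = cumul (poisson_pmf lam1) n / bulk.
Proof.
elim: n => [|n IH] nK; first by rewrite !cumul0 mul0r.
by rewrite !cumulS IH ?(ltnW nK)// /low_pmf -ltnS nK mulrDl.
Qed.

Lemma cumul_low_K : cumul low_pmf K.+1 = 1.
Proof. by rewrite cumul_low// divff// gt_eqF// bulk_gt0. Qed.

Lemma cumul_low_large n : (K < n)%N -> cumul low_pmf n = 1.
Proof.
elim: n => // n IH; rewrite ltnS leq_eqVlt => /orP[/eqP <-|Kn]; first exact: cumul_low_K.
by rewrite cumulS IH// /low_pmf leqNgt Kn addr0.
Qed.

Lemma low_is_pmf : is_pmf low_pmf.
Proof.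
split=> [i|].
  rewrite /low_pmf; case: ifP => // _.
  by rewrite divr_ge0 ?(ltW bulk_gt0)// ltW// poisson_pmf_gt0.
apply: cvg_near_cst; exists K.+1 => // n /= Kn; exact: cumul_low_large.
Qed.

Lemma high_is_pmf : is_pmf high_pmf.
Proof.
have b1 : 0 < 1 - bulk by rewrite subr_gt0 bulk_lt1.
split=> [i|].
  rewrite /high_pmf; case: ifP => // _.
  by rewrite divr_ge0 ?(ltW b1)// ltW// poisson_pmf_gt0.
have e n : cumul high_pmf (n + K.+1) = (cumul (poisson_pmf lam1) (n + K.+1) - bulk) / (1 - bulk).
  elim: n => [|n IH].
    rewrite add0n subrr mul0r /cumul big1// => i _.
    by rewrite /high_pmf -ltnS ltn_ord.
  rewrite addSn !cumulS IH /high_pmf leqNgt leq_addl /=.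
  by rewrite -mulrDl addrAC.
rewrite -(cvg_shiftn K.+1).
have [_ c] := pois_pmf1; rewrite -(cvg_shiftn K.+1) in c.
have c1 : (fun n => (cumul (poisson_pmf lam1) (n + K.+1) - bulk) / (1 - bulk)) @ \oo -->
    (1 - bulk) / (1 - bulk).
  by apply: cvgMl; apply: cvgB => //; exact: cvg_cst.
rewrite divff ?lt0r_neq0// in c1.
by under eq_fun do rewrite e.
Qed.

Lemma cumul_shifted n : cumul shifted_low n = cumul low_pmf (n - m0).
Proof.
elim: n => [|n IH]; first by rewrite sub0n !cumul0.
rewrite cumulS IH /shifted_low; case: leqP => mn.
  by rewrite subSn// cumulS.
rewrite addr0; congr cumul; apply/eqP.
by rewrite (eqP (_ : n - m0 == 0)%N) ?subn_eq0 ?(ltnW mn)// eq_sym subn_eq0.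
Qed.

Lemma cumul_rest n : cumul rest_pmf n =
  (cumul (poisson_pmf lam2) n - nu * cumul low_pmf (n - m0)) / (1 - nu).
Proof.
rewrite -cumul_shifted; elim: n => [|n IH].
  by rewrite !cumul0 mulr0 subrr mul0r.
by rewrite !cumulS IH /rest_pmf -mulrDl; congr (_ / _); ring.
Qed.

Lemma nu1_gt0 : 0 < 1 - nu. Proof. by rewrite subr_gt0. Qed.

Lemma rest_is_pmf : is_pmf rest_pmf.
Proof.
split=> [j|].
  rewrite /rest_pmf divr_ge0 ?(ltW nu1_gt0)// subr_ge0 /shifted_low.
  have p0 : 0 <= poisson_pmf lam2 j by exact/ltW/poisson_pmf_gt0.
  case: ifP => mj; last by rewrite mulr0.
  rewrite /low_pmf; case: ifP => jK; last by rewrite mulr0.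
  by rewrite mulrA ler_pdivrMr ?bulk_gt0// net_fits//; lia.
have -> : cumul rest_pmf = fun n => (cumul (poisson_pmf lam2) n - nu * cumul low_pmf (n - m0)) / (1 - nu).
  by apply/funext => n; exact: cumul_rest.
have c1 : (fun n => cumul (poisson_pmf lam2) n - nu * cumul low_pmf (n - m0)) @ \oo --> 1 - nu * 1.
  apply: cvgB; first by have [_] := poisson_is_pmf lam2_gt0.
  apply: cvgMr; apply: cvg_near_cst; exists (K.+1 + m0)%N => // n /= Kn.
  by apply: cumul_low_large; rewrite ltn_subRL addnC.
have c2 : (fun n => (cumul (poisson_pmf lam2) n - nu * cumul low_pmf (n - m0)) / (1 - nu)) @ \oo -->
    (1 - nu * 1) / (1 - nu) by exact: cvgMl.
by rewrite mulr1 divff in c2 => //; rewrite lt0r_neq0// nu1_gt0.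
Qed.

Lemma threshold01 it : 0 <= threshold coupling it <= 1.
Proof.
have /andP[a b] := s1_01; have /andP[c e] := sf_01.
by rewrite /threshold; case: it => [[k|ac]|ab] /=; rewrite ltW.
Qed.

Lemma threshold_prod_gt0 Q : 0 < \prod_(it <- items coupling Q) threshold coupling it.
Proof.
have /andP[a b] := s1_01; have /andP[c e] := sf_01.
apply: lt_le_trans (threshold_prod Q threshold01).
by rewrite mulr_gt0 ?exprn_gt0.
Qed.

Lemma coin_itv Q : 0 <= coin Q <= 1.
Proof.
have pg := threshold_prod_gt0 Q.
rewrite /coin divr_ge0 ?subr_ge0 ?(ltW bulk_lt1) ?(ltW pg)//=.
rewrite ler_pdivrMr ?mul1r//; apply: le_trans crowd_fits _.
exact: (threshold_prod Q threshold01).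
Qed.

Lemma coin_crowd Q : cd_coin coupling Q * \prod_(it <- items coupling Q) threshold coupling it = 1 - bulk.
Proof. by rewrite /= /coin divfK// gt_eqF//; exact: (threshold_prod_gt0 Q). Qed.

Lemma count1_mixture j :
  (1 - bulk) * high_pmf j + (1 - (1 - bulk)) * low_pmf j = poisson_pmf lam1 j.
Proof.
have b0 := bulk_gt0; have b1 : 0 < 1 - bulk by rewrite subr_gt0 bulk_lt1.
rewrite subKr /high_pmf /low_pmf; case: ifP => _.
  by rewrite mulr0 add0r mulrC divfK// gt_eqF.
by rewrite mulr0 addr0 mulrC divfK// gt_eqF.
Qed.

Lemma count2_mixture j :
  nu * (if (m0 <= j)%N then low_pmf (j - m0) else 0) + (1 - nu) * rest_pmf j = poisson_pmf lam2 j.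
Proof.
rewrite -/(shifted_low j) /rest_pmf [X in _ + X]mulrC divfK ?gt_eqF ?nu1_gt0//.
by rewrite addrC subrK.
Qed.

(** Fewer than [j] points survive when the low count is below [j], or equals [j] and the last point
    is isolated. *)
Lemma cumul_survivor_law j : (0 < j)%N ->
  cumul (survivor_law coupling) j = cumul low_pmf j + isolation_prob frame * low_pmf j.
Proof.
case: j => // j _; elim: j => [|j IH].
  by rewrite !cumulS !cumul0 !add0r.
rewrite cumulS IH [in RHS]cumulS /survivor_law /= -/(isolation_prob frame); lra.
Qed.

Lemma rest_below_survivors j : (0 < j <= K)%N ->
  cumul rest_pmf j <= cumul (survivor_law coupling) j.
Proof.
move=> jK; have /andP[j0 jK'] := jK.
have b0 := bulk_gt0.
rewrite cumul_survivor_law// cumul_rest ler_pdivrMr ?nu1_gt0//.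
rewrite (cumul_low (leqW jK')) (cumul_low (leq_trans (leq_subr m0 j) (leqW jK'))).
rewrite /low_pmf jK' -(ler_pM2r b0).
have bn : bulk != 0 by rewrite gt_eqF.
apply: le_trans (_ : _ <= cumul (poisson_pmf lam2) j * bulk -
    nu * cumul (poisson_pmf lam1) (j - m0)) _.
  by rewrite le_eqVlt; apply/orP; left; apply/eqP; field.
apply: le_trans (thinning_fits jK) _.
by rewrite le_eqVlt; apply/orP; left; apply/eqP; field.
Qed.

Variables (f : R -> R) (a1 : R).
Hypothesis f_mono : forall r s, 0 <= r -> r <= s -> f s <= f r.
Hypothesis f_le1 : forall r, 0 <= r -> f r <= 1.
Hypothesis f_range : forall r, 0 <= r -> 0 < f r -> r + 1 <= D%:R.
Hypothesis a1_ge0 : 0 <= a1.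
Hypothesis hp_lt : item_prob frame < f a1.
Hypothesis g_gt0 : (0 < g)%N.
Hypothesis g_a1 : 3 <= g%:R * a1.
Hypothesis hp01 : 0 < item_prob frame < 1.
Hypothesis hp_g : item_prob frame <= g%:R^-1.

Lemma coupling_exists : exists (d : measure_display) (T : measurableType d)
    (P : probability T R) (Y1 Y2 : idx -> T -> R),
  [/\ rcm_model P lam1 Y1, rcm_model P lam2 Y2 &
      infinite_component (fun r => q * f r) Y1 `<=` infinite_component f Y2].
Proof.
pose xi := @uniform_family R prim.
have mxi j : measurable_fun setT (xi j) by exact: measurable_tail_valueT.
have xi01 j w : 0 <= xi j w <= 1 by rewrite tail_value_ge0 tail_value_le1.
have uxi j : uniform01 (@unit_lebesgue R) (xi j) by exact: uniform_family_uniform.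
have ixi : mutually_independent (@unit_lebesgue R) xi by exact: uniform_family_independent.
have hp0 : 0 <= item_prob frame by case/andP: hp01 => /ltW.
exists _, (measurableTypeR R), (@unit_lebesgue R), (model1 coupling xi), (model2 coupling xi).
split.
- apply: (model1_rcm mxi xi01 uxi ixi (cd := coupling) q01 low_is_pmf (cp := 1 - bulk)).
  + exact: high_is_pmf.
  + exact: coin_itv.
  + exact: threshold01.
  + exact: coin_crowd.
  + exact: count1_mixture.
- apply: (model2_rcm mxi xi01 uxi ixi (cd := coupling) q01 low_is_pmf threshold01 hp01 g_gt0 hp_g
    cumul_low_K rest_is_pmf).
  exact: count2_mixture.
- move=> w; apply: (infinite_component_inclusion (cd := coupling) (a1 := a1)) => //.
  + by move=> k w'; exact: (low_count_le xi01 (cd := coupling) low_is_pmf cumul_low_K).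
  + move=> k w'.
    exact: (survivors_rest mxi xi01 uxi ixi (cd := coupling) q01 low_is_pmf cumul_low_K rest_below_survivors).
Qed.

End CouplingParameters.

(** * Choice of the constants at equal intensities *)

Section Constants.
Context (R : realType).

Lemma union_prob_le (s : R) n : 0 <= s <= 1 -> 1 - (1 - s) ^+ n <= n%:R * s.
Proof.
move=> /andP[s0 s1]; elim: n => [|n IH]; first by rewrite expr0 subrr mul0r.
rewrite exprS -natr1.
have h0 : 0 <= (1 - s) ^+ n by rewrite exprn_ge0// subr_ge0.
have h1 : (1 - s) ^+ n <= 1 by rewrite exprn_ile1// ?subr_ge0// gerBl.
by nra.
Qed.

Lemma union_prob_gt0 (s : R) n : 0 < s <= 1 -> (0 < n)%N -> 0 < 1 - (1 - s) ^+ n.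
Proof.
move=> /andP[s0 s1] n0; rewrite subr_gt0 exprn_ilt1 ?subr_ge0// ?gtrBl//.
by rewrite -lt0n.
Qed.

(** At most [t] terms, each compared with the mass at [j] through [poisson_ratio]. *)
Lemma poisson_increment (mu u : R) N t j : 0 < mu -> 1 <= u -> mu^-1 <= u -> (0 < N)%N ->
  (j <= N)%N -> cumul (poisson_pmf mu) j - cumul (poisson_pmf mu) (j - t) <=
    t%:R * ((u * N%:R) ^+ t * poisson_pmf mu j).
Proof.
move=> m0 u1 muu N0 jN; elim: t => [|t IH]; first by rewrite subn0 subrr mul0r.
have uN : 1 <= u * N%:R by rewrite mulr_ege1// ler1n.
have p0 : 0 <= poisson_pmf mu j by exact/ltW/poisson_pmf_gt0.
have e0 : 0 <= (u * N%:R) ^+ t * poisson_pmf mu j.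
  by rewrite mulr_ge0// exprn_ge0// (le_trans ler01).
have e1 : (u * N%:R) ^+ t * poisson_pmf mu j <= (u * N%:R) ^+ t.+1 * poisson_pmf mu j.
  by rewrite ler_wpM2r// ler_weXn2l.
have IH' := le_trans IH (ler_wpM2l (ler0n R t) e1).
rewrite -natr1 mulrDl mul1r; case: (leqP t.+1 j) => tj; last first.
  have -> : (j - t.+1 = j - t)%N.
    by move: tj; rewrite ltnS -subn_eq0 => /eqP e; rewrite subnS e.
  by apply: le_trans IH' _; rewrite lerDl (le_trans e0).
have r := poisson_ratio m0 u1 muu N0 jN tj.
have -> : cumul (poisson_pmf mu) (j - t.+1) = cumul (poisson_pmf mu) (j - t) - poisson_pmf mu (j - t.+1).
  have -> : (j - t = (j - t.+1).+1)%N by rewrite subnSK.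
  by rewrite cumulS addrK.
by rewrite opprB addrCA addrC lerD.
Qed.

(** Discarding gains [eps] times the mass at [j] in each cumulative sum. The nets shift a fraction
    [net_prob] of the law by [m0] and so cost at most [net_prob * m0 * rho] times that mass; taking
    [sf] proportional to [eps], up to a power of [N], keeps the cost below the gain. *)
Lemma coupling_constants (q mu s1 : R) (g D : nat) : 0 < q < 1 -> 0 < mu -> 0 < s1 <= 1 ->
  (0 < g)%N ->
  exists (K : nat) (sf : R), let fr := frame q K g D s1 sf in
  [/\ 0 < sf <= 1, net_prob fr < 1,
     (forall j, (net_size fr <= j)%N -> (j <= K + net_size fr)%N ->
        net_prob fr * poisson_pmf mu (j - net_size fr) < poisson_pmf mu j * bulk K mu),
     (forall j, (0 < j <= K)%N ->
        cumul (poisson_pmf mu) j * bulk K mu - net_prob fr * cumul (poisson_pmf mu) (j - net_size fr) <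
        (1 - net_prob fr) * (cumul (poisson_pmf mu) j + isolation_prob fr * poisson_pmf mu j)) &
     1 - bulk K mu < sf ^+ block_size fr * s1 ^+ request_size fr].
Proof.
move=> /andP[q0 q1] mu0 /andP[s10 s11] g0.
pose m0 := (g * g)%N; pose B := ((2 * D).+1 * (2 * D).+1)%N.
have m0_gt0 : (0 < m0)%N by rewrite muln_gt0 g0.
have B_gt0 : (0 < B)%N by [].
have B0 : 0 < B%:R :> R by rewrite ltr0n.
pose u : R := 1 + mu^-1.
have mi : 0 < mu^-1 by rewrite invr_gt0.
have u1 : 1 <= u by rewrite lerDl ltW.
have u0 : 0 < u by exact: lt_le_trans ltr01 u1.
have muu : mu^-1 <= u by rewrite lerDr.
have sq1 : Num.sqrt q < 1 by rewrite -[ltRHS]sqrtr1 ltr_sqrt.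
pose r : R := (1 - Num.sqrt q) ^+ B.
have r0 : 0 < r by rewrite exprn_gt0// subr_gt0.
have r1 : r <= 1 by rewrite exprn_ile1 ?subr_ge0 ?(ltW sq1)// gerBl sqrtr_ge0.
(* [B] compensates the union bound on [net_prob], [u ^+ m0] the ratio [rho], [m0.+1] the number of
   terms of an increment, [expR (- mu)] the lower bound on [bulk]; the [4] leaves a strict
   margin. *)
pose c : R := expR (- mu) / (4 * m0.+1%:R * B%:R * u ^+ m0).
have c0 : 0 < c.
  by rewrite divr_gt0 ?expR_gt0// !mulr_gt0 ?exprn_gt0 ?ltr0n.
(* [request_size] is [c1 + c2 * K]: the constant part enters the prefactor, the linear part the
   geometric rate. *)
pose c1 := (B * m0 * 2 + B * m0 * (B * m0))%N.
pose c2 := (B * m0 * B)%N.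
have A0 : 0 < c ^+ B * s1 ^+ c1 by rewrite mulr_gt0 ?exprn_gt0.
have Rr0 : 0 < r ^+ B * s1 ^+ c2 by apply: mulr_gt0; apply: exprn_gt0.
(* The exponent [m0 * B] clears the denominator [N%:R ^+ m0] of [sf], which crowding raises to the
   power [B]. *)
have [K hK] := factorial_decay (m0 * B) m0 mu0 A0 Rr0.
pose N := (K + m0)%N.
have N0 : (0 < N)%N by rewrite addn_gt0 m0_gt0 orbT.
have NR : 0 < N%:R :> R by rewrite ltr0n.
(* [r ^+ K] is the isolation probability; [sf] makes [net_prob * rho], which bounds the
   intensity added by the nets, a small multiple of it. *)
pose sf : R := c * r ^+ K / N%:R ^+ m0.
exists K, sf => fr.
have sf0 : 0 < sf.
  by apply: divr_gt0; [apply: mulr_gt0 => //; exact: exprn_gt0|exact: exprn_gt0].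
pose rho : R := (u * N%:R) ^+ m0.
have rho1 : 1 <= rho by rewrite exprn_ege1// mulr_ege1// ler1n.
have rho0 : 0 < rho by exact: lt_le_trans ltr01 rho1.
have eE : isolation_prob fr = r ^+ K by rewrite /isolation_prob /= exprM.
have eps0 : 0 < r ^+ K by exact: exprn_gt0.
have eps1 : r ^+ K <= 1 by apply: exprn_ile1 => //; exact: ltW.
have key : B%:R * sf * rho = r ^+ K * expR (- mu) / (4 * m0.+1%:R).
  rewrite /sf /rho /c exprMn; field.
  by rewrite !expf_neq0 ?gt_eqF// pnatr_eq0.
have em1 : expR (- mu) <= 1 by rewrite -expR0 ler_expR oppr_le0 ltW.
have em0 : 0 < expR (- mu) by exact: expR_gt0.
have m1 : 1 <= m0.+1%:R :> R by rewrite ler1n.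
have keyle : B%:R * sf * rho * m0.+1%:R = r ^+ K * expR (- mu) / 4.
  rewrite key; have : m0.+1%:R != 0 :> R by rewrite pnatr_eq0.
  by move: (m0.+1%:R : R) => M M0; field.
have BS0 : 0 <= B%:R * sf by apply: mulr_ge0; exact: ltW.
have Bsf : B%:R * sf * rho <= r ^+ K * expR (- mu) / 4.
  by rewrite -keyle; apply: ler_peMr => //; apply: mulr_ge0 => //; exact: ltW.
have Bsf4 : B%:R * sf <= 4^-1.
  apply: (@le_trans _ _ (B%:R * sf * rho)); first exact: ler_peMr.
  apply: le_trans Bsf _; apply: ler_piMl => //; apply: mulr_ile1 => //; exact: ltW.
have sf1 : sf <= 1.
  have : sf <= B%:R * sf by rewrite ler_peMl ?ler1n// ltW.
  lra.
have nuB : net_prob fr <= B%:R * sf by apply: union_prob_le; rewrite (ltW sf0).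
have nu0 : 0 < net_prob fr by apply: union_prob_gt0 => //; rewrite sf0.
have Zle1 : bulk K mu <= 1 by apply: cumul_le1; exact: poisson_is_pmf.
have Zge : expR (- mu) <= bulk K mu.
  have h : cumul (poisson_pmf mu) 1 <= bulk K mu.
    by apply: (cumul_homo (poisson_is_pmf mu0)).
  apply: le_trans h; rewrite cumulS cumul0 add0r poisson_pmfE// /exp_coeff /=.
  by rewrite expr0 fact0 divr1 mul1r.
have nurho : net_prob fr * rho <= r ^+ K * expR (- mu) / 4.
  by apply: le_trans Bsf; rewrite ler_wpM2r// ltW.
split.
- by rewrite sf0.
- apply: le_lt_trans nuB _; lra.
- move=> j mj jK.
  have pj := poisson_pmf_gt0 j mu0.
  have rt := @poisson_ratio R mu u N m0 j mu0 u1 muu N0 jK mj.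
  apply: (@le_lt_trans _ _ (net_prob fr * (rho * poisson_pmf mu j))).
    by rewrite ler_wpM2l// ltW.
  (* It remains to place [net_prob * rho] below [expR (- mu)], the Poisson mass at 0, which bounds
     [bulk] from below. *)
  rewrite mulrA [ltRHS]mulrC ltr_pM2r//; apply: lt_le_trans Zge.
  apply: le_lt_trans nurho _.
  have : r ^+ K * expR (- mu) <= expR (- mu) by rewrite ler_piMl// ltW.
  lra.
- move=> j /andP[j0 jK].
  have jN : (j <= N)%N by exact: leq_trans jK (leq_addr _ _).
  have pj := poisson_pmf_gt0 j mu0.
  have inc := @poisson_increment mu u N m0 j mu0 u1 muu N0 jN.
  rewrite -/rho in inc; rewrite eE.
  have G0 : 0 <= cumul (poisson_pmf mu) j.
    by apply: sumr_ge0 => i _; exact/ltW/poisson_pmf_gt0.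
  set G := cumul (poisson_pmf mu) j in inc G0 *.
  set G' := cumul (poisson_pmf mu) (j - m0) in inc *.
  rewrite -/G'.
  have GZ : G * bulk K mu <= G by rewrite ler_piMr.
  (* Since [G * bulk <= G], the loss [net_prob * (G - G')] has to stay below [1 - net_prob] times
     the gain: at most a quarter of the gain against at least three quarters. *)
  have h1 : net_prob fr * (G - G') <= r ^+ K / 4 * poisson_pmf mu j.
    apply: (@le_trans _ _ (net_prob fr * (m0%:R * (rho * poisson_pmf mu j)))).
      by rewrite ler_wpM2l// ltW.
    have -> : net_prob fr * (m0%:R * (rho * poisson_pmf mu j)) =
      net_prob fr * rho * m0%:R * poisson_pmf mu j by ring.
    rewrite ler_wpM2r ?(ltW pj)//.
    apply: (@le_trans _ _ (B%:R * sf * rho * m0.+1%:R)).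
      apply: ler_pM => //; first by rewrite mulr_ge0// ltW.
        by rewrite ler_wpM2r// ltW.
      by rewrite ler_nat.
    by rewrite keyle ler_wpM2r// ler_piMr// ltW.
  have h2 : net_prob fr <= 4^-1 by exact: le_trans nuB Bsf4.
  have h3 : 3 / 4 * (r ^+ K * poisson_pmf mu j) <= (1 - net_prob fr) * (r ^+ K * poisson_pmf mu j).
    by rewrite ler_wpM2r// ?mulr_ge0 ?(ltW eps0) ?(ltW pj)//; lra.
  have h4 : 0 < r ^+ K * poisson_pmf mu j by rewrite mulr_gt0.
  have -> : (1 - net_prob fr) * (G + r ^+ K * poisson_pmf mu j) =
     G - net_prob fr * G + (1 - net_prob fr) * (r ^+ K * poisson_pmf mu j) by ring.
  have : net_prob fr * (G - G') = net_prob fr * G - net_prob fr * G' by ring.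
  move: h1 h3 h4 GZ; have -> : r ^+ K / 4 * poisson_pmf mu j = 4^-1 * (r ^+ K * poisson_pmf mu j) by ring.
  move: (G * bulk K mu) (r ^+ K * poisson_pmf mu j) (net_prob fr * G) (net_prob fr * G')
    (net_prob fr * (G - G')) => x1 x2 x3 x4 x5.
  move: ((1 - net_prob fr) * x2) => x6 *; lra.
- apply: le_lt_trans (poisson_tail K mu0) _.
  have NP : 0 < N%:R ^+ (m0 * B) :> R by rewrite exprn_gt0.
  rewrite -(ltr_pM2r NP); apply: lt_le_trans hK _.
  rewrite le_eqVlt; apply/orP; left; apply/eqP.
  have -> : request_size fr = (c1 + c2 * K)%N.
    by rewrite /request_size /= /block_size /net_size /= -/m0 -/B /c1 /c2 mulnDr addnA -!mulnA.
  rewrite exprD [s1 ^+ (c2 * K)]exprM [N%:R ^+ (m0 * B)]exprM -[block_size fr]/B /sf.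
  have : N%:R ^+ m0 != 0 :> R by rewrite gt_eqF// exprn_gt0.
  move: (N%:R ^+ m0 : R) (c) (r) => P x y P0; rewrite !exprMn exprVn (exprAC y K B).
  by field; exact: expf_neq0.
Qed.

End Constants.

(** * Separating the intensities, and conclusion *)

Lemma cvg_perturbation (R : realType) (mu c : R) :
  (fun n => mu + c * harmonic n) @ \oo --> mu.
Proof.
rewrite -[X in _ --> X]addr0 -[X in _ + X](mulr0 c).
by apply: cvgD; [exact: cvg_cst|apply: cvgMr; exact: cvg_harmonic].
Qed.

(** [K] and [sf] are fixed at intensity [mu]. The conditions then involve only labels up to
    [K + net_size], hence are finitely many strict inequalities between continuous functions of the
    intensities, and some common index of the perturbation satisfies them all. *)
Lemma coupling_across (R : realType) (q mu s1 a1 : R) (f : R -> R) (g D : nat) :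
  0 < q < 1 -> 0 < mu -> 0 < s1 <= 1 -> (0 < g)%N ->
  (forall r s, 0 <= r -> r <= s -> f s <= f r) ->
  (forall r, 0 <= r -> f r <= 1) ->
  (forall r, 0 <= r -> 0 < f r -> r + 1 <= D%:R) ->
  0 <= a1 -> 3 <= g%:R * a1 ->
  (forall K sf, let hp := item_prob (frame q K g D s1 sf) in
     [/\ 0 < hp < 1, hp < f a1 & hp <= g%:R^-1]) ->
  exists lam1 lam2 : R, [/\ mu < lam1, 0 < lam2 < mu &
    exists (d : measure_display) (T : measurableType d)
      (P : probability T R) (Y1 Y2 : idx -> T -> R),
    [/\ rcm_model P lam1 Y1, rcm_model P lam2 Y2 &
        infinite_component (fun r => q * f r) Y1 `<=` infinite_component f Y2]].
Proof.
move=> q01 mu0 s101 g0 fm f1 fr a10 ga1 hp.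
have [K [sf [sf01 nu1 c1 c2 c3]]] := coupling_constants D q01 mu0 s101 g0.
have [hp1 hp2 hp3] := hp K sf.
set cd := frame q K g D s1 sf in nu1 c1 c2 c3 hp1 hp2 hp3.
(* As [harmonic] is at most 1, the amplitude [mu / 2] keeps [l2] positive. *)
pose l1 n : R := mu + mu / 2 * harmonic n.
pose l2 n : R := mu + - (mu / 2) * harmonic n.
have h0 n : 0 < @harmonic R n by exact: harmonic_gt0.
have h1 n : @harmonic R n <= 1 by rewrite /harmonic invf_le1// ler1n.
have mu2 : 0 < mu / 2 by rewrite divr_gt0.
have l1mu n : mu < l1 n by rewrite ltrDl mulr_gt0.
have l10 n : 0 < l1 n by exact: lt_trans (l1mu n).
have l2mu n : 0 < l2 n < mu.
  rewrite /l2 mulNr gtrDl oppr_lt0 mulr_gt0// andbT.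
  have : mu / 2 * harmonic n <= mu / 2 by rewrite ler_piMr// ltW.
  by lra.
have l20 n : 0 < l2 n by case/andP: (l2mu n).
have cl1 : l1 @ \oo --> mu by exact: cvg_perturbation.
have cl2 : l2 @ \oo --> mu by exact: cvg_perturbation.
have cb : (fun n => bulk K (l1 n)) @ \oo --> bulk K mu by exact: cvg_cumul_poisson.
have n1 : \forall n \near \oo, forall j, (j < (K + net_size cd).+1)%N ->
    (net_size cd <= j)%N -> net_prob cd * poisson_pmf (l1 n) (j - net_size cd) <
      poisson_pmf (l2 n) j * bulk K (l1 n).
  apply: near_forall_lt => j; rewrite ltnS => jK.
  case: (leqP (net_size cd) j) => mj; last by apply: nearW.
  have := cvg_lt_near _ _ (c1 j mj jK); move/(_ (fun n => net_prob cd * poisson_pmf (l1 n) (j - net_size cd))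
    (fun n => poisson_pmf (l2 n) j * bulk K (l1 n))) => h.
  apply: filterS (h _ _) => //.
    by apply: cvgMr; exact: cvg_poisson.
  by apply: cvgM => //; exact: cvg_poisson.
have n2 : \forall n \near \oo, forall j, (j < K.+1)%N -> (0 < j)%N ->
    cumul (poisson_pmf (l2 n)) j * bulk K (l1 n) -
      net_prob cd * cumul (poisson_pmf (l1 n)) (j - net_size cd) <
    (1 - net_prob cd) * (cumul (poisson_pmf (l1 n)) j + isolation_prob cd * poisson_pmf (l1 n) j).
  apply: near_forall_lt => -[|j]; first by move=> _; apply: nearW.
  rewrite ltnS => jK.
  have h : \forall n \near \oo, cumul (poisson_pmf (l2 n)) j.+1 * bulk K (l1 n) -
      net_prob cd * cumul (poisson_pmf (l1 n)) (j.+1 - net_size cd) <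
    (1 - net_prob cd) * (cumul (poisson_pmf (l1 n)) j.+1 + isolation_prob cd * poisson_pmf (l1 n) j.+1).
    apply: (cvg_lt_near _ _ (c2 j.+1 jK)).
      apply: cvgB; first by apply: cvgM => //; exact: cvg_cumul_poisson.
      by apply: cvgMr; exact: cvg_cumul_poisson.
    apply: cvgMr; apply: cvgD; first exact: cvg_cumul_poisson.
    by apply: cvgMr; exact: cvg_poisson.
  by apply: filterS h.
have n3 : \forall n \near \oo, 1 - bulk K (l1 n) < sf ^+ block_size cd * s1 ^+ request_size cd.
  apply: (cvg_lt_near _ _ c3); last exact: cvg_cst.
  by apply: cvgB => //; exact: cvg_cst.
have [n [h1n h2n h3n]] : exists n, [/\ forall j, (j < (K + net_size cd).+1)%N ->
    (net_size cd <= j)%N -> net_prob cd * poisson_pmf (l1 n) (j - net_size cd) <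
      poisson_pmf (l2 n) j * bulk K (l1 n),
    forall j, (j < K.+1)%N -> (0 < j)%N ->
    cumul (poisson_pmf (l2 n)) j * bulk K (l1 n) -
      net_prob cd * cumul (poisson_pmf (l1 n)) (j - net_size cd) <
    (1 - net_prob cd) * (cumul (poisson_pmf (l1 n)) j + isolation_prob cd * poisson_pmf (l1 n) j) &
    1 - bulk K (l1 n) < sf ^+ block_size cd * s1 ^+ request_size cd].
  apply: (@filter_ex _ \oo); near=> n; split.
  - by near: n.
  - by near: n.
  - by near: n.
exists (l1 n), (l2 n); split => //.
apply: (@coupling_exists _ q K g D s1 sf _ _ q01 _ _ s101 sf01 nu1 _ _ _ f a1) => //.
- by move=> j mj jK; apply/ltW/h1n.
- by move=> j /andP[j0 jK]; apply/ltW/h2n.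
- exact: ltW.
Unshelve. all: by end_near.
Qed.

Theorem theorem3 (R : realType) (q0 : R) (f : R -> R) :
  0 < q0 < 1 ->
  (forall r, 0 <= r -> 0 <= f r <= 1) ->
  (forall r s, 0 <= r -> r <= s -> f s <= f r) ->
  has_sup [set a | 0 <= a /\ 0 < f a] ->
  0 < sup [set a | 0 <= a /\ 0 < f a] ->
  forall lam_f lam_q0f : R,
    critical_intensity f lam_f ->
    critical_intensity (fun r => q0 * f r) lam_q0f ->
    lam_f < lam_q0f.
Proof.
move=> q01 f01 fm hs s0 lf mu [lf0 _ sub] [mu0 sup _].
rewrite ltNge; apply/negP => mulf.
set S := [set a | _] in hs s0.
have [a1 [a10 fa1] a1p] := sup_gt hs.1 s0.
(* [g] exceeds [3 / a1], which makes points of touching squares closer than [a1]; [D] exceeds the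
   range of [f] plus the side of a cell. *)
pose g := (Num.truncn (3 / a1)).+1; pose D := (Num.truncn (reals.sup S + 1)).+1.
pose n := ((2 * D).+1 * (2 * D).+1)%N.
have g0 : 0 < g%:R :> R by rewrite ltr0n.
have n0 : 0 < n%:R :> R by rewrite ltr0n.
(* [n] is the size of a block, so the union bound gives [item_prob] at most [n%:R * s1 = e / 2],
   strictly below both [f a1] and [g%:R^-1]. *)
pose e := Num.min (f a1) g%:R^-1; pose s1 := e / (2 * n%:R).
have e0 : 0 < e by rewrite lt_min fa1 invr_gt0.
have ef : e <= f a1 by rewrite ge_min lexx.
have eg : e <= g%:R^-1 by rewrite ge_min lexx orbT.
have /andP[_ f1] := f01 _ a10.
have e1 : e <= 1 by exact: le_trans f1.
have n2 : 0 < 2 * n%:R :> R by rewrite mulr_gt0.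
have s10 : 0 < s1 by exact: divr_gt0.
have s11 : s1 <= 1.
  rewrite /s1 ler_pdivrMr// mul1r; apply: le_trans e1 _.
  have : 1 <= n%:R :> R by rewrite ler1n.
  lra.
have s101 : 0 < s1 <= 1 by rewrite s10.
have hpe : n%:R * s1 = e / 2.
  have : n%:R != 0 :> R by rewrite gt_eqF.
  by rewrite /s1; move: (n%:R : R) (e) => x y x0; field.
have [l1 [l2 [ml1 /andP[l20 l2m] [d [T [P [Y1 [Y2 [m1 m2 inc]]]]]]]]] :
  exists lam1 lam2 : R, [/\ mu < lam1, 0 < lam2 < mu &
    exists (d : measure_display) (T : measurableType d)
      (P : probability T R) (Y1 Y2 : idx -> T -> R),
    [/\ rcm_model P lam1 Y1, rcm_model P lam2 Y2 &
        infinite_component (fun r => q0 * f r) Y1 `<=` infinite_component f Y2]].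
  apply: (@coupling_across _ q0 mu s1 a1 f g D) => //.
  - by move=> r /f01 /andP[].
  - move=> r r0 fr; apply: le_trans (ltW (truncnS_gt _)); rewrite lerD2r.
    by apply: (sup_upper_bound hs).
  - by rewrite -ler_pdivrMr//; exact/ltW/truncnS_gt.
  - move=> K sf hp.
    have hp0 : 0 < hp by exact: union_prob_gt0.
    have hp1 : hp <= e / 2 by rewrite -hpe; apply: union_prob_le; rewrite (ltW s10).
    have e2 : e / 2 < e by lra.
    split; first by rewrite hp0 /=; lra.
    + by apply: le_lt_trans hp1 _; exact: lt_le_trans ef.
    + by apply: le_trans hp1 _; apply: le_trans (ltW e2) eg.
have [A [mA AY PA]] := sup _ ml1 _ _ _ _ m1.
have [B [mB BY PB]] := sub _ l20 (lt_le_trans l2m mulf) _ _ _ _ m2.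
have AB : A `&` B = set0.
  by apply/seteqP; split => // w [/AY /inc Yw /BY].
have := probability_le1 P (measurableU _ _ mA mB).
have -> : P (A `|` B) = (P A + P B)%E by exact: measureU.
by rewrite PA PB -EFinD lee_fin; lra.
Qed.
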